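(* Let $m:(0,\infty)\to(0,\infty)$ be a smooth non-increasing function such that $\int_0^\infty\frac{m(r)}{1+r}\,dr<\infty$ and such that $r\mapsto r\,m(r)$ is non-decreasing on $(0,1)$. There exist a time $T>0$ and a smooth function $\theta_0$ on $\mathbb{R}^2$ with $\|\theta_0\|_{C^2(\mathbb{R}^2)}\le 1$ such that for every modulus of continuity $\rho$ there exists a smooth, divergence-free, time-independent vector field $u$ on $\mathbb{R}^2$ with $\|u\|_{L^\infty(\mathbb{R}^2)}\le 1$ such that the smooth solution $\theta$ of $$\partial_t\theta+u\cdot\nabla\theta+\mathrm{P.V.}\int_{\mathbb{R}^2}\big(\theta(x)-\theta(x+y)\big)\frac{m(|y|)}{|y|^2}\,dy=0,\qquad\theta(0,\cdot)=\theta_0,$$ breaks the modulus $\rho$ at some time $t\le T$.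
   Context: A modulus of continuity is a continuous non-decreasing function $\rho:[0,\infty)\to[0,\infty)$ with $\rho(0)=0$. A function $\theta$ on $(t_0,t_1)\times\mathbb{R}^2$ breaks $\rho$ at time $t$ if there exist $x,y\in\mathbb{R}^2$ with $|\theta(t,x)-\theta(t,y)|>\rho(|x-y|)$. *)

(* Defs.v *)
From HB Require Import structures.
From mathcomp Require Import all_boot all_order all_algebra.
From mathcomp Require Import all_classical all_reals all_analysis.
Set Implicit Arguments. Unset Strict Implicit. Unset Printing Implicit Defensive.
Import Order.TTheory GRing.Theory Num.Theory.
Import numFieldNormedType.Exports.
Local Open Scope classical_set_scope.
Local Open Scope ring_scope.

Section Defs.
Variable R : realType.

Definition dT (F : R -> R -> R -> R) : R -> R -> R -> R :=
  fun t x y => derive1 (fun s => F s x y) t.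
Definition dX (F : R -> R -> R -> R) : R -> R -> R -> R :=
  fun t x y => derive1 (fun s => F t s y) x.
Definition dY (F : R -> R -> R -> R) : R -> R -> R -> R :=
  fun t x y => derive1 (fun s => F t x s) y.

Definition uncurry3 (F : R -> R -> R -> R) : R * R * R -> R :=
  fun p => F p.1.1 p.1.2 p.2.

Fixpoint Ck_on (D : R -> R -> R -> Prop) (k : nat) (F : R -> R -> R -> R)
  : Prop :=
  match k with
  | 0%N => forall t x y, D t x y -> {for (t, x, y), continuous (uncurry3 F)}
  | k'.+1 =>
      (forall t x y, D t x y ->
         [/\ derivable (fun s => F s x y) t 1,
             derivable (fun s => F t s y) x 1 &
             derivable (fun s => F t x s) y 1])
      /\ Ck_on D k' F /\ Ck_on D k' (dT F) /\ Ck_on D k' (dX F)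
      /\ Ck_on D k' (dY F)
  end.

Definition smooth_on (D : R -> R -> R -> Prop) (F : R -> R -> R -> R) :=
  forall k, Ck_on D k F.

Definition smooth1_on (D : R -> Prop) (f : R -> R) :=
  smooth_on (fun t _ _ => D t) (fun t _ _ => f t).
Definition smooth2 (f : R -> R -> R) :=
  smooth_on (fun _ _ _ => True) (fun _ x y => f x y).

Definition dx (f : R -> R -> R) : R -> R -> R :=
  fun x y => derive1 (fun s => f s y) x.
Definition dy (f : R -> R -> R) : R -> R -> R :=
  fun x y => derive1 (fun s => f x s) y.

Definition C2norm_le (f : R -> R -> R) (c : R) : Prop :=
  exists a0 a1 a2 a3 a4 a5 : R,
    (forall x y, `|f x y| <= a0) /\
    (forall x y, `|dx f x y| <= a1) /\
    (forall x y, `|dy f x y| <= a2) /\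
    (forall x y, `|dx (dx f) x y| <= a3) /\
    (forall x y, `|dx (dy f) x y| <= a4) /\
    (forall x y, `|dy (dy f) x y| <= a5) /\
    a0 + a1 + a2 + a3 + a4 + a5 <= c.

Definition enorm (x1 x2 : R) : R := Num.sqrt (x1 ^+ 2 + x2 ^+ 2).

Definition is_modulus (rho : R -> R) : Prop :=
  [/\ rho 0 = 0,
      (forall r, 0 <= r -> 0 <= rho r),
      {in [set r : R | 0 <= r] &, {homo rho : a b / a <= b}} &
      {within [set r : R | 0 <= r], continuous rho}].

Definition breaks (rho : R -> R) (theta : R -> R -> R -> R) (t : R) : Prop :=
  exists x1 x2 y1 y2 : R,
    `|theta t x1 x2 - theta t y1 y2| > rho (enorm (x1 - y1) (x2 - y2)).

Definition leb2 := ((@lebesgue_measure R) \x (@lebesgue_measure R))%E.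

Definition pv_integral (g : R * R -> R) (L : R) : Prop :=
  (forall e : R, 0 < e ->
     leb2.-integrable [set y : R * R | e < enorm y.1 y.2] (EFin \o g))
  /\ (fun e : R => Rintegral leb2 [set y : R * R | e < enorm y.1 y.2] g)
       @ 0^'+ --> L.

Definition is_solution (m : R -> R) (u1 u2 : R -> R -> R)
  (theta0 : R -> R -> R) (theta : R -> R -> R -> R) : Prop :=
  [/\ forall x1 x2, theta 0 x1 x2 = theta0 x1 x2,
      smooth_on (fun t _ _ => 0 < t) theta,
      (forall x1 x2 e, 0 < e -> exists2 d, 0 < d &
         forall t y1 y2, 0 < t < d -> `|y1 - x1| < d -> `|y2 - x2| < d ->
           `|theta t y1 y2 - theta0 x1 x2| < e),
      (exists M, forall t x1 x2, 0 <= t -> `|theta t x1 x2| <= M) &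
      (forall t x1 x2, 0 < t -> exists L,
         pv_integral (fun y => (theta t x1 x2 - theta t (x1 + y.1) (x2 + y.2))
                               * m (enorm y.1 y.2) / (enorm y.1 y.2) ^+ 2) L
         /\ dT theta t x1 x2 + u1 x1 x2 * dX theta t x1 x2
            + u2 x1 x2 * dY theta t x1 x2 + L = 0)].

End Defs.

(* Main.v *)
Require Import Defs.
From HB Require Import structures.
From mathcomp Require Import all_boot all_order all_algebra.
From mathcomp Require Import all_classical all_reals all_analysis.
From mathcomp Require Import measurable_realfun ring lra zify.
Set Implicit Arguments. Unset Strict Implicit. Unset Printing Implicit Defensive.
Import Order.TTheory GRing.Theory Num.Theory.
Import numFieldNormedType.Exports.
Local Open Scope classical_set_scope.
Local Open Scope ring_scope.

(* The datum is [ka * sin (n * x2)]; with [n * a = pi / 2], its caps around [(0, a)] and [(0, - a)] have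
   opposite signs. A cellular flow whose velocity nearly jumps at the origin carries both caps towards
   the origin at unit speed, so that at time [a - smin] they sit at [(0, smin)] and [(0, - smin)], for
   [smin] as small as the modulus requires. Each cap is followed by a barrier: a bump centered at
   [(0, +- (a - t))] of radius [(a - t) / 4], minus a time-dependent loss. The nonlocal operator costs
   [Gk r] on a bump of radius [r]; as the radius decreases linearly in time, the total loss is a
   multiple of the primitive [Hk (a / 4)] of [Gk], independently of [smin], and [Hk] tends to [0] at
   [0] because [m (r) / (1 + r)] is integrable. So for [n] large the caps keep most of their height.

   Solutions come from Galerkin approximations in the basis [cos (z . x) + sin (z . x)]: transport
   is antisymmetric there, weighted energy estimates give bounds on all derivatives that are uniform
   in the truncation, and the approximations converge along an ultrafilter. Boundedness for
   all times is the comparison principle with constants. *)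

(** * Radial integrals in the plane *)

(** The datum and the time bound must not depend on the modulus, the flow may. Hence the order of
    choices: [n] from [m] alone, then [smin] from the modulus, then the accuracy of the flow from
    [smin]. This works because [Gk] blows up at radius 0 but stays integrable there, so bringing the
    caps closer to the origin costs no further height.

    The conclusion is about every solution, and no uniqueness is proved: the barrier is compared
    with an arbitrary bounded solution, not assumed periodic. The contact point could then escape to
    infinity. A confining term of radius [rho] prevents this, and its cost disappears as [rho] tends
    to infinity. Barriers only bound from below; the negative cap is the same statement for
    [- theta], hence the sign [sg].

    A flow of unit speed on the axis that reverses at the origin is not smooth. Its stream function
    contains an inverse square root, and truncating the binomial series of that root keeps the speed
    at most 1 while giving a trigonometric polynomial, so that transport couples each Fourier mode
    to finitely many others. *)

Section Radial.
Variable R : realType.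
Local Notation mu := (@lebesgue_measure R).

Lemma measurable_opp_leb : measurable_fun setT (-%R : measurableTypeR R -> measurableTypeR R).
Proof. exact: oppr_measurable. Qed.

Lemma integral_reflect (f : R -> \bar R) : measurable_fun setT f ->
  (forall x, 0 <= f x)%E -> (\int[mu]_x f (- x)%R = \int[mu]_x f x)%E.
Proof.
move=> mf f0.
have := @ge0_integral_pushforward _ _ _ _ R _ measurable_opp_leb mu setT f measurableT mf.
move=> /(_ (fun y _ => f0 y)); rewrite preimage_setT => <-.
by apply: eq_measure_integral => //= A mA _; exact: lebesgue_measureN.
Qed.

Lemma integral_normr (f : R -> R) : measurable_fun setT f -> (forall x, 0 <= f x) ->
  (forall x, x <= 0 -> f x = 0) ->
  (\int[mu]_x (f `|x|)%:E = 2%:E * \int[mu]_x (f x)%:E)%E.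
Proof.
move=> mf f0 fz.
have -> : (\int[mu]_x (f `|x|)%:E = \int[mu]_x ((f x)%:E + (f (- x))%:E))%E.
  apply: eq_integral => x _; rewrite -EFinD; congr EFin.
  have [x0|x0] := ger0P x; first by rewrite (fz (- x)) ?addr0// oppr_le0.
  by rewrite (fz x) ?add0r // ltW.
have mfe : measurable_fun setT (fun x => (f x)%:E) by exact/measurable_EFinP.
rewrite ge0_integralD//; last 3 first.
- by move=> x _; rewrite lee_fin.
- by move=> x _; rewrite lee_fin.
- exact: (measurableT_comp mfe measurable_opp_leb).
rewrite (integral_reflect (f := fun x => (f x)%:E))//.
by rewrite mule_natl mule2n.
Qed.

Lemma measurable_enorm : measurable_fun setT (fun y : measurableTypeR R * measurableTypeR R => enorm y.1 y.2).
Proof.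
apply: measurableT_comp; first by apply: continuous_measurable_fun; exact: sqrt_continuous.
by apply: measurable_funD; apply: measurable_funX; [exact: measurable_fst|exact: measurable_snd].
Qed.

Lemma enorm_ge0 (a b : R) : 0 <= enorm a b. Proof. exact: sqrtr_ge0. Qed.

Lemma enorm_sqr (a b : R) : enorm a b ^+ 2 = a ^+ 2 + b ^+ 2.
Proof. by rewrite sqr_sqrtr// addr_ge0// sqr_ge0. Qed.

Lemma enorm_ge1 (a b : R) : `|a| <= enorm a b.
Proof. by rewrite -sqrtr_sqr ler_wsqrtr// lerDl sqr_ge0. Qed.

Lemma enorm_ge2 (a b : R) : `|b| <= enorm a b.
Proof. by rewrite -sqrtr_sqr ler_wsqrtr// lerDr sqr_ge0. Qed.

Section tonelli.
Variable kap : R -> R.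
Hypothesis mk : measurable_fun setT kap.
Hypothesis k0 : forall x, 0 <= kap x.
Hypothesis kz : forall x, x <= 0 -> kap x = 0.

(* The square cone [|b| <= |a|] has intervals as slices, and the Euclidean norm dominates [|a|] on it. *)
Let tri (a b : R) : R := kap `|a| * (`|b| <= `|a|)%R%:R.

Let tri_inner (a : R) : (\int[mu]_b (tri a b)%:E = (2 * (`|a| * kap `|a|))%:E)%E.
Proof.
rewrite (_ : (fun b => (tri a b)%:E) =
   (fun b => (kap `|a|)%:E * (\1_(`[- `|a|, `|a|]) b)%:E)%E); last first.
  apply/funext => b; rewrite /tri EFinM; congr (_ * _%:E)%E.
  by rewrite indicE mem_setE inE/= ler_norml.
rewrite ge0_integralZl//=; last by rewrite lee_fin.
  rewrite integral_indic//= setIT.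
  rewrite lebesgue_measure_itv/= lte_fin.
  case: ltP => [_|a0].
    by rewrite -EFinB opprK -EFinM -mulr2n -mulr_natl; congr EFin; ring.
  have -> : `|a| = 0 by apply/eqP; rewrite eq_le normr_ge0 andbT; have := normr_ge0 a; lra.
  by rewrite mule0 mul0r mulr0.
by apply/measurable_EFinP; exact: measurable_indic.
Qed.

Let mtri : measurable_fun setT (fun y : measurableTypeR R * measurableTypeR R => tri y.1 y.2).
Proof.
have mn1 : measurable_fun setT (fun y : measurableTypeR R * measurableTypeR R => `|y.1|).
  by apply: measurableT_comp; [exact: normr_measurable|exact: measurable_fst].
have mn2 : measurable_fun setT (fun y : measurableTypeR R * measurableTypeR R => `|y.2|).
  by apply: measurableT_comp; [exact: normr_measurable|exact: measurable_snd].
apply: measurable_funM; first exact: measurableT_comp mn1.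
rewrite (_ : (fun _ => _) = (fun y : R * R => if `|y.2| <= `|y.1| then 1 else 0)).
  apply: measurable_fun_ifT => //=.
  exact: measurable_fun_ler.
by apply/funext => y; case: ifP.
Qed.

Let tri_int : (\int[@leb2 R]_y (tri y.1 y.2)%:E = 4%:E * \int[mu]_r (r * kap r)%:E)%E.
Proof.
rewrite /leb2 fubini_tonelli1//=; last 2 first.
- exact/measurable_EFinP.
- by move=> x; rewrite lee_fin mulr_ge0.
rewrite /fubini_F /=.
under eq_integral do rewrite tri_inner.
have mrk : measurable_fun setT (fun r : R => r * kap r) by exact: measurable_funM.
rewrite (integral_normr (f := fun r => 2 * (r * kap r)))//; last 3 first.
- exact: measurable_funM.
- move=> x; have [x0|x0] := leP x 0; first by rewrite kz// !mulr0.
  by rewrite !mulr_ge0// ltW.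
- by move=> x x0; rewrite kz// !mulr0.
rewrite (_ : (fun r => (2 * (r * kap r))%:E) = (fun r => 2%:E * (r * kap r)%:E)%E)//.
rewrite ge0_integralZl//; last first.
- move=> x _; rewrite lee_fin.
  have [x0|x0] := leP x 0; first by rewrite kz// !mulr0.
  by rewrite !mulr_ge0// ltW.
- exact/measurable_EFinP.
by rewrite muleA -EFinM; congr (_%:E * _)%E; lra.
Qed.

(** The cones [|b| <= |a|] and [|a| <= |b|] cover the plane, and a decreasing [kap] only grows when
    the Euclidean norm is replaced by the larger coordinate. This avoids polar coordinates, at the
    price of 8 instead of 2 pi. *)
Lemma radial_le (kd : {in [set r | 0 < r] &, {homo kap : a b /~ a <= b}}) :
  (\int[@leb2 R]_y (kap (enorm y.1 y.2))%:E <= 8%:E * \int[mu]_r (r * kap r)%:E)%E.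
Proof.
have mtri' : measurable_fun setT (fun y : measurableTypeR R * measurableTypeR R => tri y.2 y.1).
  exact: (measurableT_comp mtri (@measurable_swap _ _ _ _)).
have swapE : (\int[@leb2 R]_y (tri y.2 y.1)%:E = 4%:E * \int[mu]_r (r * kap r)%:E)%E.
  rewrite -tri_int /leb2 fubini_tonelli2//=; last 2 first.
  - exact/measurable_EFinP.
  - by move=> x; rewrite lee_fin mulr_ge0.
  rewrite fubini_tonelli1//=.
  - exact/measurable_EFinP.
  - by move=> x; rewrite lee_fin mulr_ge0.
apply: (@le_trans _ _ (\int[@leb2 R]_y ((tri y.1 y.2)%:E + (tri y.2 y.1)%:E))%E).
  apply: ge0_le_integral => //.
  - by move=> x _; rewrite lee_fin.
  - by apply/measurable_EFinP; apply: measurableT_comp => //; exact: measurable_enorm.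
  - by apply: emeasurable_funD; exact/measurable_EFinP.
  move=> [a b] _ /=; rewrite -EFinD lee_fin /tri.
  wlog ab : a b / `|b| <= `|a|.
    move=> h; case/orP: (le_total `|b| `|a|) => [/h//|/(h b a)].
    by rewrite addrC /enorm (addrC (b ^+ 2)).
  have [a0|a0] := eqVneq a 0.
    have : b = 0 by move: ab; rewrite a0 normr0 normr_le0 => /eqP.
    by rewrite a0 => ->; rewrite /enorm expr0n addr0 sqrtr0 kz// !normr0 kz// !mul0r addr0.
  rewrite ab mulr1; apply: (@le_trans _ _ (kap `|a|)).
    have na : 0 < `|a| by rewrite normr_gt0.
    apply: kd; rewrite ?inE//=; last exact: enorm_ge1.
    exact: (lt_le_trans na (enorm_ge1 _ _)).
  by rewrite lerDl mulr_ge0.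
rewrite ge0_integralD//; last 4 first.
- by move=> x _; rewrite lee_fin mulr_ge0.
- exact/measurable_EFinP.
- by move=> x _; rewrite lee_fin mulr_ge0.
- exact/measurable_EFinP.
rewrite swapE tri_int -ge0_muleDl ?lee_fin// -EFinD.
by rewrite (_ : 4 + 4 = 8 :> R)//; lra.
Qed.

End tonelli.
End Radial.

(** * Cost of the nonlocal operator on a bump *)

Section Kernel.
Variable R : realType.
Local Notation mu := (@lebesgue_measure R).
Variable m : R -> R.
Hypothesis m0 : forall r, 0 < r -> 0 < m r.
Hypothesis mc : forall r, 0 < r -> {for r, continuous m}.
Hypothesis md : forall r s, 0 < r -> r <= s -> m s <= m r.
Hypothesis mint : (\int[mu]_(r in [set r : R | (0 < r)%R]) (m r / (1 + r))%:E < +oo)%E.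

(** Extension of [m] by 0: the hypotheses constrain [m] on the positive half-line only, and [mpos]
    is measurable everywhere. *)
Definition mpos (r : R) : R := if 0 < r then m r else 0.

Lemma mposE r : 0 < r -> mpos r = m r. Proof. by rewrite /mpos => ->. Qed.

Lemma mpos_le0 r : r <= 0 -> mpos r = 0. Proof. by rewrite /mpos ltNge => ->. Qed.

Lemma mpos_ge0 r : 0 <= mpos r.
Proof. by rewrite /mpos; case: ifP => // /m0/ltW. Qed.

Lemma measurable_mpos : measurable_fun setT mpos.
Proof.
have -> : mpos = m \_ [set r | 0 < r].
  by apply/funext => r; rewrite /mpos patchE mem_setE.
have oP : open [set r : R | 0 < r] by exact: open_gt.
apply/(measurable_restrictT _ _).1; first exact: open_measurable.
apply: open_continuous_measurable_fun => //.
by move=> r; rewrite inE => r0; exact: mc.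
Qed.

Lemma measurable_invr : measurable_fun setT (fun r : R => r^-1).
Proof.
have -> : (fun r : R => r^-1) = (fun r : R => r^-1) \_ [set r | r != 0].
  apply/funext => r; rewrite patchE; case: ifPn => //; rewrite notin_setE/=.
  by move/negP; rewrite negbK => /eqP ->; rewrite invr0.
have oP : open [set r : R | r != 0] by exact: open_neq.
apply/(measurable_restrictT _ _).1; first exact: open_measurable.
apply: open_continuous_measurable_fun => //.
by move=> r; rewrite inE => r0; exact: inv_continuous.
Qed.

(** Radial form of integration against [m |y| / |y|^2] in the plane: the factor [r] of the area
    element leaves [m r / r]. *)
Definition wint (al : R -> R) : \bar R := (\int[mu]_r (al r * (mpos r / r))%:E)%E.

Lemma measurable_wint (al : R -> R) : measurable_fun setT al ->
  measurable_fun setT (fun r => al r * (mpos r / r)).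
Proof.
move=> ma; apply: measurable_funM => //; apply: measurable_funM.
  exact: measurable_mpos.
exact: measurable_invr.
Qed.

Lemma base_int : mu.-integrable setT (fun r => (mpos r / (1 + r))%:E).
Proof.
apply/integrableP; split.
  apply/measurable_EFinP; apply: measurable_funM; first exact: measurable_mpos.
  by apply: (measurableT_comp measurable_invr); exact: measurable_funD.
apply: le_lt_trans mint; rewrite [leRHS]integral_mkcond.
rewrite le_eqVlt; apply/orP; left; apply/eqP; apply: eq_integral => r _.
rewrite patchE /mpos; case: ifPn => r0.
  by rewrite mem_set//= ger0_norm// mulr_ge0 ?invr_ge0 ?ltW ?m0// addr_gt0.
by rewrite memNset/= ?mul0r ?normr0//; exact/negP.
Qed.

(** Since [min 1 r / r <= 2 / (1 + r)], a bounded weight that vanishes linearly at 0 is controlled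
    by the integrable [m r / (1 + r)]. *)
Lemma wint_dom c al r : (forall x, 0 < x -> 0 <= al x <= c * Num.min 1 x) -> 0 <= c ->
  0 <= al r * (mpos r / r) <= 2 * c * (mpos r / (1 + r)).
Proof.
move=> ha c0; have [r0|r0] := leP r 0; first by rewrite mpos_le0// !mul0r !mulr0 lexx.
have [h1 h2] := andP (ha _ r0).
have mp := mpos_ge0 r.
rewrite mulr_ge0//=; last by rewrite divr_ge0// ltW.
have -> : al r * (mpos r / r) = mpos r * (al r / r) by lra.
have -> : 2 * c * (mpos r / (1 + r)) = mpos r * (2 * c / (1 + r)) by lra.
apply: ler_wpM2l => //.
rewrite ler_pdivrMr// mulrAC ler_pdivlMr ?addr_gt0//.
apply: le_trans (ler_wpM2r _ h2) _; first by rewrite addr_ge0// ltW.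
rewrite -!mulrA mulrCA; apply: ler_wpM2l => //.
by rewrite /Num.min; case: ltP => h; nra.
Qed.

Lemma wint_integrable c (al : R -> R) : measurable_fun setT al ->
  (forall x, 0 < x -> 0 <= al x <= c * Num.min 1 x) -> 0 <= c ->
  mu.-integrable setT (fun r => (al r * (mpos r / r))%:E).
Proof.
move=> ma ha c0.
apply: le_integrable (integrableZl measurableT (2 * c) base_int) => //.
  by apply/measurable_EFinP; exact: measurable_wint.
move=> r _; rewrite lee_fin.
have /andP[h1 h2] := wint_dom r ha c0.
by rewrite ger0_norm// ger0_norm// (le_trans h1).
Qed.

(** As [m] is non-increasing, monotonicity of [al r / r^2] makes the whole integrand non-increasing,
    as [radial_le] requires. *)
Lemma wint_radial (al : R -> R) : measurable_fun setT al -> (forall x, 0 <= al x) ->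
  (forall a b, 0 < a -> a <= b -> al b / b ^+ 2 <= al a / a ^+ 2) ->
  (\int[@leb2 R]_y (al (enorm y.1 y.2) * (mpos (enorm y.1 y.2) / enorm y.1 y.2 ^+ 2))%:E
     <= 8%:E * wint al)%E.
Proof.
move=> ma a0 ad.
pose kap r := al r * (mpos r / r ^+ 2).
have -> : wint al = (\int[mu]_r (r * kap r)%:E)%E.
  apply: eq_integral => r _; congr EFin; rewrite /kap.
  have [r0|r0] := leP r 0; first by rewrite mpos_le0// !mul0r !mulr0.
  by field; rewrite gt_eqF.
apply: (radial_le (kap := kap)).
- apply: measurable_funM => //; apply: measurable_funM; first exact: measurable_mpos.
  by apply: (measurableT_comp measurable_invr); exact: measurable_funX.
- by move=> x; rewrite mulr_ge0// divr_ge0 ?mpos_ge0// sqr_ge0.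
- by move=> x x0; rewrite /kap mpos_le0// mul0r mulr0.
- move=> a b; rewrite !inE/= => a0' b0' ab.
  rewrite /kap !mposE// mulrCA [leRHS]mulrCA; apply: ler_pM => //.
  + by rewrite ltW ?m0.
  + by rewrite divr_ge0 ?sqr_ge0.
  + exact: md.
  + exact: ad.
Qed.

Lemma wint_ge0 (al : R -> R) : (forall x, 0 < x -> 0 <= al x) -> (0 <= wint al)%E.
Proof.
move=> a0; apply: integral_ge0 => r _; rewrite lee_fin.
have [r0|r0] := leP r 0; first by rewrite mpos_le0// mul0r mulr0.
by rewrite mulr_ge0 ?a0// divr_ge0 ?mpos_ge0// ltW.
Qed.

Lemma wint_fin c (al : R -> R) : measurable_fun setT al ->
  (forall x, 0 < x -> 0 <= al x <= c * Num.min 1 x) -> 0 <= c ->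
  wint al \is a fin_num.
Proof. by move=> ma ha c0; apply: integrable_fin_num => //; exact: (wint_integrable ma ha). Qed.

(** Dominated convergence with the majorant of [wint_dom]. The rate only serves pointwise
    convergence, so [b] is arbitrary. It is applied with radii tending to 0 in [Hk_small] and to
    infinity in [Gk_small]. *)
Lemma wint_small c (al : nat -> R -> R) (b : R -> R) : (forall n, measurable_fun setT (al n)) ->
  (forall n x, 0 < x -> 0 <= al n x <= c * Num.min 1 x) -> 0 <= c ->
  (forall n x, 0 < x -> al n x <= b x / n.+1%:R) ->
  forall e, 0 < e -> exists n, fine (wint (al n)) <= e.
Proof.
move=> ma ha c0 hb e e0.
pose f_ n (r : measurableTypeR R) : \bar R := (al n r * (mpos r / r))%:E.
have mf n : measurable_fun setT (f_ n) by apply/measurable_EFinP; exact: measurable_wint.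
have h1 : {ae mu, forall x : measurableTypeR R, setT x -> f_ ^~ x @ \oo --> (cst 0%E : measurableTypeR R -> \bar R) x}.
  apply: aeW => r _ /=.
    have [r0|r0] := leP r 0.
      have -> : f_ ^~ r = cst 0%E; last exact: cvg_cst.
      by apply/funext => n; rewrite /f_ mpos_le0// mul0r mulr0.
    apply/cvg_EFin; first by near=> n.
    have h0 : (fun n => b r * (mpos r / r) * n.+1%:R^-1) @ \oo --> (0 : R).
      rewrite -[X in _ --> X](mulr0 (b r * (mpos r / r))).
      by apply: cvgMr; exact: cvg_harmonic.
    apply: (squeeze_cvgr _ (cvg_cst 0) h0).
    apply: nearW => n /=.
    have p0 : 0 <= mpos r / r by rewrite divr_ge0 ?mpos_ge0// ltW.
    have /andP[q0 _] := ha n r r0.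
    rewrite mulr_ge0//= mulrAC; apply: ler_wpM2r => //; exact: hb.
have h2 : {ae mu, forall (x : measurableTypeR R) n, setT x -> (`|f_ n x| <= (2 * c)%:E * (mpos x / (1 + x))%:E)%E}.
  apply: aeW => r n _; rewrite -EFinM lee_fin.
  have /andP[h1' h2'] := wint_dom r (ha n) c0.
  by rewrite ger0_norm.
have [_ _ cv] := dominated_convergence measurableT mf (measurable_cst _) h1
   (integrableZl measurableT (2 * c) base_int) h2.
have : fine (wint (al n)) @[n --> \oo] --> (0 : R).
  move: cv; rewrite integral0 => cv.
  by apply: (@fine_cvg _ _ _ _ (fun n => wint (al n)) 0).
move/cvgrPdist_lt => /(_ _ e0) [n _ /(_ n (leqnn n))] /=.
rewrite sub0r normrN => h; exists n.
exact: (le_trans (ler_norm _) (ltW h)).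
Unshelve. all: by end_near. Qed.

(* [aR r rho] controls the second differences at distance [rho] of a bump of radius [r], and
   [hR ^~ rho] is a primitive of [aR ^~ rho]: hence [Hk] is a primitive of [Gk]. *)
Definition aR (r rho : R) : R := Num.min 1 (rho ^+ 2 / r ^+ 2).
Definition hR (r rho : R) : R := if r <= rho then r else 2 * rho - rho ^+ 2 / r.

Lemma measurable_aR r : measurable_fun setT (aR r).
Proof.
by apply: measurable_minr => //; apply: measurable_funM => //; exact: measurable_funX.
Qed.

Lemma measurable_hR r : measurable_fun setT (hR r).
Proof.
apply: measurable_fun_ifT => //.
- exact: measurable_fun_ler.
- apply: measurable_funB; first exact: measurable_funM.
  by apply: measurable_funM => //; exact: measurable_funX.
Qed.

Lemma aR_ge0 r rho : 0 <= aR r rho.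
Proof. by rewrite le_min ler01 divr_ge0 ?sqr_ge0. Qed.

Lemma aR_le1 r rho : aR r rho <= 1.
Proof. by rewrite ge_min lexx. Qed.

Lemma aR_le r x : 0 < r -> 0 < x -> 0 <= aR r x <= (1 + r^-1) * Num.min 1 x.
Proof.
move=> r0 x0; rewrite aR_ge0/=.
have ir0 : 0 < r^-1 by rewrite invr_gt0.
have tx : 0 < x / r by rewrite divr_gt0.
have h : aR r x <= x / r.
  rewrite /aR -exprVn -exprMn ge_min; case: (leP 1 (x / r)) => //= h.
  by nra.
have := aR_le1 r x; case: (leP 1 x) => h1 h2; first by lra.
by apply: le_trans h _; rewrite mulrC; nra.
Qed.

Lemma aR_sq r a b : 0 < a -> a <= b -> aR r b / b ^+ 2 <= aR r a / a ^+ 2.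
Proof.
move=> a0 ab; have b0 := lt_le_trans a0 ab.
have [r0|r0] := eqVneq r 0.
  rewrite /aR r0 expr0n invr0 !mulr0 /Num.min.
  by case: ltP => [h|_]; [have := ltr10 R; rewrite h | rewrite !mul0r].
have h c : 0 < c -> aR r c / c ^+ 2 = Num.min (c ^+ 2)^-1 (r ^+ 2)^-1.
  move=> c0; rewrite /aR minr_pMl ?invr_ge0 ?sqr_ge0//; congr Num.min; first by rewrite mul1r.
  by rewrite mulrAC divff ?mul1r// expf_neq0// gt_eqF.
rewrite !h// le_min2// lef_pV2 ?posrE ?exprn_gt0//.
by rewrite lerXn2r// nnegrE ltW.
Qed.

Lemma hR_le r x : 0 < r -> 0 < x -> 0 <= hR r x <= (2 + r) * Num.min 1 x.
Proof.
move=> r0 x0; rewrite /hR; case: (leP r x) => h.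
  by rewrite ltW//=; case: (leP 1 x) => h1; nra.
have e : x ^+ 2 / r = x * (x / r) by rewrite expr2 mulrA.
have t0 : 0 < x / r by rewrite divr_gt0.
have t1 : x / r < 1 by rewrite ltr_pdivrMr// mul1r.
have xr : x = r * (x / r) by rewrite mulrCA divff ?mulr1// gt_eqF.
rewrite e; apply/andP; split; first by nra.
case: (leP 1 x) => h1; last by nra.
rewrite mulr1; set t := x / r in t0 t1 xr *.
have -> : 2 * x - x * t = r * (1 - (1 - t) ^+ 2) by rewrite {1 2}xr; ring.
have := sqr_ge0 (1 - t); nra.
Qed.

Lemma hR_le_r r x : 0 < r -> 0 < x -> hR r x <= r.
Proof.
move=> r0 x0; rewrite /hR; case: (leP r x) => h//.
set t := x / r; have xr : x = r * t by rewrite /t mulrCA divff ?mulr1// gt_eqF.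
have -> : 2 * x - x ^+ 2 / r = r * (1 - (1 - t) ^+ 2).
  by rewrite expr2 -mulrA -/t xr; ring.
have := sqr_ge0 (1 - t); nra.
Qed.

Lemma hR_mono r s x : 0 < r -> r <= s -> 0 < x -> hR r x <= hR s x.
Proof.
move=> r0 rs x0; have s0 := lt_le_trans r0 rs.
rewrite {2}/hR; case: (leP s x) => h.
  by rewrite /hR (le_trans rs h).
rewrite /hR; case: (leP r x) => h'.
  suff : 0 <= s * (2 * x - x ^+ 2 / s - r) by rewrite pmulr_rge0// subr_ge0.
  have -> : s * (2 * x - x ^+ 2 / s - r) = 2 * x * s - x ^+ 2 - r * s by field; rewrite gt_eqF.
  nra.
by rewrite lerD2l lerN2 ler_wpM2l ?sqr_ge0// lef_pV2.
Qed.

(** Discrete form of [hR' = aR] in the radius: between [r] and [2 r] the value of [aR] drops by a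
    factor 4 at most. *)
Lemma hR_incr r s x : 0 < r -> 0 < s -> s <= r -> 0 < x ->
  s / 4 * aR r x <= hR (r + s) x - hR r x.
Proof.
move=> r0 s0 sr x0; have rs0 : 0 < r + s by rewrite addr_gt0.
have a1 := aR_le1 r x; have a0 := aR_ge0 r x.
rewrite /hR; case: (leP (r + s) x) => h.
  have -> : r <= x by lra.
  by nra.
case: (leP r x) => h'.
  have : s / 4 <= 2 * x - x ^+ 2 / (r + s) - r.
    suff : 0 <= (r + s) * (2 * x - x ^+ 2 / (r + s) - r - s / 4).
      by rewrite pmulr_rge0// subr_ge0.
    have -> : (r + s) * (2 * x - x ^+ 2 / (r + s) - r - s / 4) =
      (r + s) * (2 * x - r - s / 4) - x ^+ 2 by field; rewrite gt_eqF.
    have : 0 <= (x - r) * (r + s - x) by rewrite mulr_ge0//; lra.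
    nra.
  by nra.
have -> : 2 * x - x ^+ 2 / (r + s) - (2 * x - x ^+ 2 / r) = x ^+ 2 * s / (r * (r + s)).
  by field; rewrite !gt_eqF.
have hh : aR r x <= x ^+ 2 / r ^+ 2 by rewrite ge_min lexx orbT.
apply: le_trans (ler_wpM2l _ hh) _; first by rewrite divr_ge0// ltW.
have -> : s / 4 * (x ^+ 2 / r ^+ 2) = (x ^+ 2 * s) * (4 * r ^+ 2)^-1.
  by field; rewrite gt_eqF.
apply: ler_wpM2l; first by rewrite mulr_ge0 ?sqr_ge0// ltW.
by rewrite lef_pV2 ?posrE ?mulr_gt0 ?exprn_gt0//; nra.
Qed.

(** The 8 is that of [radial_le]: [Gk r] bounds the plane integral of [aR r |y|] against the
    kernel. *)
Definition Gk r := 8 * fine (wint (aR r)).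
Definition Hk r := 8 * fine (wint (hR r)).

Lemma Gk_ge0 r : 0 <= Gk r.
Proof. by rewrite mulr_ge0// fine_ge0// wint_ge0// => x _; exact: aR_ge0. Qed.

Lemma Hk_ge0 r : 0 < r -> 0 <= Hk r.
Proof.
by move=> r0; rewrite mulr_ge0// fine_ge0// wint_ge0// => x x0; case/andP: (hR_le r0 x0).
Qed.

Lemma wint_aR_fin r : 0 < r -> wint (aR r) \is a fin_num.
Proof.
move=> r0; apply: (@wint_fin (1 + r^-1)); first exact: measurable_aR.
  by move=> x x0; exact: aR_le.
by rewrite addr_ge0// invr_ge0 ltW.
Qed.

Lemma hR_integrable r : 0 < r -> mu.-integrable setT (fun x => (hR r x * (mpos x / x))%:E).
Proof.
move=> r0; apply: (@wint_integrable (2 + r)); first exact: measurable_hR.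
  by move=> x x0; exact: hR_le.
by rewrite addr_ge0// ltW.
Qed.

Lemma aR_integrable r : 0 < r -> mu.-integrable setT (fun x => (aR r x * (mpos x / x))%:E).
Proof.
move=> r0; apply: (@wint_integrable (1 + r^-1)); first exact: measurable_aR.
  by move=> x x0; exact: aR_le.
by rewrite addr_ge0// invr_ge0 ltW.
Qed.

(** The barrier needs only this one-sided estimate of increments, so [Hk] is never differentiated
    under the integral. *)
Lemma Hk_incr r s : 0 < r -> 0 < s -> s <= r -> s / 4 * Gk r <= Hk (r + s) - Hk r.
Proof.
move=> r0 s0 sr; have rs0 : 0 < r + s by rewrite addr_gt0.
rewrite /Gk /Hk -mulrBr mulrCA ler_pM2l// /wint.
have -> : s / 4 * fine (\int[mu]_x (aR r x * (mpos x / x))%:E)%E =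
   Rintegral mu setT (fun x => s / 4 * (aR r x * (mpos x / x))).
  by rewrite RintegralZl//; exact: aR_integrable.
have -> : fine (\int[mu]_x (hR (r + s) x * (mpos x / x))%:E)%E - fine (\int[mu]_x (hR r x * (mpos x / x))%:E)%E =
   Rintegral mu setT (fun x => hR (r + s) x * (mpos x / x) - hR r x * (mpos x / x)).
  by rewrite RintegralB//; exact: hR_integrable.
apply: le_Rintegral => //.
- exact: (integrableZl measurableT (s / 4) (aR_integrable r0)).
- exact: (integrableB measurableT (hR_integrable rs0) (hR_integrable r0)).
move=> x _; rewrite -mulrBl [leLHS]mulrA.
have [x0|x0] := leP x 0; first by rewrite mpos_le0// mul0r !mulr0.
by rewrite ler_wpM2r ?hR_incr// divr_ge0 ?mpos_ge0// ltW.
Qed.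

Lemma Hk_mono r s : 0 < r -> r <= s -> Hk r <= Hk s.
Proof.
move=> r0 rs; have s0 := lt_le_trans r0 rs; rewrite ler_pM2l//.
apply: le_Rintegral => //; [exact: hR_integrable|exact: hR_integrable|move=> x _].
have [x0|x0] := leP x 0; first by rewrite mpos_le0// mul0r !mulr0.
by rewrite ler_wpM2r ?hR_mono// divr_ge0 ?mpos_ge0// ltW.
Qed.

(** Pointwise, [hR r] is at most [r]; for [r <= 1] the majorant [2 + r] becomes 3. This is what
    makes a sufficiently concentrated cap keep most of its height. *)
Lemma Hk_small e : 0 < e -> exists2 d, 0 < d & forall r, 0 < r -> r <= d -> Hk r <= e.
Proof.
move=> e0.
have [|||||n hn] := @wint_small 3 (fun n => hR n.+1%:R^-1) (fun=> 1) _ _ _ _ (e / 8).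
- by move=> n; exact: measurable_hR.
- move=> n x x0; have n0 : 0 < n.+1%:R^-1 :> R by rewrite invr_gt0.
  have /andP[-> h] := hR_le n0 x0; apply: le_trans h _.
  rewrite ler_wpM2r//; first by rewrite le_min ler01 ltW.
  have : n.+1%:R^-1 <= 1 :> R by rewrite invf_le1// ler1n.
  by move: (n.+1%:R^-1) => z; lra.
- by [].
- by move=> n x x0; rewrite mul1r; apply: hR_le_r => //; rewrite invr_gt0.
- by rewrite divr_gt0.
exists n.+1%:R^-1; first by rewrite invr_gt0.
move=> r r0 rn; apply: le_trans (Hk_mono r0 rn) _.
by rewrite /Hk; lra.
Qed.

(** Second differences of a bump at a fixed distance fade like the inverse square of its radius. The
    confining bump, which may be taken as wide as desired, thus costs almost nothing. *)
Lemma Gk_small K e : 1 <= K -> 0 < e -> exists2 r, K <= r & Gk r <= e.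
Proof.
move=> K1 e0; have K0 : 0 < K by exact: lt_le_trans K1.
have nK n : 1 <= n.+1%:R * K by rewrite mulr_ege1// ler1n.
have [|||||n hn] := @wint_small 2 (fun n => aR (n.+1%:R * K)) (fun x => x ^+ 2) _ _ _ _ (e / 8).
- by move=> n; exact: measurable_aR.
- move=> n x x0; have n0 : 0 < n.+1%:R * K by exact: lt_le_trans (nK n).
  have /andP[-> h] := aR_le n0 x0; apply: le_trans h _.
  rewrite ler_wpM2r//; first by rewrite le_min ler01 ltW.
  have : (n.+1%:R * K)^-1 <= 1 by rewrite invf_le1.
  by move: (n.+1%:R * K)^-1 => z; lra.
- by [].
- move=> n x x0; rewrite /aR ge_min; apply/orP; right.
  rewrite ler_wpM2l ?sqr_ge0// lef_pV2 ?posrE ?exprn_gt0//; last by rewrite mulr_gt0.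
  apply: le_trans (_ : n.+1%:R * K <= _); first by rewrite ler_peMr.
  by rewrite -[leLHS]expr1 ler_weXn2l.
- by rewrite divr_gt0.
exists (n.+1%:R * K); first by rewrite ler_peMl ?ler1n// ltW.
by rewrite /Gk; lra.
Qed.

Lemma aR_mono r s x : 0 < r -> r <= s -> aR s x <= aR r x.
Proof.
move=> r0 rs; have s0 := lt_le_trans r0 rs; rewrite /aR le_min2//.
rewrite ler_wpM2l ?sqr_ge0// lef_pV2 ?posrE ?exprn_gt0//.
by rewrite lerXn2r// nnegrE ltW.
Qed.

Lemma Gk_mono r s : 0 < r -> r <= s -> Gk s <= Gk r.
Proof.
move=> r0 rs; have s0 := lt_le_trans r0 rs; rewrite ler_pM2l//.
apply: le_Rintegral => //; [exact: aR_integrable|exact: aR_integrable|move=> x _].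
have [x0|x0] := leP x 0; first by rewrite mpos_le0// mul0r !mulr0.
by rewrite ler_wpM2r ?aR_mono// divr_ge0 ?mpos_ge0// ltW.
Qed.

Lemma hR_lip r s x : 0 < r -> r <= s -> 0 < x -> hR s x - hR r x <= (s - r) * aR r x.
Proof.
move=> r0 rs x0; have s0 := lt_le_trans r0 rs.
have hs := hR_le_r s0 x0.
rewrite {2}/hR; case: (leP r x) => h.
  have -> : aR r x = 1; last by lra.
  apply/eqP; rewrite eq_le aR_le1/= le_min lexx/= ler_pdivlMr ?exprn_gt0// mul1r.
  by rewrite lerXn2r// nnegrE ltW.
have -> : aR r x = x ^+ 2 / r ^+ 2.
  apply: min_r; rewrite ler_pdivrMr ?exprn_gt0// mul1r.
  by rewrite lerXn2r ?nnegrE ?ltW.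
have -> : hR s x = 2 * x - x ^+ 2 / s by rewrite /hR leNgt (lt_le_trans h rs).
have -> : 2 * x - x ^+ 2 / s - (2 * x - x ^+ 2 / r) = (s - r) * x ^+ 2 * (r * s)^-1.
  by field; rewrite !gt_eqF.
rewrite [leRHS]mulrA; apply: ler_wpM2l; first by rewrite mulr_ge0 ?sqr_ge0// subr_ge0.
by rewrite lef_pV2 ?posrE ?mulr_gt0 ?exprn_gt0//; nra.
Qed.

(** Upper counterpart of [Hk_incr], from which the continuity of the barrier in time follows. *)
Lemma Hk_lip r s : 0 < r -> r <= s -> Hk s - Hk r <= (s - r) * Gk r.
Proof.
move=> r0 rs; have s0 := lt_le_trans r0 rs.
rewrite /Gk /Hk -mulrBr mulrCA ler_pM2l// /wint.
have -> : (s - r) * fine (\int[mu]_x (aR r x * (mpos x / x))%:E)%E =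
   Rintegral mu setT (fun x => (s - r) * (aR r x * (mpos x / x))).
  by rewrite RintegralZl//; exact: aR_integrable.
have -> : fine (\int[mu]_x (hR s x * (mpos x / x))%:E)%E - fine (\int[mu]_x (hR r x * (mpos x / x))%:E)%E =
   Rintegral mu setT (fun x => hR s x * (mpos x / x) - hR r x * (mpos x / x)).
  by rewrite RintegralB//; exact: hR_integrable.
apply: le_Rintegral => //.
- exact: (integrableB measurableT (hR_integrable s0) (hR_integrable r0)).
- exact: (integrableZl measurableT (s - r) (aR_integrable r0)).
move=> x _; rewrite -mulrBl [leRHS]mulrA.
have [x0|x0] := leP x 0; first by rewrite mpos_le0// mul0r !mulr0.
by rewrite ler_wpM2r ?hR_lip// divr_ge0 ?mpos_ge0// ltW.
Qed.

Lemma Hk_continuous r : 0 < r -> {for r, continuous Hk}.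
Proof.
move=> r0; have h0 : 0 < r / 2 by rewrite divr_gt0.
pose G := Gk (r / 2) + 1.
have G0 : 0 < G by have := Gk_ge0 (r / 2); rewrite /G; lra.
apply/cvgrPdist_le => e e0.
have d0 : 0 < Num.min (r / 2) (e / G) by rewrite lt_min h0 divr_gt0.
apply/nbhs_normP; exists (Num.min (r / 2) (e / G)) => //= s.
rewrite /ball_/= lt_min => /andP[d1 d2].
have rs : r / 2 <= s by move: d1; rewrite ltr_norml => /andP[_ h]; lra.
have s0 : 0 < s by exact: lt_le_trans rs.
have key a b : r / 2 <= a -> a <= b -> `|a - b| < e / G -> `|Hk a - Hk b| <= e.
  move=> ra ab; rewrite distrC (distrC (Hk a)).
  have a0 : 0 < a by exact: lt_le_trans ra.
  rewrite ger0_norm ?subr_ge0// => hab.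
  rewrite ger0_norm ?subr_ge0 ?Hk_mono//.
  apply: le_trans (Hk_lip a0 ab) _.
  have hG : Gk a <= G by have := Gk_mono h0 ra; rewrite /G; lra.
  apply: (@le_trans _ _ ((b - a) * G)); first by rewrite ler_wpM2l// subr_ge0.
  by rewrite -ler_pdivlMr// ltW.
case/orP: (le_total r s) => h.
  by apply: key => //; lra.
by rewrite distrC; apply: key => //; rewrite distrC.
Qed.

End Kernel.

(** * The kernel away from the origin *)

Section Reflect2.
Variable R : realType.
Local Notation mu := (@lebesgue_measure R).
Local Notation T2 := (measurableTypeR R * measurableTypeR R)%type.

Definition opp2 (y : T2) : T2 := (- y.1, - y.2).

Lemma measurable_opp2 : measurable_fun setT opp2.
Proof.
by apply: measurable_fun_pair; apply: (measurableT_comp (@measurable_opp_leb R)).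
Qed.

Lemma leb2_opp (A : set T2) : measurable A -> pushforward (@leb2 R) opp2 A = @leb2 R A.
Proof.
move=> mA.
apply/esym; apply: product_measure_unique => //; first exact: measurable_opp2.
move=> mo' {mA}A B mA mB.
rewrite /= /pushforward.
have -> : opp2 @^-1` (A `*` B) = (-%R @^-1` A) `*` (-%R @^-1` B) by [].
have mo C : measurable C -> measurable ((-%R : measurableTypeR R -> measurableTypeR R) @^-1` C).
  by move=> mC; rewrite -[X in measurable X]setTI; exact: (@measurable_opp_leb R).
rewrite /leb2 product_measure1E//; [|exact: mo|exact: mo].
by congr (_ * _)%E; exact: lebesgue_measureN.
Qed.

Lemma eq_integral_measure (nu nu' : {measure set T2 -> \bar R}) (D : set T2) (f : T2 -> \bar R) :
  (forall A, measurable A -> nu A = nu' A) ->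
  (\int[nu]_(y in D) f y = \int[nu']_(y in D) f y)%E.
Proof. by move=> h; apply: eq_measure_integral => A mA _; exact: h. Qed.

Definition leb2N : {measure set T2 -> \bar R} :=
  measure_function_pushforward__canonical__measure_function_Measure (@leb2 R) measurable_opp2.

(** Change of variables [y] to [- y], used to cancel odd parts: it is proved for nonnegative
    functions and then for positive and negative parts. *)
Lemma integral_opp2 (D : set T2) (f : T2 -> \bar R) : measurable D ->
  opp2 @^-1` D = D ->
  (@leb2 R).-integrable D f ->
  (@leb2 R).-integrable D (f \o opp2) /\
  (\int[@leb2 R]_(y in D) f (opp2 y) = \int[@leb2 R]_(y in D) f y)%E.
Proof.
move=> mD DD fi.
have mp : measurable_fun D (f \o opp2).
  rewrite -{1}DD; apply: (measurable_comp mD) => //; last first.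
  - exact: measurable_funTS measurable_opp2.
  - exact: measurable_int fi.
  - by move=> _ [y Dy <-].
have E g : measurable_fun D g -> (forall y, 0 <= g y)%E ->
    (\int[@leb2 R]_(y in D) g (opp2 y) = \int[@leb2 R]_(y in D) g y)%E.
  move=> mg g0.
  have := @ge0_integral_pushforward _ _ _ _ R _ measurable_opp2 (@leb2 R) D g mD mg (fun y _ => g0 y).
  by rewrite DD => <-; apply: (eq_integral_measure (nu := leb2N)) => A mA; exact: leb2_opp.
have fi' : (@leb2 R).-integrable D (f \o opp2).
  apply/integrableP; split => //.
  rewrite (E (fun y => `|f y|)%E) ?(fun x => abse_ge0)//; last by apply: measurableT_comp => //; exact: measurable_int fi.
  by case/integrableP : fi.
split => //.
rewrite integralE [RHS]integralE; congr (_ - _)%E.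
  under eq_integral do rewrite (funepos_comp f opp2)/=.
  by apply: (E (f^\+)%E) => //; apply/measurable_funepos; exact: measurable_int fi.
under eq_integral do rewrite (funeneg_comp f opp2)/=.
by apply: (E (f^\-)%E) => //; apply/measurable_funeneg; exact: measurable_int fi.
Qed.

End Reflect2.

(** * Integrals against the kernel off a ball, and Fourier multipliers *)

Section PrincipalValue.
Variable R : realType.
Local Notation mu := (@lebesgue_measure R).
Local Notation T2 := (measurableTypeR R * measurableTypeR R)%type.
Variable m : R -> R.
Hypothesis m0 : forall r, 0 < r -> 0 < m r.
Hypothesis mc : forall r, 0 < r -> {for r, continuous m}.
Hypothesis md : forall r s, 0 < r -> r <= s -> m s <= m r.
Hypothesis mint : (\int[mu]_(r in [set r : R | (0 < r)%R]) (m r / (1 + r))%:E < +oo)%E.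

Definition off_ball (e : R) : set T2 := [set y | e < enorm y.1 y.2].
Definition kern (y : T2) : R := m (enorm y.1 y.2) / enorm y.1 y.2 ^+ 2.

Lemma measurable_off_ball e : measurable (off_ball e).
Proof.
rewrite -[X in measurable X]setTI.
have -> : off_ball e = (fun y : T2 => enorm y.1 y.2) @^-1` `]e, +oo[%classic.
  by apply/seteqP; split => y; rewrite /= in_itv/= andbT.
by apply: measurable_enorm => //; exact: measurable_itv.
Qed.

Lemma enormN (y : T2) : enorm (opp2 y).1 (opp2 y).2 = enorm y.1 y.2.
Proof. by rewrite /enorm /= !sqrrN. Qed.

Lemma off_ball_opp e : @opp2 R @^-1` (off_ball e) = off_ball e.
Proof. by apply/seteqP; split => y; rewrite /off_ball /= -enormN/= ?opprK. Qed.

Lemma kern_ge0 y : 0 < enorm y.1 y.2 -> 0 <= kern y.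
Proof. by move=> y0; rewrite divr_ge0 ?sqr_ge0// ltW// m0. Qed.

Lemma kern_opp y : kern (opp2 y) = kern y.
Proof. by rewrite /kern enormN. Qed.

Lemma kernE y : 0 < enorm y.1 y.2 ->
  kern y = mpos m (enorm y.1 y.2) / enorm y.1 y.2 ^+ 2.
Proof. by move=> y0; rewrite /kern mposE. Qed.

Lemma measurable_kernp : measurable_fun setT
  (fun y : T2 => mpos m (enorm y.1 y.2) / enorm y.1 y.2 ^+ 2).
Proof.
apply: measurable_funM.
  by apply: (measurableT_comp (measurable_mpos mc)); exact: measurable_enorm.
apply: (measurableT_comp (@measurable_invr R)).
by apply: measurable_funX; exact: measurable_enorm.
Qed.

Lemma measurable_kern e : 0 <= e -> measurable_fun (off_ball e) kern.
Proof.
move=> e0; apply: (@eq_measurable_fun _ _ _ _ _ (fun y : T2 => mpos m (enorm y.1 y.2) / enorm y.1 y.2 ^+ 2)).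
  by move=> y; rewrite inE => /(le_lt_trans e0) y0; rewrite kernE.
exact: measurable_funTS measurable_kernp.
Qed.

Lemma kern_weight_int (al : R -> R) : measurable_fun setT al -> (forall x, 0 <= al x) ->
  (forall a b, 0 < a -> a <= b -> al b / b ^+ 2 <= al a / a ^+ 2) ->
  wint m al \is a fin_num ->
  (@leb2 R).-integrable (off_ball 0) (EFin \o (fun y : T2 => al (enorm y.1 y.2) * kern y)) /\
  Rintegral (@leb2 R) (off_ball 0) (fun y => al (enorm y.1 y.2) * kern y) <= 8 * fine (wint m al).
Proof.
move=> ma a0 ad af.
have E : {in off_ball 0, (fun y : T2 => (al (enorm y.1 y.2) * kern y)%:E) =1
   (fun y : T2 => (al (enorm y.1 y.2) * (mpos m (enorm y.1 y.2) / enorm y.1 y.2 ^+ 2))%:E)}.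
  by move=> y; rewrite inE => y0; rewrite kernE.
have g0 (y : T2) : 0 <= al (enorm y.1 y.2) * (mpos m (enorm y.1 y.2) / enorm y.1 y.2 ^+ 2).
  by rewrite mulr_ge0// divr_ge0 ?sqr_ge0// mpos_ge0.
have mg : measurable_fun setT (fun y : T2 => al (enorm y.1 y.2) * (mpos m (enorm y.1 y.2) / enorm y.1 y.2 ^+ 2)).
  apply: measurable_funM; last exact: measurable_kernp.
  by apply: (measurableT_comp ma); exact: measurable_enorm.
have le8 := wint_radial m0 mc md ma a0 ad.
have leD : (\int[@leb2 R]_(y in off_ball 0) (al (enorm y.1 y.2) * (mpos m (enorm y.1 y.2) / enorm y.1 y.2 ^+ 2))%:E
     <= 8%:E * wint m al)%E.
  apply: le_trans le8; apply: ge0_subset_integral => //.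
  - exact: measurable_off_ball.
  - exact/measurable_EFinP.
  - by move=> y _; rewrite lee_fin.
have lt8 : (8%:E * wint m al < +oo)%E by rewrite -(fineK af) -EFinM ltry.
split.
  apply: eq_integrable (fun y yD => esym (E y yD)) _; first exact: measurable_off_ball.
  apply/integrableP; split; first exact/measurable_EFinP/measurable_funTS.
  by under eq_integral do rewrite /= ger0_norm//; exact: le_lt_trans leD lt8.
rewrite /Rintegral (eq_integral _ _ E).
rewrite -lee_fin fineK; last first.
  rewrite ge0_fin_numE; first exact: le_lt_trans leD lt8.
  by apply: integral_ge0 => y _; rewrite lee_fin.
by rewrite EFinM fineK.
Qed.

Lemma aR_kern_int r : 0 < r ->
  (@leb2 R).-integrable (off_ball 0) (EFin \o (fun y : T2 => aR r (enorm y.1 y.2) * kern y)) /\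
  Rintegral (@leb2 R) (off_ball 0) (fun y => aR r (enorm y.1 y.2) * kern y) <= Gk m r.
Proof.
move=> r0; apply: kern_weight_int.
- exact: measurable_aR.
- exact: aR_ge0.
- exact: aR_sq.
- exact: wint_aR_fin.
Qed.

Lemma off_ballS a b : a <= b -> off_ball b `<=` off_ball a.
Proof. by move=> ab y; exact: le_lt_trans. Qed.

(** Beyond distance [e] the weight [aR e] equals 1, so the weighted integrability already contains
    this one. *)
Lemma kern_int e : 0 < e -> (@leb2 R).-integrable (off_ball e) (EFin \o kern).
Proof.
move=> e0; have [h _] := aR_kern_int e0.
have h1 := integrableS (measurable_off_ball 0) (measurable_off_ball e) (off_ballS (ltW e0)) h.
apply: eq_integrable h1; first exact: measurable_off_ball.
move=> y; rewrite inE /= => ye; congr EFin.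
suff -> : aR e (enorm y.1 y.2) = 1 by rewrite mul1r.
apply/eqP; rewrite eq_le aR_le1/= le_min lexx/= ler_pdivlMr ?exprn_gt0// mul1r.
by rewrite lerXn2r ?nnegrE ?ltW// (lt_trans e0).
Qed.

Lemma bounded_kern_int e c (d : T2 -> R) : 0 < e -> measurable_fun setT d ->
  (forall y, `|d y| <= c) ->
  (@leb2 R).-integrable (off_ball e) (EFin \o (fun y => d y * kern y)).
Proof.
move=> e0 mdd dc.
apply: (le_integrable (measurable_off_ball e) _ _ (integrableZl (measurable_off_ball e) c (kern_int e0))).
  apply/measurable_EFinP; apply: measurable_funM; first exact: measurable_funTS.
  by apply: measurable_kern; exact: ltW.
move=> y ye; have y0 : 0 < enorm y.1 y.2 by exact: lt_trans ye.
by rewrite /= lee_fin !normrM ler_wpM2r// (le_trans (dc y))// ler_norm.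
Qed.

Lemma half_le (c I A G : R) : c * A <= G -> I + I <= 2 * c * A -> I <= G.
Proof. by move=> h1 h2; lra. Qed.

(** Averaging [y] and [- y] leaves a second difference, in which first-order terms cancel. The bound
    is uniform in the excised radius [e], hence survives the principal value. *)
Lemma pv_upper r c e (d : T2 -> R) : 0 < r -> 0 <= e -> 0 <= c ->
  (@leb2 R).-integrable (off_ball e) (EFin \o (fun y => d y * kern y)) ->
  (forall y, e < enorm y.1 y.2 -> d y + d (opp2 y) <= 2 * c * aR r (enorm y.1 y.2)) ->
  Rintegral (@leb2 R) (off_ball e) (fun y => d y * kern y) <= c * Gk m r.
Proof.
move=> r0 e0 c0 di hd.
have mD := measurable_off_ball e.
have [di' dE] := integral_opp2 mD (off_ball_opp e) di.
have [ai aG] := aR_kern_int r0.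
have ai' := integrableS (measurable_off_ball 0) mD (off_ballS e0) ai.
have aE : Rintegral (@leb2 R) (off_ball e) (fun y => aR r (enorm y.1 y.2) * kern y) <= Gk m r.
  apply: le_trans aG; rewrite /Rintegral fine_le//.
  - exact: integrable_fin_num ai'.
  - by apply: integrable_fin_num ai; exact: measurable_off_ball.
  apply: ge0_subset_integral => //.
  - exact: measurable_off_ball.
  - exact: measurable_int ai.
  - by move=> y y0; rewrite lee_fin mulr_ge0 ?aR_ge0// kern_ge0.
  - exact: off_ballS.
have dE2 : Rintegral (@leb2 R) (off_ball e) (fun y => d (opp2 y) * kern y) =
  Rintegral (@leb2 R) (off_ball e) (fun y => d y * kern y).
  rewrite /Rintegral -dE; congr fine; apply: eq_integral => y _ /=.
  by rewrite kern_opp.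
have di2 : (@leb2 R).-integrable (off_ball e) (EFin \o (fun y => d (opp2 y) * kern y)).
  by apply: eq_integrable di' => // y _ /=; rewrite kern_opp.
have : Rintegral (@leb2 R) (off_ball e) (fun y => d y * kern y + d (opp2 y) * kern y) <=
   Rintegral (@leb2 R) (off_ball e) (fun y => 2 * c * (aR r (enorm y.1 y.2) * kern y)).
  apply: le_Rintegral => //.
  - exact: (integrableD mD di di2).
  - exact: (integrableZl mD (2 * c) ai').
  - move=> y ye; rewrite -mulrDl.
    apply: le_trans (ler_wpM2r _ (hd y ye)) _; last by rewrite !mulrA.
    by rewrite kern_ge0// (le_lt_trans e0).
rewrite RintegralD// dE2 RintegralZl// => h.
exact: half_le (ler_wpM2l c0 aE) h.
Qed.

(** Weight seen by a function vanishing to second order on the part of the ball that the truncation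
    removes. For [e <= 1] it is at most [e * min 1 rho], which gives the linear rate in [e]. *)
Definition bR (e rho : R) : R := if rho <= e then rho ^+ 2 else 0.

Definition base_mass : R := Rintegral mu setT (fun r => mpos m r / (1 + r)).

Lemma base_mass_ge0 : 0 <= base_mass.
Proof.
apply: Rintegral_ge0 => r _; have [r0|r0] := leP r 0; first by rewrite mpos_le0// mul0r.
by rewrite divr_ge0 ?mpos_ge0// addr_ge0// ltW.
Qed.

Lemma bR_kern_int e : 0 < e -> e <= 1 ->
  (@leb2 R).-integrable (off_ball 0) (EFin \o (fun y : T2 => bR e (enorm y.1 y.2) * kern y)) /\
  Rintegral (@leb2 R) (off_ball 0) (fun y => bR e (enorm y.1 y.2) * kern y) <= 16 * base_mass * e.
Proof.
move=> e0 e1.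
have mb : measurable_fun setT (bR e).
  by apply: measurable_fun_ifT => //; exact: measurable_fun_ler.
have b0 x : 0 <= bR e x by rewrite /bR; case: ifP => // _; exact: sqr_ge0.
have bl x : 0 < x -> 0 <= bR e x <= e * Num.min 1 x.
  move=> x0; rewrite b0/= /bR; case: ifPn => h.
    by rewrite min_r ?(le_trans h)// expr2 ler_wpM2r// ltW.
  by rewrite mulr_ge0// ?ltW// lt_min ltr01.
have bf := wint_fin m0 mc mint mb bl (ltW e0).
have bi := wint_integrable m0 mc mint mb bl (ltW e0).
have bb := base_int m0 mc mint.
have hw : fine (wint m (bR e)) <= 2 * e * base_mass.
  rewrite /base_mass -RintegralZl//.
  apply: le_Rintegral => //; first exact: (integrableZl measurableT (2 * e) bb).
  by move=> x _; case/andP: (@wint_dom _ m m0 e (bR e) x bl (ltW e0)).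
have [|h1 h2] := @kern_weight_int (bR e) mb b0 _ bf.
  move=> a b a0 ab; have b0' := lt_le_trans a0 ab.
  rewrite /bR; case: (leP b e) => h.
    by rewrite (le_trans ab h) !divff// expf_neq0// gt_eqF.
  by rewrite mul0r divr_ge0 ?sqr_ge0//; case: ifP => // _; exact: sqr_ge0.
split => //; apply: le_trans h2 _.
by have := base_mass_ge0; lra.
Qed.

Section multiplier.
Variables (c : R) (d : T2 -> R).
Hypothesis c0 : 0 <= c.
Hypothesis mdd : measurable_fun setT d.
Hypothesis d0 : forall y, 0 <= d y.
Hypothesis d2 : forall y, d y <= 2.
Hypothesis dc : forall y, d y <= c * enorm y.1 y.2 ^+ 2.

Lemma mult_int : (@leb2 R).-integrable (off_ball 0) (EFin \o (fun y => d y * kern y)).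
Proof.
have [ai _] := aR_kern_int (@ltr01 R).
have mD := measurable_off_ball 0.
apply: (le_integrable mD _ _ (integrableZl mD (c + 2) ai)).
  by apply/measurable_EFinP; apply: measurable_funM; [exact: measurable_funTS|exact: measurable_kern].
move=> y y0; rewrite /= lee_fin !ger0_norm; last 2 first.
- by apply: mulr_ge0; [rewrite addr_ge0|rewrite mulr_ge0 ?aR_ge0 ?kern_ge0].
- by rewrite mulr_ge0 ?kern_ge0.
rewrite [leRHS]mulrA ler_wpM2r ?kern_ge0//.
have n0 := sqr_ge0 (enorm y.1 y.2).
rewrite /aR expr1n divr1; case: (leP 1 (enorm y.1 y.2 ^+ 2)) => h.
  by rewrite mulr1; apply: le_trans (d2 y) _; rewrite lerDr.
by apply: le_trans (dc y) _; rewrite ler_wpM2r// lerDl.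
Qed.

Definition mult : R := Rintegral (@leb2 R) (off_ball 0) (fun y => d y * kern y).

Lemma mult_ge0 : 0 <= mult.
Proof. by apply: Rintegral_ge0 => y y0; rewrite mulr_ge0 ?kern_ge0. Qed.

Lemma mult_le : mult <= (c + 2) * Gk m 1.
Proof.
have [ai aG] := aR_kern_int (@ltr01 R).
have mD := measurable_off_ball 0.
apply: (@le_trans _ _ ((c + 2) * Rintegral (@leb2 R) (off_ball 0) (fun y => aR 1 (enorm y.1 y.2) * kern y))); last first.
  by rewrite ler_wpM2l// addr_ge0.
rewrite -RintegralZl//; apply: le_Rintegral => //.
- exact: mult_int.
- exact: (integrableZl mD (c + 2) ai).
move=> y y0; rewrite [leRHS]mulrA ler_wpM2r ?kern_ge0//.
have n0 := sqr_ge0 (enorm y.1 y.2).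
rewrite /aR expr1n divr1; case: (leP 1 (enorm y.1 y.2 ^+ 2)) => h.
  by rewrite mulr1; apply: le_trans (d2 y) _; rewrite lerDr.
by apply: le_trans (dc y) _; rewrite ler_wpM2r// lerDl.
Qed.

(** The removed piece lies where [d] is at most [c * |y|^2], that is [c] times the weight [bR e].
    The explicit rate later allows a limit under a sum over frequencies. *)
Lemma mult_trunc e : 0 < e -> e <= 1 ->
  `|Rintegral (@leb2 R) (off_ball e) (fun y => d y * kern y) - mult| <= c * (16 * base_mass) * e.
Proof.
move=> e0 e1; have [bi bE] := bR_kern_int e0 e1.
have mD := measurable_off_ball 0; have mE := measurable_off_ball e.
pose B := off_ball 0 `\` off_ball e.
have mB : measurable B by exact: measurableD.
have BD : B `<=` off_ball 0 by move=> y [].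
have -> : mult = Rintegral (@leb2 R) B (fun y => d y * kern y) + Rintegral (@leb2 R) (off_ball e) (fun y => d y * kern y).
  have UE : B `|` off_ball e = off_ball 0.
    by rewrite /B setUC setDUK//; exact: off_ballS (ltW e0).
  rewrite /mult -UE Rintegral_setU//.
  - by rewrite UE; exact: mult_int.
  - by apply/disj_setPS => y [[_ h1] h2].
rewrite opprD addrCA subrr addr0 normrN.
have bB := integrableS mD mB BD bi.
have dB := integrableS mD mB BD mult_int.
rewrite ger0_norm; last first.
  by apply: Rintegral_ge0 => y [y0 _]; rewrite mulr_ge0 ?kern_ge0.
apply: (@le_trans _ _ (c * Rintegral (@leb2 R) B (fun y => bR e (enorm y.1 y.2) * kern y))).
  rewrite -RintegralZl//; apply: le_Rintegral => //.
    exact: (integrableZl mB c bB).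
  move=> y [y0 ye]; rewrite [leRHS]mulrA ler_wpM2r ?kern_ge0//.
  have -> : bR e (enorm y.1 y.2) = enorm y.1 y.2 ^+ 2.
    by rewrite /bR; case: leP => // h; case: ye.
  exact: dc.
rewrite -mulrA; apply: ler_wpM2l => //; apply: le_trans bE.
rewrite /Rintegral fine_le//.
- exact: integrable_fin_num bB.
- exact: integrable_fin_num bi.
apply: ge0_subset_integral => //.
- exact: measurable_int bi.
- move=> y y0; rewrite lee_fin mulr_ge0 ?kern_ge0//.
  by rewrite /bR; case: ifP => // _; exact: sqr_ge0.
Qed.

End multiplier.

End PrincipalValue.

(** * Derivatives and continuity *)

Section DeriveEps.
Variable R : realType.
Implicit Types f : R -> R.

Lemma is_derive_eps f (x l : R) :
  (forall e, 0 < e -> exists2 d, 0 < d &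
     forall h, `|h| < d -> `|f (x + h) - f x - h * l| <= e * `|h|) ->
  is_derive x 1 f l.
Proof.
move=> H.
have cv : h^-1 *: (f (h *: 1 + x) - f x) @[h --> 0^'] --> l.
  apply/cvgrPdist_le => e e0; have [d d0 hd] := H e e0.
  have dn : \forall h \near (0 : R)^', `|h| < d by exact: dnbhs0_lt d0.
  have nz : \forall h \near (0 : R)^', h != 0 by exact: nbhs_dnbhs_neq.
  near=> h.
  have h0 : h != 0 by near: h.
  have hd' : `|h| < d by near: h.
  have := hd h hd'.
  rewrite /GRing.scale /= mulr1 (addrC h x).
  rewrite -[X in X - h^-1 * _](mulKf h0) -mulrBr normrM normfV.
  rewrite ler_pdivrMl ?normr_gt0// distrC mulrC.
  by rewrite (mulrC e).
by apply: DeriveDef; [apply/cvg_ex; exists l|exact: cvg_lim].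
Unshelve. all: by end_near. Qed.

Lemma derive_epsP f (x l : R) : is_derive x 1 f l ->
  forall e, 0 < e -> exists2 d, 0 < d &
     forall h, `|h| < d -> `|f (x + h) - f x - h * l| <= e * `|h|.
Proof.
move=> [df fl] e e0.
have cv : h^-1 *: (f (h *: 1 + x) - f x) @[h --> 0^'] --> l.
  by rewrite -fl; exact: df.
move/cvgrPdist_le : cv => /(_ e e0).
rewrite /dnbhs /within /= => /nbhs_normP[d /= d0 hd].
exists d => // h hd'.
have [->|h0] := eqVneq h 0; first by rewrite addr0 subrr mul0r subrr normr0 mulr0.
have := hd h; rewrite /ball_ /= sub0r normrN => /(_ hd' h0).
rewrite /GRing.scale /= mulr1 (addrC h x).
rewrite -[X in X - h^-1 * _](mulKf h0) -mulrBr normrM normfV.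
by rewrite ler_pdivrMl ?normr_gt0// distrC (mulrC e).
Qed.

Lemma derivable1_is_derive f x : derivable f x 1 -> is_derive x 1 f (derive1 f x).
Proof. by move=> df; rewrite derive1E; exact: derivableP. Qed.

Lemma is_derive_derive1 f (x l : R) : is_derive x 1 f l -> derive1 f x = l.
Proof. by move=> h; rewrite derive1E derive_val. Qed.

(** Only backward increments are assumed: this is how a function that need not be differentiable in
    time can touch one that is. *)
Lemma derive_left_le f (x l k d : R) : is_derive x 1 f l -> 0 < d ->
  (forall h, 0 < h -> h < d -> h * k <= f (x - h) - f x) -> l <= - k.
Proof.
move=> df d0 H; apply/ler_addgt0Pr => e e0.
have [d' d'0 hd'] := derive_epsP df e0.
pose h := Num.min d d' / 2.
have m0 : 0 < Num.min d d' by rewrite lt_min d0.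
have h0 : 0 < h by rewrite divr_gt0.
have hm : h < Num.min d d' by rewrite ltr_pdivrMr//; lra.
have hd : h < d by apply: lt_le_trans hm _; rewrite ge_min lexx.
have hd2 : h < d' by apply: lt_le_trans hm _; rewrite ge_min lexx orbT.
have := hd' (- h); rewrite normrN gtr0_norm// => /(_ hd2).
have := H h h0 hd.
rewrite ler_norml => h1 /andP[_ h2].
rewrite -(ler_pM2l h0); lra.
Qed.

Lemma derive_min f (x l : R) : is_derive x 1 f l -> (forall y, f x <= f y) -> l = 0.
Proof.
move=> df H; apply/eqP; rewrite eq_le; apply/andP; split.
  rewrite -oppr0; apply: (@derive_left_le f x l 0 1 df) => // h h0 h1.
  by rewrite mulr0 subr_ge0.
apply/ler_addgt0Pr => e e0.
have [d d0 hd] := derive_epsP df e0.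
have h0 : 0 < d / 2 by rewrite divr_gt0.
have hh : d / 2 < d by rewrite ltr_pdivrMr//; lra.
have := hd (d / 2); rewrite (gtr0_norm h0) => /(_ hh).
rewrite ler_norml => /andP[h1 h2].
have h3 := H (x + d / 2).
rewrite -(ler_pM2l h0); lra.
Qed.

Lemma is_derive_local (f g : R -> R) (x d v : R) : 0 < d ->
  (forall h, `|h| < d -> f (x + h) = g (x + h)) -> is_derive x 1 g v -> is_derive x 1 f v.
Proof.
move=> d0 fg dg; apply: is_derive_eps => e e0.
have [d' d'0 hd] := derive_epsP dg e0.
exists (Num.min d d') => [|h]; first by rewrite lt_min d0.
rewrite lt_min => /andP[h1 h2].
have := fg 0; rewrite normr0 addr0 => /(_ d0) ->; rewrite fg//; exact: hd.
Qed.

End DeriveEps.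

Section Continuity3.
Variable R : realType.

Lemma continuous3P (F : R -> R -> R -> R) t x y :
  {for (t, x, y), continuous (uncurry3 F)} <->
  (forall e, 0 < e -> exists2 d, 0 < d & forall t' x' y',
     `|t' - t| < d -> `|x' - x| < d -> `|y' - y| < d -> `|F t' x' y' - F t x y| <= e).
Proof.
split=> [cF e e0|h].
  move/cvgrPdist_le : cF => /(_ e e0)/nbhs_ballP[d /= d0 hd]; exists d => // t' x' y' h1 h2 h3.
  rewrite distrC; apply: (hd (t', x', y')).
  by split; [split|]; rewrite /ball /= distrC.
apply/cvgrPdist_le => e e0; have [d d0 hd] := h e e0.
have : nbhs (t, x, y) [set p | `|uncurry3 F (t, x, y) - uncurry3 F p| <= e]; last exact.
apply/nbhs_ballP; exists d => //= -[[t' x'] y'] [[/= h1 h2] h3].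
by rewrite distrC; apply: hd; rewrite distrC.
Qed.

End Continuity3.

(** * Comparison principle *)

Section Comparison.
Variable R : realType.
Local Notation T2 := (measurableTypeR R * measurableTypeR R)%type.
Variable m : R -> R.
Hypothesis m0 : forall r, 0 < r -> 0 < m r.
Variables u1 u2 : R -> R -> R.

(** What the comparison uses of a solution. Freezing [W] at its initial value for negative times
    turns continuity up to time 0 into plain continuity, as needed on a compact box. *)
Definition evolves (W : R -> R -> R -> R) : Prop :=
  [/\ forall t x y, 0 <= t ->
        {for (t, x, y), continuous (uncurry3 (fun t => W (Num.max t 0)))},
      forall t x y, 0 < t ->
         [/\ derivable (fun s => W s x y) t 1,
             derivable (fun s => W t s y) x 1 &
             derivable (fun s => W t x s) y 1] &
      forall t x1 x2, 0 < t -> exists L,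
         pv_integral (fun y => (W t x1 x2 - W t (x1 + y.1) (x2 + y.2))
                               * m (enorm y.1 y.2) / (enorm y.1 y.2) ^+ 2) L
         /\ dT W t x1 x2 + u1 x1 x2 * dX W t x1 x2
            + u2 x1 x2 * dY W t x1 x2 + L = 0].

(** [p] and [q] are the slopes in space and [l] bounds the truncated operators for all [e] at once.
    Time enters through backward increments, so that no time derivative of the barrier is
    required. *)
Definition subsol_at (phi : R -> R -> R -> R) (t x y : R) : Prop :=
  exists p q l,
  [/\ is_derive x 1 (fun s => phi t s y) p,
      is_derive y 1 (fun s => phi t x s) q,
      (forall e, 0 < e ->
        (@leb2 R).-integrable (off_ball e)
          (EFin \o (fun z : T2 => (phi t x y - phi t (x + z.1) (y + z.2)) * kern m z)) /\
        Rintegral (@leb2 R) (off_ball e)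
          (fun z => (phi t x y - phi t (x + z.1) (y + z.2)) * kern m z) <= l) &
      (forall eta, 0 < eta -> exists2 d, 0 < d & forall h, 0 < h -> h < d ->
         h * (u1 x y * p + u2 x y * q + l - eta) <= phi (t - h) x y - phi t x y)].

Lemma pv_kern (W : R -> R -> R -> R) t x1 x2 :
  (fun y : R * R => (W t x1 x2 - W t (x1 + y.1) (x2 + y.2))
                               * m (enorm y.1 y.2) / (enorm y.1 y.2) ^+ 2) =
  (fun y => (W t x1 x2 - W t (x1 + y.1) (x2 + y.2)) * kern m y).
Proof. by apply/funext => y; rewrite /kern mulrA. Qed.

(* The contact point is the minimum of [W - phi + sg * t], for a small [sg], over a compact box. *)
Lemma comparison (W phi : R -> R -> R -> R) (T rad : R) :
  evolves W ->
  (forall t x y, 0 <= t -> t <= T -> {for (t, x, y), continuous (uncurry3 phi)}) ->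
  (forall x y, phi 0 x y <= W 0 x y) ->
  (forall t x y, 0 <= t -> t <= T -> rad < `|x| \/ rad < `|y| -> phi t x y <= W t x y) ->
  (forall t x y, 0 < t -> t <= T -> subsol_at phi t x y) ->
  forall t x y, 0 <= t -> t <= T -> phi t x y <= W t x y.
Proof.
move=> [Wc Wd Wpde] pc pinit pout psub t1 x1 y1 t10 t1T.
rewrite leNgt; apply/negP => gap.
have inA : ~ (rad < `|x1| \/ rad < `|y1|).
  by move=> h; have := pout _ _ _ t10 t1T h; rewrite leNgt gap.
have x1r : `|x1| <= rad by rewrite leNgt; apply/negP => h; apply: inA; left.
have y1r : `|y1| <= rad by rewrite leNgt; apply/negP => h; apply: inA; right.
pose g := phi t1 x1 y1 - W t1 x1 y1.
have g0 : 0 < g by rewrite subr_gt0.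
have T0 : 0 <= T by exact: le_trans t1T.
pose sg := g / (2 * (T + 1)).
(* The tilt is strict but too small to lift the assumed gap at [(t1, x1, y1)]. *)
have sg0 : 0 < sg by rewrite divr_gt0// mulr_gt0//; lra.
have sgT : sg * t1 < g.
  rewrite /sg mulrAC ltr_pdivrMr; last by lra.
  by rewrite ltr_pM2l//; lra.
pose F (p : R * R * R) := uncurry3 (fun t => W (Num.max t 0)) p - uncurry3 phi p + sg * p.1.1.
pose A : set (R * R * R) := `[0, T] `*` `[- rad, rad] `*` `[- rad, rad].
have cA : compact A by apply: compact_setX; [apply: compact_setX|]; exact: segment_compact.
have Ac : A (t1, x1, y1).
  by rewrite /A /=; repeat split; rewrite in_itv/= ?t10//; rewrite -ler_norml.
have cF : {within A, continuous F}.
  apply: continuous_in_subspaceT => -[[t x] y]; rewrite inE => -[[/= + _] _].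
  rewrite in_itv/= => /andP[h0 hT].
  apply: cvgD; first by apply: cvgB; [exact: Wc|exact: pc].
  apply: cvgMr.
  by apply: (cvg_comp fst fst); exact: cvg_fst.
have [[[t x] y] + cmin] := compact_EVT_min (ex_intro _ _ Ac) cA cF.
rewrite inE => -[[/=]]; rewrite !in_itv/= => /andP[t0 tT] /andP[xr1 xr2] /andP[yr1 yr2].
have FE t' x' y' : 0 <= t' -> F (t', x', y') = W t' x' y' - phi t' x' y' + sg * t'.
  by move=> h; rewrite /F /uncurry3 /= max_l.
have Fneg : W t x y - phi t x y + sg * t < 0.
  have := cmin (t1, x1, y1); rewrite inE => /(_ Ac); rewrite !FE// => h.
  by apply: le_lt_trans h _; rewrite /g in sgT; lra.
(* Outside the box the function is nonnegative while its minimum is negative, so the minimum is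
   global in space. A local one would not control the nonlocal term. *)
have Fmin t' x' y' : 0 <= t' -> t' <= T ->
   W t x y - phi t x y + sg * t <= W t' x' y' - phi t' x' y' + sg * t'.
  move=> t'0 t'T; have [h|h] := pselect (rad < `|x'| \/ rad < `|y'|).
    apply: le_trans (ltW Fneg) _; have := pout _ _ _ t'0 t'T h.
    have : 0 <= sg * t' by rewrite mulr_ge0// ltW.
    lra.
  have := cmin (t', x', y'); rewrite !FE//; apply; rewrite inE /A /=.
  have hx : `|x'| <= rad by rewrite leNgt; apply/negP => h'; apply: h; left.
  have hy : `|y'| <= rad by rewrite leNgt; apply/negP => h'; apply: h; right.
  by repeat split; rewrite in_itv/= ?t'0//; rewrite -ler_norml.
have {}t0 : 0 < t.
  rewrite lt_neqAle t0 andbT; apply/eqP => h; move: Fneg; rewrite -h mulr0 addr0.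
  by have := pinit x y; lra.
have [Dt Dx Dy] := Wd t x y t0.
have [p [q [l [dp dq pv dini]]]] := psub t x y t0 tT.
have [L [[Wi WL] eqn]] := Wpde t x y t0.
have WX : dX W t x y = p.
  have dd := is_deriveB (derivable1_is_derive Dx) dp.
  apply/eqP; rewrite -subr_eq0; apply/eqP; apply: (derive_min dd) => z /=.
  by have := Fmin t z y (ltW t0) tT; rewrite !fctE; lra.
have WY : dY W t x y = q.
  have dd := is_deriveB (derivable1_is_derive Dy) dq.
  apply/eqP; rewrite -subr_eq0; apply/eqP; apply: (derive_min dd) => z /=.
  by have := Fmin t x z (ltW t0) tT; rewrite !fctE; lra.
(* At a global minimum of [W - phi] every increment of [W] dominates that of [phi], so each
   truncated integral of [W] is at most that of [phi]. *)
have Ll : L <= l.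
  apply: (cvgr_to_le WL); near=> e.
  have e0 : 0 < e by near: e; exact: nbhs_right_gt.
  have [pi pl] := pv e e0; apply: le_trans pl.
  rewrite pv_kern; apply: le_Rintegral => //.
  - exact: measurable_off_ball.
  - by move: (Wi e e0); rewrite pv_kern.
  move=> z ze; rewrite ler_wpM2r//.
    by apply: kern_ge0 => //; exact: lt_trans ze.
  have := Fmin t (x + z.1) (y + z.2) (ltW t0) tT; lra.
have := dini (sg / 2); rewrite divr_gt0// => /(_ isT)[d d0 hd].
(* Half of the tilt pays for [eta] in [subsol_at]; the other half contradicts the equation. *)
have : dT W t x y <= - (u1 x y * p + u2 x y * q + l + sg / 2).
  apply: (@derive_left_le _ _ t _ _ (Num.min d t) (derivable1_is_derive Dt)).
    by rewrite lt_min d0.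
  move=> h h0; rewrite lt_min => /andP[hd' ht].
  have th0 : 0 <= t - h by rewrite subr_ge0 ltW.
  have := Fmin (t - h) x y th0; have := hd h h0 hd'.
  move=> h1 /(_ _)/wrap[|h2]; first by lra.
  lra.
move: eqn; rewrite WX WY => eqn.
by move=> h; lra.
Unshelve. all: by end_near. Qed.

End Comparison.

(** * Travelling barrier *)

Section Bump.
Variable R : realType.
Local Notation T2 := (measurableTypeR R * measurableTypeR R)%type.

Definition hat (p : R) : R := Num.max 0 p ^+ 2.

Lemma hat_ge0 p : 0 <= hat p. Proof. exact: sqr_ge0. Qed.

Lemma hat_eq0 p : p <= 0 -> hat p = 0.
Proof. by move=> h; rewrite /hat max_l// expr0n. Qed.

Lemma hat_le1 p : p <= 1 -> hat p <= 1.
Proof.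
move=> h; rewrite /hat; case: (leP 0 p) => h0; last by rewrite expr0n.
by rewrite expr_le1.
Qed.

(** The graph of [hat] lies above its tangents. This gives lower bounds without second-order
    remainders, both for second differences of the bump and for its backward increments in time. *)
Lemma hat_convex (a b : R) : 2 * Num.max 0 a * (b - a) <= hat b - hat a.
Proof.
have h1 := sqr_ge0 (b - a); have h2 := sqr_ge0 a; have h3 := sqr_ge0 b.
rewrite /hat; case: (leP 0 a) => ha; case: (leP 0 b) => hb; rewrite ?expr0n/=; nra.
Qed.

Lemma hat_upper (a b : R) : hat b - hat a - 2 * Num.max 0 a * (b - a) <= (b - a) ^+ 2.
Proof.
have h1 := sqr_ge0 (b - a); have h2 := sqr_ge0 a; have h3 := sqr_ge0 b.
rewrite /hat; case: (leP 0 a) => ha; case: (leP 0 b) => hb; rewrite ?expr0n/=; nra.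
Qed.

Lemma is_derive_hat (a : R) : is_derive a 1 hat (2 * Num.max 0 a).
Proof.
apply: is_derive_eps => e e0; exists e => // h he.
have h1 := hat_convex a (a + h); have h2 := hat_upper a (a + h).
have hh : a + h - a = h by ring.
rewrite hh in h1 h2.
rewrite ger0_norm; last by lra.
rewrite (mulrC h); apply: le_trans h2 _.
by rewrite -real_normK ?num_real// expr2 ler_wpM2r// ltW.
Qed.

Lemma hat_continuous : continuous hat.
Proof.
by move=> x; apply: differentiable_continuous; apply/derivable1_diffP; case: (is_derive_hat x).
Qed.

Lemma measurable_hat : measurable_fun setT hat.
Proof. exact: continuous_measurable_fun hat_continuous. Qed.

Definition hat2 (c r x y : R) : R := hat (1 - (x ^+ 2 + (y - c) ^+ 2) / r ^+ 2).

Lemma hat2_arg_le1 (c r x y : R) : 1 - (x ^+ 2 + (y - c) ^+ 2) / r ^+ 2 <= 1.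
Proof. by rewrite gerBl divr_ge0 ?sqr_ge0// addr_ge0// sqr_ge0. Qed.

Lemma hat2_ge0 (c r x y : R) : 0 <= hat2 c r x y. Proof. exact: hat_ge0. Qed.

Lemma hat2_le1 (c r x y : R) : hat2 c r x y <= 1.
Proof. exact/hat_le1/hat2_arg_le1. Qed.

Lemma hat2_slope_le (c r x y : R) : 0 <= Num.max 0 (1 - (x ^+ 2 + (y - c) ^+ 2) / r ^+ 2) <= 1.
Proof. by rewrite le_max lexx/= ge_max ler01 hat2_arg_le1. Qed.

Definition hat2_x (c r x y : R) : R :=
  2 * Num.max 0 (1 - (x ^+ 2 + (y - c) ^+ 2) / r ^+ 2) * - (2 * x / r ^+ 2).
Definition hat2_y (c r x y : R) : R :=
  2 * Num.max 0 (1 - (x ^+ 2 + (y - c) ^+ 2) / r ^+ 2) * - (2 * (y - c) / r ^+ 2).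

Lemma is_derive_hat2_x (c r x y : R) : is_derive x 1 (fun s => hat2 c r s y) (hat2_x c r x y).
Proof.
have d : is_derive x 1 (fun s => 1 - (s ^+ 2 + (y - c) ^+ 2) / r ^+ 2) (- (2 * x / r ^+ 2)).
  apply: is_derive_eq; rewrite /GRing.scale/=; ring.
have := @is_derive1_comp _ hat (fun s => 1 - (s ^+ 2 + (y - c) ^+ 2) / r ^+ 2) x _ _ (is_derive_hat _) d.
by apply.
Qed.

Lemma is_derive_hat2_y (c r x y : R) : is_derive y 1 (fun s => hat2 c r x s) (hat2_y c r x y).
Proof.
have d : is_derive y 1 (fun s => 1 - (x ^+ 2 + (s - c) ^+ 2) / r ^+ 2) (- (2 * (y - c) / r ^+ 2)).
  apply: is_derive_eq; rewrite /GRing.scale/=; ring.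
have := @is_derive1_comp _ hat (fun s => 1 - (x ^+ 2 + (s - c) ^+ 2) / r ^+ 2) y _ _ (is_derive_hat _) d.
by apply.
Qed.

Lemma hat2_grad0 (r x y : R) : 0 < r ->
  `|hat2_x 0 r x y| <= 4 / r /\ `|hat2_y 0 r x y| <= 4 / r.
Proof.
move=> r0; have /andP[s0 s1] := hat2_slope_le 0 r x y.
rewrite /hat2_x /hat2_y; set S := Num.max _ _ in s0 s1 *.
have [p0|p0] := leP (1 - (x ^+ 2 + (y - 0) ^+ 2) / r ^+ 2) 0.
  have -> : S = 0 by rewrite /S max_l.
  by rewrite !mulr0 !mul0r normr0 divr_ge0// ltW.
have hr : x ^+ 2 + (y - 0) ^+ 2 <= r ^+ 2.
  by move: p0; rewrite subr_gt0 ltr_pdivrMr ?exprn_gt0// mul1r => /ltW.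
have hz z : z ^+ 2 <= r ^+ 2 -> `|2 * S * - (2 * z / r ^+ 2)| <= 4 / r.
  move=> zr; have zr' : `|z| <= r by rewrite ler_norml; apply/andP; split; nra.
  rewrite normrM normrN normrM (ger0_norm s0) normrM normrM normfV.
  rewrite !(ger0_norm (_ : 0 <= 2))// (ger0_norm (sqr_ge0 r)).
  have -> : 4 / r = 2 * 1 * (2 * r / r ^+ 2) by field; rewrite gt_eqF.
  apply: ler_pM => //; first by rewrite mulr_ge0.
  - by rewrite mulr_ge0 ?invr_ge0 ?sqr_ge0// mulr_ge0.
  - by rewrite ler_wpM2l.
  - by rewrite ler_wpM2r ?invr_ge0 ?sqr_ge0// ler_wpM2l.
split; apply: hz; have := sqr_ge0 x; have := sqr_ge0 (y - 0); lra.
Qed.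

(** Far away, use that [hat] is at most 1. Close by, add the tangent inequalities at both shifted
    points: the linear terms of the quadratic argument cancel. *)
Lemma hat2_second_diff (c r x y : R) (z : T2) : 0 < r ->
  (hat2 c r x y - hat2 c r (x + z.1) (y + z.2)) +
  (hat2 c r x y - hat2 c r (x + (opp2 z).1) (y + (opp2 z).2)) <= 2 * 2 * aR r (enorm z.1 z.2).
Proof.
move=> r0; case: z => a b; rewrite /= /aR enorm_sqr.
have e1 := hat2_le1 c r x y; have e0 := hat2_ge0 c r (x + a) (y + b); have e0' := hat2_ge0 c r (x + - a) (y + - b).
case: (leP 1 ((a ^+ 2 + b ^+ 2) / r ^+ 2)) => h; first by lra.
have /andP[s0 s1] := hat2_slope_le c r x y.
have h1 := hat_convex (1 - (x ^+ 2 + (y - c) ^+ 2) / r ^+ 2) (1 - ((x + a) ^+ 2 + (y + b - c) ^+ 2) / r ^+ 2).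
have h2 := hat_convex (1 - (x ^+ 2 + (y - c) ^+ 2) / r ^+ 2) (1 - ((x + - a) ^+ 2 + (y + - b - c) ^+ 2) / r ^+ 2).
set S := Num.max _ _ in s0 s1 h1 h2.
have q0 : 0 <= (a ^+ 2 + b ^+ 2) / r ^+ 2 by rewrite divr_ge0 ?sqr_ge0// addr_ge0// sqr_ge0.
have h3 := lerD h1 h2.
have h4 : 2 * S * (1 - ((x + a) ^+ 2 + (y + b - c) ^+ 2) / r ^+ 2 - (1 - (x ^+ 2 + (y - c) ^+ 2) / r ^+ 2)) +
    2 * S * (1 - ((x + - a) ^+ 2 + (y + - b - c) ^+ 2) / r ^+ 2 - (1 - (x ^+ 2 + (y - c) ^+ 2) / r ^+ 2)) =
   - (4 * S * ((a ^+ 2 + b ^+ 2) / r ^+ 2)) by field; rewrite gt_eqF.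
have h5 : 4 * S * ((a ^+ 2 + b ^+ 2) / r ^+ 2) <= 4 * ((a ^+ 2 + b ^+ 2) / r ^+ 2).
  by rewrite ler_wpM2r//; lra.
rewrite /hat2; move: h3; rewrite h4 => h3; lra.
Qed.

Lemma measurable_hat2_shift (c r x y : R) :
  measurable_fun setT (fun z : T2 => hat2 c r x y - hat2 c r (x + z.1) (y + z.2)).
Proof.
apply: measurable_funB => //.
apply: (measurableT_comp measurable_hat).
apply: measurable_funB => //; apply: measurable_funM => //.
apply: measurable_funD; apply: measurable_funX.
  by apply: measurable_funD => //; exact: measurable_fst.
apply: measurable_funB => //.
by apply: measurable_funD => //; exact: measurable_snd.
Qed.

Section etapv.
Variable m : R -> R.
Hypothesis m0 : forall r, 0 < r -> 0 < m r.
Hypothesis mc : forall r, 0 < r -> {for r, continuous m}.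
Hypothesis md : forall r s, 0 < r -> r <= s -> m s <= m r.
Hypothesis mint : (\int[@lebesgue_measure R]_(r in [set r : R | (0 < r)%R]) (m r / (1 + r))%:E < +oo)%E.

Lemma hat2_pv (c r x y : R) e : 0 < r -> 0 < e ->
  (@leb2 R).-integrable (off_ball e)
    (EFin \o (fun z : T2 => (hat2 c r x y - hat2 c r (x + z.1) (y + z.2)) * kern m z)) /\
  Rintegral (@leb2 R) (off_ball e)
    (fun z => (hat2 c r x y - hat2 c r (x + z.1) (y + z.2)) * kern m z) <= 2 * Gk m r.
Proof.
move=> r0 e0.
have di : (@leb2 R).-integrable (off_ball e)
    (EFin \o (fun z : T2 => (hat2 c r x y - hat2 c r (x + z.1) (y + z.2)) * kern m z)).
  apply: (@bounded_kern_int _ _ m0 mc md mint e 1) => //.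
    exact: measurable_hat2_shift.
  move=> z; have := hat2_le1 c r x y; have := hat2_ge0 c r x y.
  have := hat2_le1 c r (x + z.1) (y + z.2); have := hat2_ge0 c r (x + z.1) (y + z.2).
  by move=> *; rewrite ler_norml; apply/andP; split; lra.
split=> //; apply: (pv_upper m0 mc md mint r0 (ltW e0) _ di) => //.
by move=> z _; exact: hat2_second_diff.
Qed.

End etapv.
End Bump.

(** * The moving bump as a subsolution *)

Section Barrier.
Variable R : realType.
Local Notation T2 := (measurableTypeR R * measurableTypeR R)%type.
Variable m : R -> R.
Hypothesis m0 : forall r, 0 < r -> 0 < m r.
Hypothesis mc : forall r, 0 < r -> {for r, continuous m}.
Hypothesis md : forall r s, 0 < r -> r <= s -> m s <= m r.
Hypothesis mint : (\int[@lebesgue_measure R]_(r in [set r : R | (0 < r)%R]) (m r / (1 + r))%:E < +oo)%E.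

Section setup.
Variables (u1 u2 : R -> R -> R) (sg A B P a smin rho ep C2 : R).
Hypothesis u1b : forall x y, `|u1 x y| <= 1.
Hypothesis u2b : forall x y, `|u2 x y| <= 1.
Hypothesis sg2 : sg * sg = 1.
Hypothesis A0 : 0 <= A.
Hypothesis P0 : 0 <= P.
Hypothesis smin0 : 0 < smin.
Hypothesis smina : smin <= a.
Hypothesis rho0 : 0 < rho.
Hypothesis ep0 : 0 <= ep.
(** The terms pay for the operator on the confining bump, for its transport (each slope is at most
    [4 / rho]), and for the defect [ep] of the flow. *)
Hypothesis C2E : C2 = P * (2 * Gk m rho) + P * (8 / rho) + 64 * A * ep / smin.
(** With [s] decreasing at unit speed, [2 / s^2] times the part before [ep * s] is the material
    derivative of the squared distance to the centre in units of [s]. That distance almost never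
    decreases along the flow, so transport does not push the barrier up. *)
Hypothesis flow : forall s x y, smin <= s -> s <= a ->
  x ^+ 2 + (y - sg * s) ^+ 2 <= (s / 4) ^+ 2 ->
  0 <= A * (u1 x y * x + (u2 x y + sg) * (y - sg * s) + (x ^+ 2 + (y - sg * s) ^+ 2) / s + ep * s).

(** [32 = 2 * 4 * 4]: the 2 of [hat2_pv], the speed 1/4 at which the radius shrinks, and the factor
    1/4 of [Hk_incr]. *)
Let drift (t : R) : R := 32 * A * (Hk m (a / 4) - Hk m ((a - t) / 4)) + C2 * t.

(* The bump moves to the origin at unit speed while shrinking. The [Hk] term pays for the nonlocal
   operator, [C2] for the confinement by [P], which keeps the barrier below bounded functions far out. *)
Definition barrier (t x y : R) : R :=
  B + A * hat2 (sg * (a - t)) ((a - t) / 4) x y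
  - (32 * A * (Hk m (a / 4) - Hk m ((a - t) / 4)) + C2 * t)
  - P * (1 - hat2 0 rho x y).

Lemma C2_ge0 : 0 <= C2.
Proof.
rewrite C2E !addr_ge0//.
- by rewrite mulr_ge0// mulr_ge0//; exact: Gk_ge0.
- by rewrite mulr_ge0// divr_ge0// ltW.
- by rewrite divr_ge0 ?mulr_ge0// ltW.
Qed.

Lemma drift_ge0 (t : R) : 0 <= t -> t <= a - smin -> 0 <= drift t.
Proof.
move=> t0 tT; rewrite /drift addr_ge0 ?mulr_ge0 ?C2_ge0// subr_ge0.
by have h1 := smin0; apply: (Hk_mono m0 mc mint); lra.
Qed.

(** Outside the square the confining bump vanishes, so the full [P] is subtracted and absorbs the
    height of the bump and the bound [M]. *)
Lemma barrier_out (M t x y : R) : 0 <= t -> t <= a - smin -> B + A + M <= P ->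
  rho < `|x| \/ rho < `|y| -> barrier t x y <= - M.
Proof.
move=> t0 tT PM out; rewrite /barrier.
have -> : hat2 0 rho x y = 0.
  apply: hat_eq0; rewrite subr_le0 ler_pdivlMr ?exprn_gt0// mul1r subr0.
  have sq (z : R) : rho < `|z| -> rho ^+ 2 <= z ^+ 2.
    by move=> h; rewrite -(@real_normK _ z) ?num_real// lerXn2r ?nnegrE// ltW.
  by case: out => /sq h; [have := sqr_ge0 y|have := sqr_ge0 x]; lra.
have d0 := drift_ge0 t0 tT; rewrite /drift in d0.
have := hat2_le1 (sg * (a - t)) ((a - t) / 4) x y => e1.
have : A * hat2 (sg * (a - t)) ((a - t) / 4) x y <= A by rewrite ler_piMr.
by lra.
Qed.

Lemma barrier_init (x y : R) : barrier 0 x y <= B + A * hat2 (sg * a) (a / 4) x y.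
Proof.
rewrite /barrier subr0 subrr mulr0 mulr0 addr0 subr0.
have := mulr_ge0 P0 (_ : 0 <= 1 - hat2 0 rho x y); rewrite subr_ge0 => /(_ (hat2_le1 _ _ _ _)).
lra.
Qed.

Lemma barrier_continuous (t x y : R) : 0 <= t -> t <= a - smin ->
  {for (t, x, y), continuous (uncurry3 barrier)}.
Proof.
move=> t0 tT; have at0 : 0 < a - t by have h1 := smin0; lra.
pose pt (p : R * R * R) := p.1.1; pose px (p : R * R * R) := p.1.2; pose py (p : R * R * R) := p.2.
have ct : {for (t, x, y), continuous pt}.
  by apply: (cvg_comp fst fst); exact: cvg_fst.
have cx : {for (t, x, y), continuous px}.
  by apply: (cvg_comp fst snd); [exact: cvg_fst|exact: cvg_snd].
have cy : {for (t, x, y), continuous py} by exact: cvg_snd.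
have cat : {for (t, x, y), continuous (fun p => a - pt p)} by apply: cvgB => //; exact: cvg_cst.
have cr : {for (t, x, y), continuous (fun p => (a - pt p) / 4)} by apply: cvgMl.
have csq (f : R * R * R -> R) : {for (t, x, y), continuous f} -> {for (t, x, y), continuous (fun p => f p ^+ 2)}.
  by move=> h; apply: (continuous_comp (f := f) (g := fun z : R => z ^+ 2)) => //; exact: exprn_continuous.
have ce (c r : R * R * R -> R) : {for (t, x, y), continuous c} -> {for (t, x, y), continuous r} ->
   r (t, x, y) != 0 -> {for (t, x, y), continuous (fun p => hat2 (c p) (r p) (px p) (py p))}.
  move=> cc crr r0.
  apply: (continuous_comp (f := fun p => 1 - (px p ^+ 2 + (py p - c p) ^+ 2) / r p ^+ 2) (g := @hat R)); last exact: hat_continuous.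
  apply: cvgB; first exact: cvg_cst.
  apply: cvgM.
    apply: cvgD; first exact: csq.
    apply: (csq (fun p => py p - c p)).
    by apply: cvgB.
  apply: cvgV; first by rewrite expf_neq0.
  exact: csq.
rewrite /uncurry3 /barrier.
apply: cvgB; last first.
  apply: cvgMr; apply: cvgB; first exact: cvg_cst.
  by apply: ce; [exact: cvg_cst|exact: cvg_cst|rewrite gt_eqF].
apply: cvgB.
  apply: cvgD; first exact: cvg_cst.
  apply: cvgMr; apply: ce => //; first by apply: cvgMr.
  by rewrite /pt/= gt_eqF// divr_gt0.
apply: cvgD; last by apply: cvgMr.
apply: cvgMr; apply: cvgB; first exact: cvg_cst.
have cH : {for (a - t) / 4, continuous (Hk m)}.
  by apply: (Hk_continuous m0 mc mint); rewrite divr_gt0.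
exact: (cvg_comp (fun p => (a - pt p) / 4) (Hk m) cr cH).
Qed.

(** The squared distance to the centre [sg * s] in units of [s], expanded with [sg^2 = 1]: a
    polynomial in [1 / s], so the motion of the centre and of the radius are differentiated
    together. *)
Let qf (x y s : R) : R := (x ^+ 2 + y ^+ 2) * s^-1 ^+ 2 - 2 * sg * y * s^-1 + 1.

Let qfE (x y s : R) : 0 < s -> (x ^+ 2 + (y - sg * s) ^+ 2) / (s / 4) ^+ 2 = 16 * qf x y s.
Proof.
move=> s0; have -> : (y - sg * s) ^+ 2 = y ^+ 2 - 2 * sg * y * s + (sg * sg) * s ^+ 2 by ring.
by rewrite sg2 /qf; field; rewrite gt_eqF.
Qed.

Let qf' (x y s : R) : R := - (2 * (x ^+ 2 + (y - sg * s) ^+ 2) / s ^+ 3) - 2 * sg * (y - sg * s) / s ^+ 2.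

Let is_derive_qf (x y s : R) : 0 < s -> is_derive s 1 (qf x y) (qf' x y s).
Proof.
move=> s0; have sn : s != 0 by rewrite gt_eqF.
have di : is_derive s 1 (fun z : R => z^-1) (- s ^- 2).
  have h := @is_deriveV R id s 1 1 sn (is_derive_id _ _).
  by apply: is_derive_eq; rewrite /GRing.scale/= mulr1.
apply: is_derive_eq.
have -> : qf' x y s = - (2 * (x ^+ 2 + y ^+ 2) / s ^+ 3) + (2 - 2 * (sg * sg)) / s - (2 * sg * y / s ^+ 2) + 4 * sg * y / s ^+ 2 + 2 * (sg * sg - 1) / s.
  by rewrite /qf'; field.
rewrite /GRing.scale/= sg2; field.
exact: sn.
Qed.

Lemma barrier_sub (t x y : R) : 0 < t -> t <= a - smin -> subsol_at m u1 u2 barrier t x y.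
Proof.
have h1 := smin0; have h2 := smina; have h3 := A0; have h4 := P0.
move=> t0 tT; set s := a - t; have s0 : 0 < s by rewrite /s; lra.
have sm : smin <= s by rewrite /s; lra.
have sa : s <= a by rewrite /s; lra.
have r0 : 0 < s / 4 by rewrite divr_gt0.
exists (A * hat2_x (sg * s) (s / 4) x y + P * hat2_x 0 rho x y),
  (A * hat2_y (sg * s) (s / 4) x y + P * hat2_y 0 rho x y),
  (A * (2 * Gk m (s / 4)) + P * (2 * Gk m rho)).
split.
- have d1 := is_derive_hat2_x (sg * s) (s / 4) x y.
  have d2 := is_derive_hat2_x 0 rho x y.
  rewrite /barrier -/s; apply: is_derive_eq; rewrite /GRing.scale/=; ring.
- have d1 := is_derive_hat2_y (sg * s) (s / 4) x y.
  have d2 := is_derive_hat2_y 0 rho x y.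
  rewrite /barrier -/s; apply: is_derive_eq; rewrite /GRing.scale/=; ring.
- move=> e e0.
  have [i1 l1] := hat2_pv m0 mc md mint (sg * s) x y r0 e0.
  have [i2 l2] := hat2_pv m0 mc md mint 0 x y rho0 e0.
  have mD := measurable_off_ball e.
  have j1 := integrableZl mD A i1; have j2 := integrableZl mD P i2.
  have E : (fun z : T2 => (barrier t x y - barrier t (x + z.1) (y + z.2)) * kern m z) =
     (fun z => A * ((hat2 (sg * s) (s / 4) x y - hat2 (sg * s) (s / 4) (x + z.1) (y + z.2)) * kern m z)
       + P * ((hat2 0 rho x y - hat2 0 rho (x + z.1) (y + z.2)) * kern m z)).
    by apply/funext => z; rewrite /barrier -/s; ring.
  rewrite E; split; first exact: (integrableD mD j1 j2).
  rewrite RintegralD// !RintegralZl// lerD// ler_wpM2l//.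
- move=> et et0.
  (* The error of linearizing [qf] is multiplied by [32 * A * S], at most [32 * A]; the [+ 1] covers
     [A = 0]. *)
  have e'0 : 0 < et / (32 * A + 1) by rewrite divr_gt0//; lra.
  have [d d0 hd] := derive_epsP (is_derive_qf x y s0) e'0.
  exists (Num.min d s); first by rewrite lt_min d0.
  move=> h h0; rewrite lt_min => /andP[hd1 hs].
  have {hd} := hd h; rewrite gtr0_norm// => /(_ hd1); rewrite ler_norml => /andP[_ hq].
  have sh : a - (t - h) = s + h by rewrite /s; ring.
  have incr := @Hk_incr _ m m0 mc mint (s / 4) (h / 4) r0.
  have {incr} incr : h / 4 / 4 * Gk m (s / 4) <= Hk m ((s + h) / 4) - Hk m (s / 4).
    by rewrite [(s + h) / 4]mulrDl; apply: incr; lra.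
  (* Convexity bounds the increment of the bump from below by its linear part; 16 is the square of
     the ratio of [s] to the radius [s / 4]. *)
  have := hat_convex (1 - 16 * qf x y s) (1 - 16 * qf x y (s + h)).
  rewrite -!qfE//; last by rewrite addr_gt0.
  have /andP[S0 S1] := hat2_slope_le (sg * s) (s / 4) x y.
  rewrite -/(hat2 (sg * (s + h)) ((s + h) / 4) x y) -/(hat2 (sg * s) (s / 4) x y).
  rewrite /barrier sh -/s /hat2_x /hat2_y -/s.
  have [gx gy] := hat2_grad0 x y rho0.
  rewrite -/(hat2_x 0 rho x y) -/(hat2_y 0 rho x y).
  set S := Num.max _ _ in S0 S1 *.
  set E1 := hat2 _ _ _ _; set E2 := hat2 _ _ _ _.
  rewrite !qfE//; last by rewrite addr_gt0.
  move=> conv.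
  pose X := u1 x y * x + (u2 x y + sg) * (y - sg * s) + (x ^+ 2 + (y - sg * s) ^+ 2) / s.
  (* The inequality [flow] is known on the disc only; off it the slope factor [S] vanishes. *)
  have bx : 0 <= S * (A * (X + ep * s)).
    have [p0|p0] := leP (1 - (x ^+ 2 + (y - sg * s) ^+ 2) / (s / 4) ^+ 2) 0.
      by rewrite /S max_l ?mul0r.
    apply: mulr_ge0 => //; apply: flow => //.
    by move: p0; rewrite subr_gt0 ltr_pdivrMr ?exprn_gt0// mul1r => /ltW.
  have bK : - (64 * A * ep / smin) <= 64 * (S * (A * X)) / s ^+ 2.
    rewrite ler_pdivlMr ?exprn_gt0//.
    have hs' : s <= s ^+ 2 / smin by rewrite ler_pdivlMr// expr2 ler_wpM2l// ltW.
    have hA : 0 <= A * ep by rewrite mulr_ge0.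
    have q3 := ler_wpM2l hA hs'.
    have q2 : S * (A * ep * s) <= A * ep * s by rewrite ler_piMl// mulr_ge0// ltW.
    have q1 : 0 <= S * (A * X) + S * (A * ep * s).
      by rewrite (_ : _ + _ = S * (A * (X + ep * s)))//; ring.
    rewrite (_ : - (64 * A * ep / smin) * s ^+ 2 = - (64 * (A * ep * (s ^+ 2 / smin)))); last by ring.
    lra.
  (* Transport of the bump plus the time derivative of the normalized distance: together they give
     exactly the bracket of [flow]. *)
  have id : u1 x y * (A * (2 * S * - (2 * x / (s / 4) ^+ 2))) +
      u2 x y * (A * (2 * S * - (2 * (y - sg * s) / (s / 4) ^+ 2))) + 32 * A * S * qf' x y s =
      - (64 * (S * (A * X)) / s ^+ 2).
    by rewrite /X /qf'; field; rewrite gt_eqF.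
  have bP : u1 x y * hat2_x 0 rho x y + u2 x y * hat2_y 0 rho x y <= 8 / rho.
    have hh (v w : R) : `|v| <= 1 -> `|w| <= 4 / rho -> v * w <= 4 / rho.
      move=> v1 w1; apply: le_trans (ler_norm _) _; rewrite normrM.
      by rewrite -[leRHS]mul1r; apply: ler_pM.
    have e1 := hh _ _ (u1b x y) gx; have e2 := hh _ _ (u2b x y) gy.
    have -> : 8 / rho = 4 / rho + 4 / rho by field; rewrite gt_eqF.
    exact: lerD.
  have e1 : 32 * A * S * (et / (32 * A + 1)) <= et.
    rewrite mulrA ler_pdivrMr; last by lra.
    have hAS : A * S <= A by rewrite ler_piMr.
    have : A * S * et <= A * et by rewrite ler_wpM2r// ltW.
    lra.
  have convA := ler_wpM2l A0 conv.
  have cq : 32 * A * S * (qf x y (s + h) - qf x y s - h * qf' x y s) <= h * et.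
    apply: (@le_trans _ _ (32 * A * S * (et / (32 * A + 1) * h))).
      by rewrite ler_wpM2l// !mulr_ge0.
    by rewrite mulrA mulrC ler_wpM2l// ltW.
  have cG := ler_wpM2l (_ : 0 <= 32 * A) incr; rewrite mulr_ge0// in cG.
  have {}cG := cG isT.
  rewrite (_ : 32 * A * (h / 4 / 4 * Gk m (s / 4)) = 2 * A * h * Gk m (s / 4)) in cG; last by field.
  have hP : h * (P * (u1 x y * hat2_x 0 rho x y + u2 x y * hat2_y 0 rho x y)) <= h * (P * (8 / rho)).
    by rewrite ler_wpM2l// ?ler_wpM2l// ltW.
  have hK := ler_wpM2l (ltW h0) bK.
  rewrite C2E.
  have idh : h * (u1 x y * (A * (2 * S * - (2 * x / (s / 4) ^+ 2)))) +
      h * (u2 x y * (A * (2 * S * - (2 * (y - sg * s) / (s / 4) ^+ 2)))) =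
      - (h * (64 * (S * (A * X)) / s ^+ 2)) - h * (32 * A * S * qf' x y s).
    have -> : - (h * (64 * (S * (A * X)) / s ^+ 2)) = h * (- (64 * (S * (A * X)) / s ^+ 2)) by ring.
    by rewrite -id; ring.
  clearbody E1 E2 S X.
  rewrite -subr_ge0.
  rewrite [X in 0 <= X](_ : _ =
    (A * (E1 - E2) - A * (2 * S * (1 - 16 * qf x y (s + h) - (1 - 16 * qf x y s)))) +
    (h * et - 32 * A * S * (qf x y (s + h) - qf x y s - h * qf' x y s)) +
    (32 * A * (Hk m ((s + h) / 4) - Hk m (s / 4)) - 2 * A * h * Gk m (s / 4)) +
    (h * (P * (8 / rho)) - h * (P * (u1 x y * hat2_x 0 rho x y + u2 x y * hat2_y 0 rho x y))) +
    (h * (64 * (S * (A * X)) / s ^+ 2) - h * (- (64 * A * ep / smin)))).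
    do 4 (apply: addr_ge0; last by rewrite subr_ge0).
    by rewrite subr_ge0.
  have -> : h * (64 * (S * (A * X)) / s ^+ 2) = - h * (32 * A * S * qf' x y s) - (h * (u1 x y * (A * (2 * S * - (2 * x / (s / 4) ^+ 2)))) +
      h * (u2 x y * (A * (2 * S * - (2 * (y - sg * s) / (s / 4) ^+ 2))))).
    by rewrite idh; ring.
  move: (s / 4) => s4.
  ring.
Qed.

End setup.

Lemma barrier_arith (Bh A Ha Hs P G ir E t h0 w e : R) :
  0 <= 32 * A * Hs -> P * (1 + t) * (2 * G) <= e / 4 -> P * (1 + t) * (8 * ir) <= 8 * e / 20 ->
  P * (1 - h0) <= P * (2 * ir) -> 0 <= P * G -> 0 <= P * ir -> 0 <= t * (P * ir) -> 0 <= e ->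
  Bh - (32 * A * (Ha - Hs) + (P * (2 * G) + P * (8 * ir) + E) * t) - P * (1 - h0) <= w ->
  Bh - 32 * A * Ha - E * t <= w + e.
Proof. by move=> *; lra. Qed.

(** The bound [M] fixes [P]; letting the confinement radius grow then removes every term with [P].
    Boundedness of [W] is thus used qualitatively, and the result does not involve [M]. *)
Lemma barrier_bound (u1 u2 : R -> R -> R) (W : R -> R -> R -> R) (sg A B M a smin ep : R) :
  (forall x y, `|u1 x y| <= 1) -> (forall x y, `|u2 x y| <= 1) ->
  sg * sg = 1 -> 0 <= A -> 0 <= ep -> 0 < smin -> smin <= a ->
  (forall s x y, smin <= s -> s <= a ->
    x ^+ 2 + (y - sg * s) ^+ 2 <= (s / 4) ^+ 2 ->
    0 <= A * (u1 x y * x + (u2 x y + sg) * (y - sg * s) +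
              (x ^+ 2 + (y - sg * s) ^+ 2) / s + ep * s)) ->
  evolves m u1 u2 W ->
  (forall t x y, 0 <= t -> t <= a - smin -> - M <= W t x y) ->
  (forall x y, B + A * hat2 (sg * a) (a / 4) x y <= W 0 x y) ->
  forall t x y, 0 <= t -> t <= a - smin ->
    B + A * hat2 (sg * (a - t)) ((a - t) / 4) x y - 32 * A * Hk m (a / 4) - 64 * A * ep / smin * t
      <= W t x y.
Proof.
move=> u1b u2b sg2 A0 ep0 smin0 smina flow We WM Winit t x y t0 tT.
have [P P0 PM] : exists2 P : R, 0 <= P & B + A + M <= P.
  by exists `|B + A + M|; [exact: normr_ge0|exact: ler_norm].
apply/ler_addgt0Pr => e e0.
have x2 := sqr_ge0 x; have y2 := sqr_ge0 y.
have [Q Q0 PQ] : exists2 Q : R, 0 < Q & P * (1 + t) <= Q.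
  by exists (P * (1 + t) + 1); [rewrite ltr_wpDl// mulr_ge0// addr_ge0|rewrite lerDl].
have Qe : 0 <= 20 * Q / e by rewrite divr_ge0 ?mulr_ge0// ltW.
(* [K >= x^2 + y^2] makes the confinement at the given point at most [2 * P / rho], and
   [K >= 20 * Q / e] makes this and the transport cost small. *)
have [K K1 [KQ Kxy]] : exists2 K : R, 1 <= K & 20 * Q / e <= K /\ x ^+ 2 + y ^+ 2 <= K.
  exists (1 + (20 * Q / e + (x ^+ 2 + y ^+ 2))); first by rewrite lerDl !addr_ge0.
  by move: Qe; move: (20 * Q / e) => v; split; lra.
have [rho Krho Grho] := @Gk_small _ m m0 mc mint K (e / (8 * Q)) K1 (divr_gt0 e0 (mulr_gt0 (ltr0Sn _ 7) Q0)).
have rho0 : 0 < rho by apply: lt_le_trans Krho; lra.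
pose C2 := P * (2 * Gk m rho) + P * (8 / rho) + 64 * A * ep / smin.
have bl : barrier sg A B P a rho C2 t x y <= W t x y.
  have c1 t' x' y' : 0 <= t' -> t' <= a - smin ->
      {for (t', x', y'), continuous (uncurry3 (barrier sg A B P a rho C2))}.
    by move=> h1 h2; exact: (barrier_continuous smin0 rho0 h1 h2).
  have c2 x' y' : barrier sg A B P a rho C2 0 x' y' <= W 0 x' y'.
    by apply: le_trans (Winit x' y'); exact: barrier_init.
  have c3 t' x' y' : 0 <= t' -> t' <= a - smin -> rho < `|x'| \/ rho < `|y'| ->
      barrier sg A B P a rho C2 t' x' y' <= W t' x' y'.
    move=> h1 h2 out; apply: le_trans (WM t' x' y' h1 h2).
    exact: (barrier_out sg A0 P0 smin0 rho0 ep0 erefl h1 h2 PM out).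
  have c4 t' x' y' : 0 < t' -> t' <= a - smin -> subsol_at m u1 u2 (barrier sg A B P a rho C2) t' x' y'.
    by move=> h1 h2; exact: (barrier_sub B u1b u2b sg2 A0 P0 smin0 smina rho0 ep0 erefl flow x' y' h1 h2).
  exact: (comparison m0 We c1 c2 c3 c4 x y t0 tT).
have Gs0 := @Gk_ge0 _ m m0 rho.
have Hs0 : 0 <= Hk m ((a - t) / 4) by apply: Hk_ge0 => //; rewrite divr_gt0//; lra.
have AH : 0 <= 32 * A * Hk m ((a - t) / 4) by rewrite mulr_ge0// mulr_ge0.
have hq : 1 - hat2 0 rho x y <= 2 * ((x ^+ 2 + y ^+ 2) / rho ^+ 2).
  have := hat_convex 1 (1 - (x ^+ 2 + (y - 0) ^+ 2) / rho ^+ 2).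
  rewrite -/(hat2 0 rho x y) {1}/hat max_r// expr1n subr0 mulr1.
  move: (hat2 0 rho x y) ((x ^+ 2 + y ^+ 2) / rho ^+ 2) => v w; lra.
have ir : rho^-1 <= e / (20 * Q).
  rewrite -invf_div lef_pV2 ?posrE// ?divr_gt0 ?mulr_gt0//; exact: le_trans Krho.
have hq2 : (x ^+ 2 + y ^+ 2) / rho ^+ 2 <= rho^-1.
  rewrite expr2 invfM mulrA -[leRHS]mul1r ler_wpM2r ?invr_ge0 ?(ltW rho0)//.
  rewrite ler_pdivrMr// mul1r; exact: le_trans Krho.
have ir0 : 0 <= rho^-1 by rewrite invr_ge0 (ltW rho0).
have Pt0 : 0 <= P * (1 + t) by rewrite mulr_ge0 ?addr_ge0.
have k1 : P * (1 + t) * (2 * Gk m rho) <= e / 4.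
  apply: (@le_trans _ _ (Q * (2 * (e / (8 * Q))))).
    apply: ler_pM; [exact: Pt0|exact: mulr_ge0|exact: PQ|].
    by rewrite ler_wpM2l.
  by rewrite le_eqVlt; apply/orP; left; apply/eqP; field; rewrite gt_eqF.
have k2 : P * (1 + t) * (8 * rho^-1) <= 8 * e / 20.
  apply: (@le_trans _ _ (Q * (8 * (e / (20 * Q))))).
    apply: ler_pM; [exact: Pt0|exact: mulr_ge0|exact: PQ|].
    by rewrite ler_wpM2l.
  by rewrite le_eqVlt; apply/orP; left; apply/eqP; field; rewrite gt_eqF.
have k3 : P * (1 - hat2 0 rho x y) <= P * (2 * rho^-1).
  rewrite ler_wpM2l//; apply: le_trans hq _; exact: ler_wpM2l.
have k4 : 0 <= P * Gk m rho by rewrite mulr_ge0.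
have k5 : 0 <= P * rho^-1 by rewrite mulr_ge0.
have k6 : 0 <= t * (P * rho^-1) by rewrite mulr_ge0.
move: bl; rewrite /barrier /C2 => bl.
exact: (barrier_arith AH k1 k2 k3 k4 k5 k6 (ltW e0) bl).
Qed.

End Barrier.

(** * Truncations of the inverse square root *)

Section Elementary.
Variable R : realType.

Lemma mean_value (f f' : R -> R) (a b : R) : a <= b ->
  (forall x : R, is_derive x 1 f (f' x)) ->
  exists2 c, a <= c <= b & f b - f a = f' c * (b - a).
Proof.
move=> ab df.
have [|c cab E] := @MVT_segment R f f' a b ab (fun x _ => df x).
  apply: continuous_subspaceT => x; apply: differentiable_continuous.
  by apply/derivable1_diffP; case: (df x).
by exists c => //; move: cab; rewrite in_itv.
Qed.

Lemma le_sin (x : R) : `|sin x| <= `|x|.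
Proof.
have pos (y : R) : 0 <= y -> `|sin y| <= y.
  move=> y0; have [c _ E] := @mean_value (@sin R) (@cos R) 0 y y0 (fun x => is_derive_sin x).
  move: E; rewrite sin0 !subr0 => ->; rewrite normrM (ger0_norm y0).
  by rewrite ler_piMl// cos_max.
have [x0|x0] := leP 0 x; first by rewrite (ger0_norm x0) pos.
rewrite (ltr0_norm x0) -normrN -sinN; apply: pos; rewrite oppr_ge0; exact: ltW.
Qed.

Lemma cos_ge (x : R) : 1 - x ^+ 2 / 2 <= cos x.
Proof.
have -> : cos x = 1 - 2 * sin (x / 2) ^+ 2.
  have := cos_mulr2n (x / 2); rewrite -[(x / 2) *+ 2]mulr_natl mulrCA divff// mulr1 => ->.
  by rewrite cos2sin2 -mulr_natl; ring.
have h := le_sin (x / 2).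
have : sin (x / 2) ^+ 2 <= (x / 2) ^+ 2.
  by rewrite -(@real_normK _ (sin _)) ?num_real// -(@real_normK _ (x / 2)) ?num_real// lerXn2r ?nnegrE.
have -> : (x / 2) ^+ 2 = x ^+ 2 / 4 by field.
lra.
Qed.

(** [5 / 16] is the largest ordinate [s + s / 4] of the discs with [s <= 1 / 4]. *)
Lemma sin_ge (y : R) : 0 <= y -> y <= 5 / 16 -> 19 / 20 * y <= sin y.
Proof.
move=> y0 y1; have [c /andP[c0 cy] E] := @mean_value (@sin R) (@cos R) 0 y y0 (fun x => is_derive_sin x).
move: E; rewrite sin0 !subr0 => ->; apply: ler_wpM2r => //.
by apply: le_trans (cos_ge c); nra.
Qed.

Lemma bernoulli (k : R) n : 0 <= k -> 1 + n%:R * k <= (1 + k) ^+ n.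
Proof.
move=> k0; elim: n => [|n IH]; first by rewrite mul0r addr0 expr0.
rewrite exprS; apply: le_trans (_ : (1 + k) * (1 + n%:R * k) <= _); last first.
  by rewrite ler_wpM2l// addr_ge0.
have : 0 <= n%:R * k * k by rewrite !mulr_ge0.
by rewrite -natr1; lra.
Qed.

(** With [N.+1 = 2 n], Bernoulli bounds [(1 - k)^n] by [1 / (n k)]; its square beats the linear
    factor. *)
Lemma geometric_small (k e : R) : 0 < k -> k <= 1 -> 0 < e ->
  exists N : nat, (2 * N%:R + 1) * (1 - k) ^+ N.+1 <= e.
Proof.
move=> k0 k1 e0.
pose n := (Num.truncn (4 / (e * k ^+ 2))).+1.
have n0 : 0 < n%:R :> R by rewrite ltr0n.
have hn : 4 / (e * k ^+ 2) <= n%:R by apply/ltW; exact: truncnS_gt.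
have ek : 0 < e * k ^+ 2 by rewrite mulr_gt0// exprn_gt0.
have nk : 4 <= n%:R * (e * k ^+ 2) by rewrite -ler_pdivrMr.
exists (n + n).-1.
rewrite prednK ?addn_gt0 ?ltr0n//.
have -> : 2 * (n + n).-1%:R + 1 = 4 * n%:R - 1 :> R.
  by rewrite -[(n + n).-1%:R](addrK 1) natr1 prednK// natrD; ring.
have q0 : 0 <= (1 - k) ^+ n by rewrite exprn_ge0// subr_ge0.
have q1 : (1 - k) ^+ n * (1 + n%:R * k) <= 1.
  apply: le_trans (ler_wpM2l q0 (bernoulli n (ltW k0))) _.
  by rewrite -exprMn exprn_ile1//; nra.
rewrite exprD; move: q0 q1 nk n0; set q := (1 - k) ^+ n; set v := n%:R => q0 q1 nk n0.
have qv : q * (v * k) <= 1 by nra.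
have qv0 : 0 <= q * (v * k) by rewrite !mulr_ge0// ltW.
have qv2 : (q * (v * k)) ^+ 2 <= 1 by rewrite expr_le1.
have qq0 : 0 <= q * q by rewrite mulr_ge0.
apply: (@le_trans _ _ (4 * v * (q * q))); first by rewrite ler_wpM2r//; lra.
apply: (@le_trans _ _ (v * (e * k ^+ 2) * v * (q * q))).
  by rewrite ler_wpM2r// ler_wpM2r// ltW.
have -> : v * (e * k ^+ 2) * v * (q * q) = e * (q * (v * k)) ^+ 2 by ring.
by rewrite ler_piMr// ltW.
Qed.

(* Coefficients of the binomial series of [(1 - w)^(-1/2)]. *)
Fixpoint isq_coef (n : nat) : R :=
  if n is n'.+1 then isq_coef n' * ((2 * n'%:R + 1) / (2 * n'%:R + 2)) else 1.

Arguments isq_coef n : simpl never.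

Lemma isq_coefS n : isq_coef n.+1 = isq_coef n * ((2 * n%:R + 1) / (2 * n%:R + 2)).
Proof. by []. Qed.

Fixpoint isq (N : nat) (w : R) : R :=
  if N is N'.+1 then isq N' w + isq_coef N'.+1 * w ^+ N'.+1 else 1.

Fixpoint isq' (N : nat) (w : R) : R :=
  if N is N'.+1 then isq' N' w + isq_coef N'.+1 * (N'.+1%:R * w ^+ N') else 0.

(* The defect of [isq N] in the equation [2 (1 - w) f' = f] satisfied by [(1 - w)^(-1/2)]. *)
Definition isq_def (N : nat) (w : R) : R := (2 * N%:R + 1) * isq_coef N * w ^+ N.

Lemma isq_coef_bounds n : 0 <= isq_coef n <= 1.
Proof.
elim: n => [|n /andP[h0 h1]]; first by rewrite /isq_coef ler01 lexx.
rewrite isq_coefS.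
have n0 : 0 <= n%:R :> R by [].
have q0 : 0 <= (2 * n%:R + 1) / (2 * n%:R + 2) :> R by apply: divr_ge0; lra.
have q1 : (2 * n%:R + 1) / (2 * n%:R + 2) <= 1 :> R by rewrite ler_pdivrMr; lra.
by rewrite mulr_ge0// mulr_ile1.
Qed.

Lemma isq_ode N w : 2 * (1 - w) * isq' N w = isq N w - isq_def N w.
Proof.
elim: N => [|N IH] /=; first by rewrite /isq_def /isq_coef expr0; ring.
rewrite mulrDr IH /isq_def isq_coefS.
have n0 : 0 <= N%:R :> R by [].
rewrite -natr1 exprS; field.
lra.
Qed.

Lemma is_derive_pow n (w : R) : is_derive w 1 (fun z : R => z ^+ n.+1) (n.+1%:R * w ^+ n).
Proof.
have -> : (fun z : R => z ^+ n.+1) = (id : R -> R) ^+ n.+1.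
  by apply/funext => z; rewrite exprfctE.
by apply: is_derive_eq; rewrite /GRing.scale/= mulr1.
Qed.

Lemma is_derive_add_monom (f : R -> R) (w df c : R) n : is_derive w 1 f df ->
  is_derive w 1 (fun z => f z + c * z ^+ n.+1) (df + c * (n.+1%:R * w ^+ n)).
Proof.
by move=> h; have h' := is_derive_pow n w; apply: is_derive_eq; rewrite /GRing.scale/=; ring.
Qed.

Lemma is_derive_isq N (w : R) : is_derive w 1 (isq N) (isq' N w).
Proof.
elim: N => [|N IH]; first exact: is_derive_cst.
exact: (is_derive_add_monom (isq_coef N.+1) N IH).
Qed.

Lemma isq'_ge0 N (w : R) : 0 <= w -> 0 <= isq' N w.
Proof.
move=> w0; elim: N => [//|N IH] /=; apply: addr_ge0 => //; apply: mulr_ge0.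
  by case/andP: (isq_coef_bounds N.+1).
by apply: mulr_ge0 => //; exact: exprn_ge0.
Qed.

Lemma isq_ge1 N (w : R) : 0 <= w -> 1 <= isq N w.
Proof.
move=> w0; elim: N => [//|N IH] /=; apply: le_trans IH _.
rewrite lerDl; apply: mulr_ge0; last exact: exprn_ge0.
by case/andP: (isq_coef_bounds N.+1).
Qed.

Lemma isq_leS N (w : R) : 0 <= w -> w <= 1 -> isq N w <= N.+1%:R.
Proof.
move=> w0 w1; elim: N => [//|N IH] /=; rewrite -[leRHS]natr1 lerD//.
case/andP: (isq_coef_bounds N.+1) => h0 h1; apply: mulr_ile1 => //; [exact: exprn_ge0|exact: exprn_ile1].
Qed.

Lemma isq_def_ge0 N w : 0 <= w -> 0 <= isq_def N w.
Proof.
move=> w0; apply: mulr_ge0; last exact: exprn_ge0.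
apply: mulr_ge0; first by rewrite addr_ge0// mulr_ge0.
by case/andP: (isq_coef_bounds N).
Qed.

Lemma isq_def_le N w : 0 <= w -> w <= 1 -> isq_def N w <= isq N w.
Proof.
move=> w0 w1; rewrite -subr_ge0 -isq_ode; apply: mulr_ge0; last exact: isq'_ge0.
by rewrite mulr_ge0// subr_ge0.
Qed.

(** Identically 1 for the full binomial series. Its derivative only involves the defect, which makes
    the truncation error monotone and explicit. *)
Let g N (w : R) := (1 - w) * isq N w ^+ 2.

Let dg N (w : R) : is_derive w 1 (g N) (- (isq N w * isq_def N w)).
Proof.
have h := is_derive_isq N w.
rewrite /g; apply: is_derive_eq; rewrite /GRing.scale/=.
have -> : isq_def N w = isq N w - 2 * (1 - w) * isq' N w by rewrite isq_ode; ring.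
ring.
Qed.

Let g0 N : g N 0 = 1.
Proof.
rewrite /g subr0 mul1r; suff -> : isq N 0 = 1 by rewrite expr1n.
by elim: N => //= n ->; rewrite expr0n mulr0 addr0.
Qed.

Lemma isq_upper N w : 0 <= w -> w <= 1 -> (1 - w) * isq N w ^+ 2 <= 1.
Proof.
move=> w0 w1; have [c /andP[c0 cw] E] := @mean_value (g N) _ 0 w w0 (dg N).
have g1 := g0 N.
have c1 : c <= 1 by exact: le_trans w1.
have : 0 <= isq N c * isq_def N c * w.
  apply: mulr_ge0 => //; apply: mulr_ge0; last exact: isq_def_ge0.
  by apply: le_trans ler01 _; exact: isq_ge1.
move: E; rewrite g1 subr0 -/(g N w); lra.
Qed.

(** Adding [(2 N + 1) * w^(N+1)] to [g] compensates its decrease, because [isq N] is at most [N + 1]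
    and its coefficients at most 1. *)
Lemma isq_lower N w : 0 <= w -> w <= 1 ->
  1 - (2 * N%:R + 1) * w ^+ N.+1 <= (1 - w) * isq N w ^+ 2.
Proof.
move=> w0 w1.
pose G (z : R) := g N z + (2 * N%:R + 1) * z ^+ N.+1.
have dG (z : R) : is_derive z 1 G (- (isq N z * isq_def N z) + (2 * N%:R + 1) * (N.+1%:R * z ^+ N)).
  exact: (is_derive_add_monom (2 * N%:R + 1) N (dg N z)).
have [c /andP[c0 cw] E] := @mean_value G _ 0 w w0 dG.
have G1 : G 0 = 1.
  by rewrite /G g0 expr0n mulr0 addr0.
have c1 : c <= 1 by exact: le_trans w1.
have : 0 <= (- (isq N c * isq_def N c) + (2 * N%:R + 1) * (N.+1%:R * c ^+ N)) * (w - 0).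
  rewrite subr0 mulr_ge0// addrC subr_ge0.
  have -> : (2 * N%:R + 1) * (N.+1%:R * c ^+ N) = N.+1%:R * ((2 * N%:R + 1) * c ^+ N) by ring.
  apply: ler_pM; [by apply: le_trans ler01 _; exact: isq_ge1|exact: isq_def_ge0|exact: isq_leS|].
  rewrite /isq_def; apply: ler_wpM2r; first exact: exprn_ge0.
  by apply: ler_piMr; [rewrite addr_ge0// mulr_ge0|case/andP: (isq_coef_bounds N)].
rewrite -E G1 /G -/(g N w); lra.
Qed.

End Elementary.

(** * Trigonometric polynomials *)

Section Smooth.
Variable R : realType.

(** A family of continuous, differentiable functions stable under the three partial derivatives
    consists of smooth functions; no order of differentiation has to be tracked. *)
Lemma smooth_closed (D : R -> R -> R -> Prop) (S : (R -> R -> R -> R) -> Prop) :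
  (forall F, S F -> forall t x y, D t x y ->
     {for (t, x, y), continuous (uncurry3 F)} /\
     [/\ derivable (fun s => F s x y) t 1, derivable (fun s => F t s y) x 1 &
         derivable (fun s => F t x s) y 1]) ->
  (forall F, S F -> [/\ S (dT F), S (dX F) & S (dY F)]) ->
  forall F, S F -> smooth_on D F.
Proof.
move=> h1 h2 F SF k; elim: k F SF => [|k IH] F SF /=.
  by move=> t x y Dt; case: (h1 F SF t x y Dt).
have [ST SX SY] := h2 F SF.
split; first by move=> t x y Dt; case: (h1 F SF t x y Dt).
by repeat split; apply: IH.
Qed.

Definition phase (p : R * R * R * R) (x y : R) : R := p.1.1.2 * x + p.1.2 * y + p.2.

(** An entry holds an amplitude, two frequencies and a phase. Differentiation multiplies by a
    frequency and shifts the phase by [pi / 2], so the class is stable. *)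
Fixpoint waves (l : seq (R * R * R * R)) (x y : R) : R :=
  if l is p :: l' then p.1.1.1 * cos (phase p x y) + waves l' x y else 0.

Definition waves_dx (l : seq (R * R * R * R)) :=
  [seq (p.1.1.1 * p.1.1.2, p.1.1.2, p.1.2, p.2 + pi / 2) | p <- l].
Definition waves_dy (l : seq (R * R * R * R)) :=
  [seq (p.1.1.1 * p.1.2, p.1.1.2, p.1.2, p.2 + pi / 2) | p <- l].

Lemma is_derive_waves_x l (x y : R) :
  is_derive x 1 (fun s => waves l s y) (waves (waves_dx l) x y).
Proof.
elim: l => [|p l IH] /=; first exact: is_derive_cst.
have d : is_derive x 1 (fun s => phase p s y) p.1.1.2.
  by rewrite /phase; apply: is_derive_eq; rewrite /GRing.scale/=; ring.
have := @is_derive1_comp _ (@cos R) (fun s => phase p s y) x _ _ (is_derive_cos _) d => dc.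
have E : phase (p.1.1.1 * p.1.1.2, p.1.1.2, p.1.2, p.2 + pi / 2) x y = phase p x y + pi / 2.
  by rewrite /phase /= addrA.
rewrite E cosDpihalf.
have -> : (fun s => p.1.1.1 * cos (phase p s y) + waves l s y) =
  (fun s => p.1.1.1 * (@cos R \o (fun s => phase p s y)) s + waves l s y) by [].
by apply: is_derive_eq; rewrite /GRing.scale/=; ring.
Qed.

Lemma is_derive_waves_y l (x y : R) :
  is_derive y 1 (fun s => waves l x s) (waves (waves_dy l) x y).
Proof.
elim: l => [|p l IH] /=; first exact: is_derive_cst.
have d : is_derive y 1 (fun s => phase p x s) p.1.2.
  by rewrite /phase; apply: is_derive_eq; rewrite /GRing.scale/=; ring.
have := @is_derive1_comp _ (@cos R) (fun s => phase p x s) y _ _ (is_derive_cos _) d => dc.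
have E : phase (p.1.1.1 * p.1.2, p.1.1.2, p.1.2, p.2 + pi / 2) x y = phase p x y + pi / 2.
  by rewrite /phase /= addrA.
rewrite E cosDpihalf.
have -> : (fun s => p.1.1.1 * cos (phase p x s) + waves l x s) =
  (fun s => p.1.1.1 * (@cos R \o (fun s => phase p x s)) s + waves l x s) by [].
by apply: is_derive_eq; rewrite /GRing.scale/=; ring.
Qed.

Lemma waves_continuous l (t x y : R) :
  {for (t, x, y), continuous (uncurry3 (fun _ x y => waves l x y))}.
Proof.
elim: l => [|p l IH]; first exact: cvg_cst.
apply: (@cvgD _ _ _ _ _ (fun q : R * R * R => p.1.1.1 * cos (phase p q.1.2 q.2)) (fun q => waves l q.1.2 q.2) _ _ _ IH).
apply: cvgMr.
have cx : (fun q : R * R * R => q.1.2) @ (t, x, y) --> x.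
  by apply: (cvg_comp fst snd); [exact: cvg_fst|exact: cvg_snd].
have cy : (fun q : R * R * R => q.2) @ (t, x, y) --> y by exact: cvg_snd.
have cp : (fun q : R * R * R => phase p q.1.2 q.2) @ (t, x, y) --> phase p x y.
  apply: cvgD; last exact: cvg_cst.
  by apply: cvgD; exact: cvgMr.
exact: (cvg_comp (fun q : R * R * R => phase p q.1.2 q.2) (@cos R) cp (@continuous_cos R _)).
Qed.

Lemma waves_smooth l : smooth2 (waves l).
Proof.
pose S (F : R -> R -> R -> R) := exists l, F = fun _ x y => waves l x y.
apply: (@smooth_closed _ S); last by exists l.
- move=> F [l' ->] t x y _; split; first exact: waves_continuous.
  by split=> //; [case: (is_derive_waves_x l' x y)|case: (is_derive_waves_y l' x y)].
- move=> F [l' ->]; split.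
  + by exists [::]; apply/funext => t; apply/funext => x; apply/funext => y; rewrite /dT derive1_cst.
  + exists (waves_dx l'); apply/funext => t; apply/funext => x; apply/funext => y.
    exact: is_derive_derive1 (is_derive_waves_x l' x y).
  + exists (waves_dy l'); apply/funext => t; apply/funext => x; apply/funext => y.
    exact: is_derive_derive1 (is_derive_waves_y l' x y).
Qed.

End Smooth.

Section Trig.
Variable R : realType.
Implicit Types l : seq (R * int * int).

Definition ang (i j : int) (x y : R) : R := i%:~R * x + j%:~R * y.

(** Integer frequencies, so that the velocity shifts Fourier modes by lattice vectors. Cosines
    suffice because the stream function is even under central symmetry. *)
Definition cosum l (x y : R) : R := \sum_(p <- l) p.1.1 * cos (ang p.1.2 p.2 x y).

Definition trigpoly (f : R -> R -> R) := exists l, forall x y, f x y = cosum l x y.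

Lemma trigpolyD f g : trigpoly f -> trigpoly g -> trigpoly (fun x y => f x y + g x y).
Proof.
move=> [l fl] [l' gl]; exists (l ++ l') => x y.
by rewrite fl gl /cosum big_cat.
Qed.

Lemma trigpoly0 : trigpoly (fun _ _ => 0).
Proof. by exists [::] => x y; rewrite /cosum big_nil. Qed.

Lemma trigpoly_cos c i j : trigpoly (fun x y => c * cos (ang i j x y)).
Proof. by exists [:: (c, i, j)] => x y; rewrite /cosum big_seq1. Qed.

Lemma trigpoly_ext f g : (forall x y, f x y = g x y) -> trigpoly f -> trigpoly g.
Proof. by move=> fg [l fl]; exists l => x y; rewrite -fg fl. Qed.

Lemma trigpoly_cst c : trigpoly (fun _ _ => c).
Proof.
apply: trigpoly_ext (trigpoly_cos c 0 0) => x y.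
by rewrite /ang !mul0r addr0 cos0 mulr1.
Qed.

Lemma trigpolyM f g : trigpoly f -> trigpoly g -> trigpoly (fun x y => f x y * g x y).
Proof.
move=> [l fl] [l' gl].
apply: (@trigpoly_ext (fun x y => cosum l x y * cosum l' x y)).
  by move=> x y; rewrite fl gl.
elim: l {f fl} => [|[[c i] j] l IH].
  by apply: trigpoly_ext trigpoly0 => x y; rewrite /cosum big_nil mul0r.
apply: (@trigpoly_ext (fun x y => c * cos (ang i j x y) * cosum l' x y + cosum l x y * cosum l' x y)).
  by move=> x y; rewrite [cosum (_ :: _) _ _]big_cons mulrDl.
apply: trigpolyD => // {IH l g gl}.
elim: l' => [|[[c' i'] j'] l' IH].
  by apply: trigpoly_ext trigpoly0 => x y; rewrite /cosum big_nil mulr0.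
apply: (@trigpoly_ext (fun x y => (c * c' / 2 * cos (ang (i + i') (j + j') x y)
   + c * c' / 2 * cos (ang (i - i') (j - j') x y)) + c * cos (ang i j x y) * cosum l' x y)).
  move=> x y; rewrite /cosum big_cons mulrDr; congr (_ + _) => /=.
  have -> : ang (i + i') (j + j') x y = ang i j x y + ang i' j' x y.
    by rewrite /ang !rmorphD/=; ring.
  have -> : ang (i - i') (j - j') x y = ang i j x y - ang i' j' x y.
    by rewrite /ang !rmorphB/=; ring.
  by rewrite cosD cosB; field.
by apply: trigpolyD => //; apply: trigpolyD; exact: trigpoly_cos.
Qed.

Definition grad_x l (x y : R) : R := \sum_(p <- l) - (p.1.1 * p.1.2%:~R * sin (ang p.1.2 p.2 x y)).
Definition grad_y l (x y : R) : R := \sum_(p <- l) - (p.1.1 * p.2%:~R * sin (ang p.1.2 p.2 x y)).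

Definition freqs l : seq (R * R * R * R) := [seq (p.1.1, p.1.2%:~R, p.2%:~R, 0) | p <- l].

Lemma cosum_waves l x y : cosum l x y = waves (freqs l) x y.
Proof.
elim: l => [|p l IH]; first by rewrite /cosum big_nil.
by rewrite /cosum big_cons /= -IH /phase /= addr0.
Qed.

Lemma grad_x_waves l x y : grad_x l x y = waves (waves_dx (freqs l)) x y.
Proof.
elim: l => [|p l IH]; first by rewrite /grad_x big_nil.
rewrite /grad_x big_cons /= -IH /phase /= add0r cosDpihalf; congr (_ + _).
by rewrite mulrN.
Qed.

Lemma grad_y_waves l x y : grad_y l x y = waves (waves_dy (freqs l)) x y.
Proof.
elim: l => [|p l IH]; first by rewrite /grad_y big_nil.
rewrite /grad_y big_cons /= -IH /phase /= add0r cosDpihalf; congr (_ + _).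
by rewrite mulrN.
Qed.

Lemma is_derive_cosum_x l (x y : R) : is_derive x 1 (fun s => cosum l s y) (grad_x l x y).
Proof.
rewrite grad_x_waves (_ : (fun s => cosum l s y) = fun s => waves (freqs l) s y).
  exact: is_derive_waves_x.
by apply/funext => s; rewrite cosum_waves.
Qed.

Lemma is_derive_cosum_y l (x y : R) : is_derive y 1 (fun s => cosum l x s) (grad_y l x y).
Proof.
rewrite grad_y_waves (_ : (fun s => cosum l x s) = fun s => waves (freqs l) x s).
  exact: is_derive_waves_y.
by apply/funext => s; rewrite cosum_waves.
Qed.

(* [cosum l] is the stream function. *)
Definition vel1 l : R -> R -> R := grad_y l.
Definition vel2 l : R -> R -> R := fun x y => - grad_x l x y.

Lemma wavesN (l : seq (R * R * R * R)) x y :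
  waves [seq (- p.1.1.1, p.1.1.2, p.1.2, p.2) | p <- l] x y = - waves l x y.
Proof. by elim: l => [|p l IH] /=; rewrite ?oppr0// IH opprD mulNr. Qed.

Lemma vel1_smooth l : smooth2 (vel1 l).
Proof.
rewrite (_ : vel1 l = waves (waves_dy (freqs l))); first exact: waves_smooth.
by apply/funext => x; apply/funext => y; exact: grad_y_waves.
Qed.

Lemma vel2_smooth l : smooth2 (vel2 l).
Proof.
rewrite (_ : vel2 l = waves [seq (- p.1.1.1, p.1.1.2, p.1.2, p.2) | p <- waves_dx (freqs l)]); first exact: waves_smooth.
by apply/funext => x; apply/funext => y; rewrite wavesN -grad_x_waves.
Qed.

Lemma vel_div0 l x y : dx (vel1 l) x y + dy (vel2 l) x y = 0.
Proof.
have -> : dx (vel1 l) x y = waves (waves_dx (waves_dy (freqs l))) x y.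
  rewrite /dx (_ : (fun s => vel1 l s y) = fun s => waves (waves_dy (freqs l)) s y).
    exact: is_derive_derive1 (is_derive_waves_x _ _ _).
  by apply/funext => s; exact: grad_y_waves.
have -> : dy (vel2 l) x y = - waves (waves_dy (waves_dx (freqs l))) x y.
  rewrite /dy (_ : (fun s => vel2 l x s) = fun s => - waves (waves_dx (freqs l)) x s).
    apply: is_derive_derive1; have h := is_derive_waves_y (waves_dx (freqs l)) x y.
    exact: is_deriveN.
  by apply/funext => s; rewrite /vel2 grad_x_waves.
rewrite (_ : waves_dx (waves_dy (freqs l)) = waves_dy (waves_dx (freqs l))) ?subrr//.
rewrite /waves_dx /waves_dy -!map_comp; apply: eq_map => p /=.
by rewrite mulrAC.
Qed.

End Trig.

(** * A flow compressing the vertical axis *)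

Section Flow.
Variable R : realType.

(** As [1 - wcos] is half of [sin^2 x + sin^2 y], this factor turns [(1 - wcos)^(-1/2)] into the
    inverse root of [sin^2 x + sin^2 y]. *)
Let kap : R := Num.sqrt (1 / 2).

Let kap2 : kap ^+ 2 = 1 / 2. Proof. by rewrite sqr_sqrtr// divr_ge0. Qed.

Let kap0 : 0 <= kap. Proof. exact: sqrtr_ge0. Qed.

Lemma prod3_ge (e a b c : R) : 0 <= e -> 0 <= b <= 1 -> 0 <= c -> c <= 1 -> 1 - a <= c ->
  1 - (e + a + b) <= (1 - e) * (c * (1 - b)).
Proof.
move=> e0 /andP[b0 b1] c0 c1 ac.
have h1 : c * b <= b by rewrite ler_piMl.
have h2 : c * (1 - b) <= 1 by rewrite mulr_ile1//; lra.
have h3 : e * (c * (1 - b)) <= e by rewrite ler_piMr.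
lra.
Qed.

Definition wcos (x y : R) : R := (cos x ^+ 2 + cos y ^+ 2) / 2.

(* With [(1 - w)^(-1/2)] in place of [isq N w] this would be [sin x sin y / sqrt (sin^2 x + sin^2 y)],
   whose velocity on the axis [x = 0] is exactly [(0, - sgn (sin y))]. *)
Definition stream (N : nat) (x y : R) : R := kap * (sin x * sin y) * isq N (wcos x y).

Lemma trigpoly_wcos : trigpoly wcos.
Proof.
apply: (@trigpoly_ext _ (fun x y => 1 / 2 + (1 / 4 * cos (ang 2 0 x y) + 1 / 4 * cos (ang 0 2 x y)))).
  move=> x y; rewrite /ang !mul0r addr0 add0r /wcos.
  have h z : cos (2 * z) = 2 * cos z ^+ 2 - 1 :> R.
    by rewrite mulr_natl cos_mulr2n -mulr_natl.
  by rewrite !h; field.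
apply: trigpolyD; first exact: trigpoly_cst.
by apply: trigpolyD; exact: trigpoly_cos.
Qed.

Lemma trigpoly_isq N : trigpoly (fun x y => isq N (wcos x y)).
Proof.
have pw n : trigpoly (fun x y => wcos x y ^+ n).
  elim: n => [|n IH]; first exact: trigpoly_cst.
  apply: (@trigpoly_ext _ (fun x y => wcos x y * wcos x y ^+ n)); first by move=> x y; rewrite exprS.
  by apply: trigpolyM => //; exact: trigpoly_wcos.
elim: N => [|N IH]; first exact: trigpoly_cst.
apply: trigpolyD => //; apply: trigpolyM; [exact: trigpoly_cst|exact: pw].
Qed.

Lemma trigpoly_stream N : trigpoly (stream N).
Proof.
apply: trigpolyM; last exact: trigpoly_isq.
apply: trigpolyM; first exact: trigpoly_cst.
apply: (@trigpoly_ext _ (fun x y => 1 / 2 * cos (ang 1 (-1) x y) + - (1 / 2) * cos (ang 1 1 x y))).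
  move=> x y; rewrite /ang !mul1r rmorphN1 mulN1r cosB cosD.
  by field.
by apply: trigpolyD; exact: trigpoly_cos.
Qed.

Lemma is_derive_stream_y N (x y : R) : is_derive y 1 (fun s => stream N x s)
  (kap * sin x * (cos y * (isq N (wcos x y) - sin y ^+ 2 * isq' N (wcos x y)))).
Proof.
have dw : is_derive y 1 (fun s => wcos x s) (- (cos y * sin y)).
  by rewrite /wcos; apply: is_derive_eq; rewrite /GRing.scale/=; field.
have := @is_derive1_comp _ (isq N) (fun s => wcos x s) y _ _ (is_derive_isq N _) dw => dc.
have -> : (fun s => stream N x s) = (fun s => kap * (sin x * sin s) * (isq N \o (fun s => wcos x s)) s) by [].
by apply: is_derive_eq; rewrite /GRing.scale/=; ring.
Qed.

Lemma is_derive_stream_x N (x y : R) : is_derive x 1 (fun s => stream N s y)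
  (kap * sin y * (cos x * (isq N (wcos x y) - sin x ^+ 2 * isq' N (wcos x y)))).
Proof.
have dw : is_derive x 1 (fun s => wcos s y) (- (cos x * sin x)).
  by rewrite /wcos; apply: is_derive_eq; rewrite /GRing.scale/=; field.
have := @is_derive1_comp _ (isq N) (fun s => wcos s y) x _ _ (is_derive_isq N _) dw => dc.
have -> : (fun s => stream N s y) = (fun s => kap * (sin s * sin y) * (isq N \o (fun s => wcos s y)) s) by [].
by apply: is_derive_eq; rewrite /GRing.scale/=; ring.
Qed.

Let v1 N (x y : R) := kap * sin x * (cos y * (isq N (wcos x y) - sin y ^+ 2 * isq' N (wcos x y))).
Let v2 N (x y : R) := - (kap * sin y * (cos x * (isq N (wcos x y) - sin x ^+ 2 * isq' N (wcos x y)))).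

Let wcos01 x y : 0 <= wcos x y <= 1.
Proof.
rewrite /wcos divr_ge0 ?addr_ge0 ?sqr_ge0//=.
by rewrite ler_pdivrMr// mul1r; have := sin2cos2 x; have := sin2cos2 y;
  have := sqr_ge0 (sin x); have := sqr_ge0 (sin y); lra.
Qed.

Let wcosE x y : 2 * (1 - wcos x y) = sin x ^+ 2 + sin y ^+ 2.
Proof. by rewrite !sin2cos2 /wcos; field. Qed.

(** The differential equation of [isq] eliminates its derivative. What remains is a sum of
    nonnegative terms, and for the full series only the first. *)
Let slopeE N x y (a b : R) : a + b = sin x ^+ 2 + sin y ^+ 2 ->
  (a + b) * (isq N (wcos x y) - a * isq' N (wcos x y)) =
  isq N (wcos x y) * b + isq_def N (wcos x y) * a.
Proof.
move=> ab; have := isq_ode N (wcos x y); rewrite wcosE -ab => ode.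
have -> : isq_def N (wcos x y) = isq N (wcos x y) - (a + b) * isq' N (wcos x y) by rewrite ode; ring.
ring.
Qed.

Let slope_bounds N x y (a b : R) : 0 <= a -> 0 <= b -> 0 < a + b -> a + b = sin x ^+ 2 + sin y ^+ 2 ->
  0 <= isq N (wcos x y) - a * isq' N (wcos x y) <= isq N (wcos x y).
Proof.
move=> a0 b0 ab0 ab; have /andP[w0 w1] := wcos01 x y.
have p1 := isq_ge1 N w0; have d0 := isq_def_ge0 N w0; have dp := isq_def_le N w0 w1.
have p'0 := isq'_ge0 N w0.
apply/andP; split; last by rewrite gerBl mulr_ge0.
rewrite -(pmulr_rge0 _ ab0) (slopeE _ ab) addr_ge0// mulr_ge0//.
exact: le_trans ler01 p1.
Qed.

(** Bounding cosines by 1 and slopes by [isq], the squared speed is at most [(1 - w) * isq^2], where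
    [isq_upper] applies with no loss: hence the exact bound 1. *)
Lemma vel_bound N x y : enorm (v1 N x y) (v2 N x y) <= 1.
Proof.
rewrite -(@ler_pXn2r _ 2)// ?nnegrE ?enorm_ge0// expr1n enorm_sqr.
have /andP[w0 w1] := wcos01 x y.
set X := sin x; set Y := sin y.
have [S0|S0] := eqVneq (X ^+ 2 + Y ^+ 2) 0.
  have X0 : X = 0 by apply/eqP; move/eqP: S0; rewrite paddr_eq0 ?sqr_ge0// !sqrf_eq0 => /andP[].
  have Y0 : Y = 0 by apply/eqP; move/eqP: S0; rewrite paddr_eq0 ?sqr_ge0// !sqrf_eq0 => /andP[].
  by rewrite /v1 /v2 -/X -/Y X0 Y0 !mulr0 !mul0r oppr0 expr0n/= addr0.
have Sp : 0 < X ^+ 2 + Y ^+ 2 by rewrite lt_neqAle eq_sym S0 addr_ge0 ?sqr_ge0.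
have SYp : 0 < Y ^+ 2 + X ^+ 2 by rewrite addrC.
have /andP[a0 a1] := @slope_bounds N x y (Y ^+ 2) (X ^+ 2) (sqr_ge0 _) (sqr_ge0 _) SYp (addrC _ _).
have /andP[b0 b1] := @slope_bounds N x y (X ^+ 2) (Y ^+ 2) (sqr_ge0 _) (sqr_ge0 _) Sp erefl.
have up := isq_upper N w0 w1.
have hw := wcosE x y.
rewrite /v1 /v2 -/X -/Y sqrrN !exprMn kap2.
move: a0 a1 b0 b1; set P := isq N _ in up *; set A := _ - _; set B := P - X ^+ 2 * _ => a0 a1 b0 b1.
have A2 : A ^+ 2 <= P ^+ 2 by rewrite lerXn2r ?nnegrE// (le_trans a0).
have B2 : B ^+ 2 <= P ^+ 2 by rewrite lerXn2r ?nnegrE// (le_trans b0).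
have cy : cos y ^+ 2 <= 1 by rewrite cos2sin2 gerBl sqr_ge0.
have cx : cos x ^+ 2 <= 1 by rewrite cos2sin2 gerBl sqr_ge0.
have h1 : cos y ^+ 2 * A ^+ 2 <= P ^+ 2.
  by apply: le_trans A2; rewrite ler_piMl// sqr_ge0.
have h2 : cos x ^+ 2 * B ^+ 2 <= P ^+ 2.
  by apply: le_trans B2; rewrite ler_piMl// sqr_ge0.
have h3 := ler_wpM2l (sqr_ge0 X) h1; have h4 := ler_wpM2l (sqr_ge0 Y) h2.
have : (X ^+ 2 + Y ^+ 2) * P ^+ 2 <= 2 by rewrite -hw -mulrA; lra.
rewrite -!mulrA; lra.
Qed.

Let vel_odd N (sg x y : R) : sg * sg = 1 ->
  v1 N x (sg * y) = v1 N x y /\ v2 N x (sg * y) = sg * v2 N x y.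
Proof.
move=> sg2.
have : sg = 1 \/ sg = - 1.
  have /eqP : (sg - 1) * (sg + 1) = 0 by rewrite mulrDr mulr1 mulrBl sg2; ring.
  by rewrite mulf_eq0 subr_eq0 addr_eq0 => /orP[/eqP|/eqP]; [left|right].
case=> ->; first by rewrite !mul1r.
have we : wcos x (- y) = wcos x y by rewrite /wcos cosN.
rewrite !mulN1r /v1 /v2 we cosN sinN sqrrN; split=> //; ring.
Qed.

(** The horizontal term is nonnegative. Above the centre, [v2 >= - 1] suffices. Below it, [v2] must
    be close to [- 1]; its deviation is of order [ep + x^2 + (x / s)^2], and times [s - y] it is
    absorbed by the last two terms. *)
Let flow_up N (ep s x y : R) : 0 < s -> s <= 1 / 4 -> 0 <= ep ->
  (forall w, 0 <= w -> w <= 1 - s ^+ 2 / 4 -> 1 - ep <= (1 - w) * isq N w ^+ 2) ->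
  ep <= 1 ->
  x ^+ 2 + (y - s) ^+ 2 <= (s / 4) ^+ 2 ->
  0 <= v1 N x y * x + (v2 N x y + 1) * (y - s) + (x ^+ 2 + (y - s) ^+ 2) / s + ep * s.
Proof.
move=> s0 s14 ep0 H ep1 hxy.
have x2 := sqr_ge0 x; have y2 := sqr_ge0 (y - s).
have xs : `|x| <= s / 4 by rewrite ler_norml; apply/andP; split; nra.
have ys : `|y - s| <= s / 4 by rewrite ler_norml; apply/andP; split; nra.
move: (xs) (ys); rewrite !ler_norml => /andP[x_l x_u] /andP[y_l y_u].
have y0 : 0 < y by lra.
have Yl : 19 / 20 * y <= sin y by apply: sin_ge; lra.
have cx := cos_ge x; have cx1 := cos_le1 x.
have cx0 : 0 <= cos x by nra.
have cy0 : 0 <= cos y by have := cos_ge y; nra.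
have Xx : sin x ^+ 2 <= x ^+ 2.
  by rewrite -(@real_normK _ (sin _)) ?num_real// -(@real_normK _ x) ?num_real// lerXn2r ?nnegrE// le_sin.
have xsin : 0 <= sin x * x.
  have [x0|x0] := leP 0 x.
    by apply: mulr_ge0 => //; have := @sin_ge R x x0 (_ : x <= 5 / 16); lra.
  have := @sin_ge R (- x); rewrite sinN => /(_ _ _)/wrap[||h]; [lra|lra|].
  by apply: mulr_le0; lra.
have /andP[w0 w1] := wcos01 x y.
have hw := wcosE x y.
have vb := vel_bound N x y.
have V1 : - 1 <= v2 N x y.
  have := le_trans (enorm_ge2 (v1 N x y) (v2 N x y)) vb.
  by rewrite ler_norml => /andP[].
move: V1; rewrite /v1 /v2; set X := sin x in Xx xsin hw *; set Y := sin y in Yl hw *.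
have Y0 : 0 < Y by nra.
have Y2 : 1 / 2 * s ^+ 2 <= Y ^+ 2.
  have h1 : 19 / 20 * (3 / 4 * s) <= Y by lra.
  have h2 : (19 / 20 * (3 / 4 * s)) ^+ 2 <= Y ^+ 2 by rewrite lerXn2r// nnegrE; lra.
  by have := sqr_ge0 s; rewrite !expr2 in h2 *; lra.
have X20 := sqr_ge0 X; have Y20 : 0 < Y ^+ 2 by rewrite exprn_gt0.
have Sp : 0 < X ^+ 2 + Y ^+ 2 by lra.
have SYp : 0 < Y ^+ 2 + X ^+ 2 by lra.
have /andP[a0 a1] := @slope_bounds N x y (Y ^+ 2) (X ^+ 2) (ltW Y20) X20 SYp (addrC _ _).
have /andP[b0 b1] := @slope_bounds N x y (X ^+ 2) (Y ^+ 2) X20 (ltW Y20) Sp erefl.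
have bE := @slopeE N x y (X ^+ 2) (Y ^+ 2) erefl.
have d0 := isq_def_ge0 N w0.
have Hw := H _ w0 (_ : wcos x y <= 1 - s ^+ 2 / 4).
have {}Hw : 1 - ep <= (1 - wcos x y) * isq N (wcos x y) ^+ 2 by apply: Hw; lra.
have P1 := isq_ge1 N w0.
move: a0 a1 b0 b1 bE Hw d0 P1.
set P := isq N _; set B := isq_def N _; set P' := isq' N _.
set aa := P - Y ^+ 2 * P'; set bb := P - X ^+ 2 * P' => a0 a1 b0 b1 bE Hw d0 P1 V1.
have u1x : 0 <= kap * X * (cos y * aa) * x.
  have -> : kap * X * (cos y * aa) * x = kap * (cos y * aa) * (X * x) by ring.
  by apply: mulr_ge0 => //; apply: mulr_ge0; [exact: kap0|exact: mulr_ge0].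
have es : 0 <= ep * s by rewrite mulr_ge0// ltW.
have [sy|ys'] := leP s y.
  rewrite !addr_ge0//; last by rewrite divr_ge0 ?addr_ge0// ltW.
  by rewrite mulr_ge0//; lra.
clear xs ys x_l x_u y_u y0 Yl cy0 xsin w0 w1 vb SYp a0 a1 b0 b1 H.
(* [h] and [t] are the squared sine and cosine of the angle between [(sin x, sin y)] and the
   vertical axis; [h] is at most 1/8 on the disc. *)
pose t := Y ^+ 2 / (X ^+ 2 + Y ^+ 2); pose h := X ^+ 2 / (X ^+ 2 + Y ^+ 2).
have ht : t = 1 - h by rewrite /t /h; field; rewrite gt_eqF.
have h0 : 0 <= h by rewrite divr_ge0// ltW.
have hS : h * (X ^+ 2 + Y ^+ 2) = X ^+ 2 by rewrite /h divfK// gt_eqF.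
have hs2 : h * s ^+ 2 <= 2 * x ^+ 2.
  have : h * (1 / 2 * s ^+ 2) <= h * (X ^+ 2 + Y ^+ 2) by rewrite ler_wpM2l//; lra.
  rewrite hS; lra.
have h8 : h <= 1 / 8.
  have s20 : 0 < s ^+ 2 by rewrite exprn_gt0.
  rewrite -(ler_pM2r s20); apply: le_trans hs2 _.
  move: hxy; rewrite [(s / 4) ^+ 2]expr_div_n; lra.
have t0 : 0 <= t by rewrite ht; lra.
clear Xx Y2 hS hxy.
(* Lower bound for the downward speed, obtained by dropping the nonnegative defect in [slopeE]. *)
pose V0 := kap * Y * (cos x * (P * t)).
have V0le : V0 <= kap * Y * (cos x * bb).
  rewrite /V0; apply: ler_wpM2l; first by rewrite mulr_ge0// ltW.
  apply: ler_wpM2l => //; rewrite -(ler_pM2l Sp) bE /t.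
  have -> : (X ^+ 2 + Y ^+ 2) * (P * (Y ^+ 2 / (X ^+ 2 + Y ^+ 2))) = P * Y ^+ 2.
    by field; rewrite gt_eqF.
  by rewrite lerDl mulr_ge0.
have V00 : 0 <= V0.
  have P0 : 0 <= P by exact: le_trans ler01 P1.
  rewrite /V0; apply: mulr_ge0; first by apply: mulr_ge0; [exact: kap0|exact: ltW].
  by apply: mulr_ge0 => //; exact: mulr_ge0.
clear bE d0.
pose b := (1 - ep) * (cos x * (1 - 3 / 2 * h)).
have bV : b <= V0.
  have b00 : 0 <= b by rewrite /b; apply: mulr_ge0; [lra|apply: mulr_ge0 => //; lra].
  rewrite -(@ler_pXn2r _ 2)// ?nnegrE//.
  have -> : V0 ^+ 2 = (1 - wcos x y) * P ^+ 2 * (cos x ^+ 2 * t ^+ 3).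
    have -> : (1 - wcos x y) = (X ^+ 2 + Y ^+ 2) / 2 by rewrite -hw; field.
    rewrite /V0 !exprMn kap2 /t; field; rewrite gt_eqF//.
  have -> : b ^+ 2 = (1 - ep) * ((1 - ep) * (cos x ^+ 2 * (1 - 3 / 2 * h) ^+ 2)) by rewrite /b; ring.
  have c2 := sqr_ge0 (cos x).
  have q0 : 0 <= cos x ^+ 2 * (1 - 3 / 2 * h) ^+ 2 by rewrite mulr_ge0// sqr_ge0.
  apply: ler_pM => //; first by lra.
    by rewrite mulr_ge0//; lra.
  apply: (@le_trans _ _ (cos x ^+ 2 * (1 - 3 / 2 * h) ^+ 2)).
    by rewrite ler_piMl//; lra.
  rewrite ler_wpM2l// ht -subr_ge0.
  (* The square of [t^(3/2) >= 1 - 3/2 * h], true for [h] at most 3/4. *)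
  have -> : (1 - h) ^+ 3 - (1 - 3 / 2 * h) ^+ 2 = h ^+ 2 * (3 / 4 - h) by field.
  by rewrite mulr_ge0 ?sqr_ge0//; lra.
have b1' : 1 - (ep + x ^+ 2 / 2 + 3 / 2 * h) <= b.
  by rewrite /b; apply: prod3_ge => //; apply/andP; split; lra.
clear Hw hw P1 Y0 X20 Y20 Sp V00 cx0.
have VB : 1 - kap * Y * (cos x * bb) <= ep + x ^+ 2 / 2 + 3 / 2 * h by lra.
have dd0 : 0 < s - y by lra.
have dd1 : s - y <= s / 4 by lra.
have key : (1 - kap * Y * (cos x * bb)) * (s - y) <= (ep + x ^+ 2 / 2 + 3 / 2 * h) * (s / 4).
  apply: ler_pM => //; [lra|exact: ltW].
(* After multiplication by [s], [hs2] bounds the left side by [x^2 / 8 + 3 / 4 * x^2]. *)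
have key2 : (x ^+ 2 / 2 + 3 / 2 * h) * (s / 4) <= (x ^+ 2 + (y - s) ^+ 2) / s.
  rewrite ler_pdivlMr//.
  have -> : (x ^+ 2 / 2 + 3 / 2 * h) * (s / 4) * s = x ^+ 2 * s ^+ 2 / 8 + 3 / 8 * (h * s ^+ 2) by field.
  have : x ^+ 2 * s ^+ 2 <= x ^+ 2 by rewrite ler_piMr// expr_le1//; lra.
  lra.
lra.
Qed.

(** On the discs with [s >= smin] the argument [w] stays below [1 - smin^2 / 4], where the
    truncation error is geometrically small; one [N] serves them all. The lower discs follow by the
    symmetry [vel_odd]. *)
Lemma flow_exists (ep smin : R) : 0 < ep -> ep <= 1 -> 0 < smin -> smin <= 1 / 4 ->
  exists l : seq (R * int * int),
    (forall x y, enorm (vel1 l x y) (vel2 l x y) <= 1) /\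
    (forall sg s x y, sg * sg = 1 -> smin <= s -> s <= 1 / 4 ->
      x ^+ 2 + (y - sg * s) ^+ 2 <= (s / 4) ^+ 2 ->
      0 <= vel1 l x y * x + (vel2 l x y + sg) * (y - sg * s) +
           (x ^+ 2 + (y - sg * s) ^+ 2) / s + ep * s).
Proof.
move=> ep0 ep1 sm0 sm1.
have k0 : 0 < smin ^+ 2 / 4 by rewrite divr_gt0// exprn_gt0.
have k1 : smin ^+ 2 / 4 <= 1 by nra.
have [N hN] := geometric_small k0 k1 ep0.
have [l lE] := trigpoly_stream N.
have E1 x y : vel1 l x y = v1 N x y.
  have d := is_derive_cosum_y l x y; have d' := is_derive_stream_y N x y.
  rewrite /vel1 -(is_derive_derive1 d) /v1 -(is_derive_derive1 d').
  by congr (derive1 _ y); apply/funext => z; rewrite lE.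
have E2 x y : vel2 l x y = v2 N x y.
  have d := is_derive_cosum_x l x y; have d' := is_derive_stream_x N x y.
  rewrite /vel2 -(is_derive_derive1 d) /v2 -(is_derive_derive1 d').
  by congr (- derive1 _ x); apply/funext => z; rewrite lE.
exists l; split=> [x y|sg s x y sg2 sms s1 hxy]; first by rewrite E1 E2; exact: vel_bound.
rewrite E1 E2.
have s0 : 0 < s by exact: lt_le_trans sms.
have H w : 0 <= w -> w <= 1 - s ^+ 2 / 4 -> 1 - ep <= (1 - w) * isq N w ^+ 2.
  move=> w0 w1.
  have ws : w <= 1 - smin ^+ 2 / 4.
    by apply: le_trans w1 _; rewrite lerD2l lerN2 ler_pM2r// lerXn2r// nnegrE ltW.
  have w1' : w <= 1 by apply: le_trans ws _; lra.
  apply: le_trans (isq_lower N w0 w1').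
  rewrite lerD2l lerN2; apply: le_trans hN; apply: ler_wpM2l.
    by rewrite addr_ge0// mulr_ge0.
  by rewrite lerXn2r// nnegrE; lra.
have yE : (y - sg * s) ^+ 2 = (sg * y - s) ^+ 2.
  have -> : (y - sg * s) ^+ 2 = y ^+ 2 - 2 * sg * y * s + (sg * sg) * s ^+ 2 by ring.
  have -> : (sg * y - s) ^+ 2 = (sg * sg) * y ^+ 2 - 2 * sg * y * s + s ^+ 2 by ring.
  by rewrite sg2 !mul1r.
rewrite yE in hxy *.
have := flow_up s0 s1 (ltW ep0) H ep1 hxy.
have [-> ->] := vel_odd N x y sg2.
have -> : (sg * v2 N x y + 1) * (sg * y - s) = (v2 N x y + sg) * (y - sg * s) + (sg * sg - 1) * (v2 N x y * y + s).
  ring.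
by rewrite sg2 subrr mul0r addr0.
Qed.

End Flow.

(** * Finite linear systems *)

Section FiniteODE.
Variable R : realType.

Lemma is_derive_bigsum (I : Type) (r : seq I) (F : I -> R -> R) (F' : I -> R) (x : R) :
  (forall i, is_derive x 1 (F i) (F' i)) ->
  is_derive x 1 (fun s => \sum_(i <- r) F i s) (\sum_(i <- r) F' i).
Proof.
move=> h; elim: r => [|i r IH].
  rewrite big_nil (_ : (fun s => _) = cst 0); first exact: is_derive_cst.
  by apply/funext => s; rewrite big_nil.
rewrite big_cons (_ : (fun s => _) = (fun s => F i s + \sum_(j <- r) F j s)).
  exact: is_deriveD.
by apply/funext => s; rewrite big_cons.
Qed.

Lemma cvg_bigsum (X : Type) (Fl : set_system X) (FF : Filter Fl) (I : Type) (r : seq I)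
    (f : I -> X -> R) (g : I -> R) :
  (forall i, f i @ Fl --> g i) ->
  (fun x => \sum_(i <- r) f i x) @ Fl --> \sum_(i <- r) g i.
Proof.
move=> h; elim: r => [|i r IH].
  rewrite big_nil (_ : (fun x => _) = cst 0); first exact: cvg_cst.
  by apply/funext => s; rewrite big_nil.
rewrite big_cons (_ : (fun x => _) = (fun x => f i x + \sum_(j <- r) f j x)).
  exact: cvgD.
by apply/funext => s; rewrite big_cons.
Qed.

Lemma exp_type_cvg (b : nat -> R) (C L : R) : 0 <= C -> 0 <= L ->
  (forall n, `|b n| <= C * L ^+ n) ->
  forall x, cvgn (pseries (fun n => b n / n`!%:R) x).
Proof.
move=> C0 L0 hb x; apply: normed_cvg.
apply: (@series_le_cvg _ _ (fun n => C * (exp_coeff (L * `|x|) n))).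
- by move=> n /=.
- by move=> n; rewrite mulr_ge0// exp_coeff_ge0// mulr_ge0.
- move=> n; rewrite /exp_coeff /= normrM normrM normfV normrX (ger0_norm (_ : 0 <= n`!%:R))//.
  rewrite exprMn -mulrA mulrCA [leRHS](_ : _ = n`!%:R^-1 * `|x| ^+ n * (C * L ^+ n)); last by ring.
  rewrite mulrCA [leLHS](_ : _ = n`!%:R^-1 * `|x| ^+ n * `|b n|); last by ring.
  by rewrite ler_wpM2l// mulr_ge0 ?invr_ge0// exprn_ge0.
have := @is_cvg_series_exp_coeff R (L * `|x|).
move=> /cvg_ex[l hl]; apply/cvg_ex; exists (C * l).
rewrite (_ : series _ = (fun N => C * series (exp_coeff (L * `|x|)) N)).
  exact: cvgMr.
by apply/funext => N; rewrite /series /= mulr_sumr.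
Qed.

Lemma exp_type_derive (b : nat -> R) (C L : R) : 0 <= C -> 0 <= L ->
  (forall n, `|b n| <= C * L ^+ n) ->
  forall x : R, is_derive x 1 (fun x => limn (pseries (fun n => b n / n`!%:R) x))
    (limn (pseries (fun n => b n.+1 / n`!%:R) x)).
Proof.
move=> C0 L0 hb x.
have dE (d : nat -> R) : pseries_diffs (fun n => d n / n`!%:R) = (fun n => d n.+1 / n`!%:R).
  apply/funext => n; rewrite /pseries_diffs factS natrM.
  by rewrite invfM mulrCA; congr (_ * _); rewrite mulrA divff ?mul1r// pnatr_eq0.
have hs n : `|b n.+1| <= (C * L) * L ^+ n by rewrite -mulrA -exprS.
have hss n : `|b n.+2| <= (C * L * L) * L ^+ n by rewrite -!mulrA -!exprS.
rewrite -dE; apply: (@pseries_snd_diffs _ _ (`|x| + 1)).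
- exact: exp_type_cvg hb _.
- by rewrite dE; apply: exp_type_cvg hs _ => //; rewrite mulr_ge0.
- by rewrite dE (dE (fun n => b n.+1)); apply: exp_type_cvg hss _ => //; rewrite !mulr_ge0.
- by rewrite [ltRHS]ger0_norm ?ltrDl// addr_ge0.
Qed.

Section linear.
Variables (T : finType) (M : T -> T -> R) (a0 : T -> R).

Definition mapp (b : T -> R) : T -> R := fun k => \sum_l M k l * b l.

Lemma mapp_iter_bound : exists C L : R, [/\ 0 <= C, 0 <= L &
  forall n k, `|iter n mapp a0 k| <= C * L ^+ n].
Proof.
pose C := \sum_k `|a0 k|; pose L := \sum_k \sum_l `|M k l|.
have C0 : 0 <= C by rewrite sumr_ge0.
have L0 : 0 <= L by rewrite sumr_ge0// => k _; rewrite sumr_ge0.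
exists C, L; split=> //; elim=> [|n IH] k /=.
  by rewrite expr0 mulr1 /C (bigD1 k)//= lerDl sumr_ge0.
apply: le_trans (ler_norm_sum _ _ _) _.
apply: (@le_trans _ _ (\sum_l `|M k l| * (C * L ^+ n))).
  by apply: ler_sum => l _; rewrite normrM ler_wpM2l.
rewrite -mulr_suml exprS [leRHS]mulrCA; apply: ler_wpM2r; first by rewrite mulr_ge0// exprn_ge0.
by rewrite /L [leRHS](bigD1 k)//= lerDl sumr_ge0// => j _; rewrite sumr_ge0.
Qed.

(** The matrix exponential applied to [a0], as componentwise power series with coefficients
    [M^n a0 / n!]. *)
Lemma linear_ode : exists a : R -> T -> R,
  (forall k, a 0 k = a0 k) /\
  (forall (t : R) k, is_derive t 1 (fun s => a s k) (mapp (a t) k)).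
Proof.
have [C [L [C0 L0 hb]]] := mapp_iter_bound.
pose c k n := iter n mapp a0 k.
pose a t k := limn (pseries (fun n => c k n / n`!%:R) t).
exists a; split=> [k|t k].
  rewrite /a /pseries; apply: cvg_lim => //.
  apply: cvg_near_cst; near=> n.
  have n0 : (0 < n)%N by near: n; exact: nbhs_infty_gt.
  rewrite /series /= -(prednK n0) big_nat_recl// expr0 mulr1 fact0 divr1 /= big1 ?addr0//.
  by move=> i _; rewrite expr0n mulr0.
have d := exp_type_derive C0 L0 (fun n => hb n k) t.
suff -> : mapp (a t) k = limn (pseries (fun n => c k n.+1 / n`!%:R) t) by exact: d.
apply/esym/cvg_lim => //.
rewrite (_ : pseries _ t = (fun N => \sum_l M k l * pseries (fun n => c l n / n`!%:R) t N)).
  apply: cvg_bigsum => l; apply: cvgMr.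
  exact: exp_type_cvg C0 L0 (fun n => hb n l) t.
apply/funext => N; rewrite /pseries /series /=.
under [RHS]eq_bigr do rewrite mulr_sumr.
rewrite exchange_big /=; apply: eq_bigr => n _.
rewrite /mapp !mulr_suml; apply: eq_bigr => l _; rewrite /c; ring.
Unshelve. all: by end_near. Qed.

(** Gronwall: [exp (- C t)] times the weighted energy is non-increasing. *)
Lemma energy_bound (a : R -> T -> R) (w : T -> R) (C : R) :
  (forall (t : R) k, is_derive t 1 (fun s => a s k) (mapp (a t) k)) ->
  (forall b : T -> R, 2 * \sum_k w k * (b k * mapp b k) <= C * \sum_k w k * b k ^+ 2) ->
  forall t, 0 <= t -> \sum_k w k * a t k ^+ 2 <= expR (C * t) * \sum_k w k * a 0 k ^+ 2.
Proof.
move=> da hq t t0.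
pose E s := \sum_k w k * a s k ^+ 2.
have dE (s : R) : is_derive s 1 E (2 * \sum_k w k * (a s k * mapp (a s) k)).
  rewrite mulr_sumr; apply: is_derive_bigsum => k; have h := da s k.
  by apply: is_derive_eq; rewrite /GRing.scale/=; ring.
pose G s := expR (- C * s) * E s.
have dG (s : R) : is_derive s 1 G (expR (- C * s) * (2 * \sum_k w k * (a s k * mapp (a s) k) - C * E s)).
  have h := dE s.
  have d1 : is_derive s 1 (fun z => - C * z) (- C).
    by apply: is_derive_eq; rewrite /GRing.scale/=; ring.
  have := @is_derive1_comp _ (@expR R) (fun z => - C * z) s _ _ (is_derive_expR _) d1 => d2.
  rewrite (_ : G = (fun z => (expR \o (fun z => - C * z)) z * E z))//.
  by apply: is_derive_eq; rewrite /GRing.scale/=; ring.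
have [c _ Eq] := mean_value t0 dG.
have : G t <= G 0.
  rewrite -subr_le0 Eq subr0; apply: mulr_le0_ge0 => //.
  by rewrite mulr_ge0_le0 ?expR_ge0// subr_le0; exact: hq.
rewrite /G mulr0 expR0 mul1r => h.
have -> : \sum_k w k * a t k ^+ 2 = expR (C * t) * (expR (- C * t) * E t).
  by rewrite mulrA -expRD mulNr subrr expR0 mul1r.
by rewrite ler_wpM2l// expR_ge0.
Qed.

End linear.
End FiniteODE.

(** * Limits along an ultrafilter *)

Section UltraLimit.
Variable R : realType.

Lemma mean_value_mid (f f' : R -> R) (u v : R) : (forall z : R, is_derive z 1 f (f' z)) ->
  exists c, [/\ Num.min u v <= c, c <= Num.max u v & f v - f u = f' c * (v - u)].
Proof.
move=> df; case: (leP u v) => [uv|/ltW vu].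
  by have [c /andP[c1 c2] E] := mean_value uv df; exists c.
have [c /andP[c1 c2] E] := mean_value vu df; exists c; split=> //.
by rewrite -opprB E; ring.
Qed.

Lemma lip_bound (f f' : R -> R) (u v K : R) : (forall z : R, is_derive z 1 f (f' z)) ->
  (forall z, Num.min u v <= z -> z <= Num.max u v -> `|f' z| <= K) ->
  `|f v - f u| <= K * `|v - u|.
Proof.
move=> df h; have [c [c1 c2 ->]] := mean_value_mid u v df.
by rewrite normrM ler_wpM2r// h.
Qed.

Lemma taylor_bound (f f' f'' : R -> R) (x h K : R) :
  (forall z : R, is_derive z 1 f (f' z)) -> (forall z : R, is_derive z 1 f' (f'' z)) ->
  (forall z, `|z - x| <= `|h| -> `|f'' z| <= K) ->
  `|f (x + h) - f x - h * f' x| <= K * h ^+ 2.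
Proof.
move=> df df' hK.
have near z w : Num.min x w <= z -> z <= Num.max x w -> `|z - x| <= `|w - x|.
  by case: (leP x w) => xw h1 h2; [rewrite !ger0_norm|rewrite !ler0_norm]; lra.
have [c [c1 c2 E1]] := mean_value_mid x (x + h) df.
have hx : x + h - x = h by ring.
have cx := near _ _ c1 c2; rewrite hx in cx E1.
have -> : f (x + h) - f x - h * f' x = (f' c - f' x) * h by rewrite E1; ring.
have K0 : 0 <= K by apply: le_trans (hK x _); rewrite ?subrr ?normr0.
rewrite normrM -(@real_normK _ h) ?num_real// expr2 mulrA; apply: ler_wpM2r => //.
apply: (@le_trans _ _ (K * `|c - x|)); last exact: ler_wpM2l.
apply: (lip_bound df') => z z1 z2; apply: hK.
exact: le_trans (near _ _ z1 z2) cx.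
Qed.

Lemma ultra_infty : exists U : set_system nat, UltraFilter U /\ \oo `<=` U.
Proof. by apply: ultraFilterLemma; exact: eventually_filter. Qed.

Lemma ultra_fmap (X Y : Type) (F : set_system X) (f : X -> Y) :
  UltraFilter F -> UltraFilter (f @ F).
Proof.
move=> UF; split=> [|G PG FG]; first exact: fmap_proper_filter.
apply/seteqP; split=> [A GA|//].
have [//|h] := in_ultra_setVsetC (f @^-1` A) UF.
have GC : G (~` A) by apply: FG.
have := filterI GA GC; rewrite setICr => G0.
by case: (@filter_not_empty _ G PG); exact: G0.
Qed.

Variable U : set_system nat.
Hypothesis UU : UltraFilter U.

(* Bounded sequences converge along an ultrafilter, so no subsequence has to be extracted. *)
Definition ulim (f : nat -> R) : R := lim (f @ U).

Lemma cvg_ulim (f : nat -> R) (C : R) : (forall n, `|f n| <= C) -> f @ U --> ulim f.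
Proof.
move=> fC.
have cK : compact `[- C, C]%classic by exact: segment_compact.
rewrite compact_ultra in cK.
have := cK (f @ U) _ _; case => [| |p [_ pcvg]].
- exact: ultra_fmap.
- have h : U (f @^-1` `[- C, C]%classic).
    by apply: filterE => n; rewrite /= in_itv/= -ler_norml.
  exact: h.
by rewrite /ulim; apply/cvg_ex; exists p.
Qed.

Lemma ulimE (f : nat -> R) (l : R) : f @ U --> l -> ulim f = l.
Proof. by move=> h; apply: cvg_lim. Qed.

Lemma ultra_norm_le (f : nat -> R) (p C : R) :
  f @ U --> p -> (forall n, `|f n| <= C) -> `|p| <= C.
Proof.
move=> fp fC.
have hc : (fun n => `|f n|) @ U --> `|p| by exact: cvg_norm.
by apply: (cvgr_to_le hc); exact: filterE.
Qed.

(** A quadratic remainder bound uniform in [n] passes to the limit, so pointwise convergence of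
    functions and derivatives is enough. *)
Lemma ulim_derive (f : R -> nat -> R) (g : R -> R) (f' : nat -> R) (g' x d K : R) :
  0 < d -> (forall h, `|h| < d -> f (x + h) @ U --> g (x + h)) -> f' @ U --> g' ->
  (forall h n, `|h| < d -> `|f (x + h) n - f x n - h * f' n| <= K * h ^+ 2) ->
  is_derive x 1 g g'.
Proof.
move=> d0 cf cf' hb; apply: is_derive_eps => e e0.
have K1 : 0 < `|K| + 1 by rewrite ltr_wpDl.
exists (Num.min d (e / (`|K| + 1))); first by rewrite lt_min d0 divr_gt0.
move=> h; rewrite lt_min => /andP[hd he].
have c0 : f x @ U --> g x by have := cf 0; rewrite addr0 normr0; exact.
have cc : (fun n => `|f (x + h) n - f x n - h * f' n|) @ U --> `|g (x + h) - g x - h * g'|.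
  apply: cvg_norm; apply: cvgB; last exact: cvgMr.
  by apply: cvgB => //; exact: cf.
apply: (@le_trans _ _ (K * h ^+ 2)).
  by apply: (cvgr_to_le cc); apply: filterE => n; exact: hb.
apply: (@le_trans _ _ ((`|K| + 1) * `|h| * `|h|)).
  rewrite -mulrA -expr2 real_normK ?num_real//; apply: ler_wpM2r; first exact: sqr_ge0.
  by apply: le_trans (ler_norm _) _; rewrite lerDl.
apply: ler_wpM2r => //; rewrite mulrC -ler_pdivlMr//; exact: ltW.
Qed.

End UltraLimit.

(** * Galerkin approximation *)

Section Box.
Variable R : realType.

(** Indexes the frequencies of [[-N, N]^2] by a finite type; [box_coord] recentres them. *)
Definition box (N : nat) : finType := ('I_(N.*2.+1) * 'I_(N.*2.+1))%type.

Definition box_coord N (i : 'I_(N.*2.+1)) : int := (i : nat)%:Z - N%:Z.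

Definition frq N (k : box N) : int * int := (box_coord k.1, box_coord k.2).

Definition freq_weight (z : int * int) : R := 1 + `|z.1%:~R| + `|z.2%:~R|.

Lemma wt_ge1 z : 1 <= freq_weight z.
Proof. by rewrite /freq_weight -addrA lerDl addr_ge0. Qed.

Lemma wt_gt0 z : 0 < freq_weight z.
Proof. exact: lt_le_trans ltr01 (wt_ge1 z). Qed.

Lemma frq_inj N : injective (@frq N).
Proof.
by move=> [i j] [i' j'] [/addIr[/val_inj ->] /addIr[/val_inj ->]].
Qed.

Lemma coord_cover N (z : int) :
  (exists i : 'I_(N.*2.+1), box_coord i = z) \/ N.+1%:R <= `|z%:~R| :> R.
Proof.
have [h|h] := leqP `|z|%N N.
  have hi : (absz (z + N%:Z)%R < N.*2.+1)%N by lia.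
  left; exists (Ordinal hi); rewrite /box_coord /=; lia.
right; rewrite -intr_norm -[N.+1%:R]/(N.+1%:Z%:~R) ler_int; lia.
Qed.

Lemma frq_cover N z : (exists k : box N, frq k = z) \/ N.+1%:R <= freq_weight z.
Proof.
case: z => z1 z2; have [[i hi]|h] := coord_cover N z1; last first.
  by right; apply: le_trans h _; rewrite /freq_weight /=; have := normr_ge0 (z2%:~R : R); lra.
have [[j hj]|h] := coord_cover N z2; last first.
  by right; apply: le_trans h _; rewrite /freq_weight /=; have := normr_ge0 (z1%:~R : R); lra.
by left; exists (i, j); rewrite /frq /= hi hj.
Qed.

Lemma sum_frq N z (g : box N -> R) :
  (exists2 k, frq k = z & \sum_k (frq k == z)%:R * g k = g k) \/
  ((forall k : box N, frq k <> z) /\ \sum_k (frq k == z)%:R * g k = 0).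
Proof.
have [[k kz]|h] := pselect (exists k : box N, frq k = z).
  left; exists k => //; rewrite (bigD1 k)//= kz eqxx mul1r big1 ?addr0// => i ik.
  case: eqP => [iz|_]; last by rewrite mul0r.
  by move/eqP: ik; case; apply: frq_inj; rewrite iz.
right; have h' (k : box N) : frq k <> z by move=> kz; apply: h; exists k.
by split=> //; rewrite big1// => k _; case: eqP => [/h'//|_]; rewrite mul0r.
Qed.

Lemma sum_frq_le N z (g : box N -> R) (c : R) : 0 <= c ->
  (forall k, frq k = z -> g k <= c) -> \sum_k (frq k == z)%:R * g k <= c.
Proof. by move=> c0 h; have [[k kz ->]|[_ ->//]] := sum_frq z g; exact: h. Qed.

(** There is no error if [z] lies in the box; otherwise its weight is at least [N + 1] and the
    factor on the right is at least 1. One weight thus buys a rate [1 / N]. *)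
Lemma sum_frq_gap N z (g : int * int -> R) :
  `|g z - \sum_(k : box N) (frq k == z)%:R * g (frq k)| <= `|g z| * (freq_weight z / N.+1%:R).
Proof.
have w0 : 0 <= freq_weight z / N.+1%:R by rewrite divr_ge0// ltW// wt_gt0.
have [[k kz ->]|[h ->]] := sum_frq z (fun k : box N => g (frq k)).
  by rewrite kz subrr normr0 mulr_ge0.
have [[k /h//]|hw] := frq_cover N z.
by rewrite subr0 ler_peMr// ler_pdivlMr ?mul1r ?ltr0n.
Qed.

(** The term [- 2 / N.+1] lets the induction telescope: the two new terms at distance [N + 1] are
    bounded by a difference of inverses. *)
Lemma coord_sum N : \sum_(i < N.*2.+1) (1 + `|(box_coord i)%:~R|) ^- 2 <= 3 - 2 / N.+1%:R :> R.
Proof.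
pose f M (n : nat) : R := (1 + `|(n%:Z - M%:Z)%:~R|) ^- 2.
suff H M : \sum_(i < M.*2.+1) f M i <= 3 - 2 / M.+1%:R by exact: H.
elim: M => [|M IH].
  rewrite big_ord_recl big_ord0 /f subrr normr0 !addr0 expr1n invr1; lra.
rewrite doubleS big_ord_recl big_ord_recr /=.
have -> : \sum_(i < M.*2.+1) f M.+1 (bump 0 i) = \sum_(i < M.*2.+1) f M i.
  apply: eq_bigr => i _; rewrite /f /bump /=.
  by have -> : (1 + i)%N%:Z - M.+1%:Z = (i : nat)%:Z - M%:Z by lia.
have E n : n = 0%N \/ n = M.*2.+2 -> f M.+1 n = M.+2%:R ^- 2.
  move=> h; rewrite /f -intr_norm.
  have -> : `|n%:Z - M.+1%:Z| = M.+1%:Z by lia.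
  by rewrite -[M.+2%:R]natr1 addrC.
rewrite E; last by left.
rewrite E; last by right.
have M1 : 0 < M.+1%:R :> R by rewrite ltr0n.
have -> : M.+2%:R = M.+1%:R + 1 :> R by rewrite -natr1.
move: IH M1; move: (M.+1%:R : R) => X IH X0.
apply: (@le_trans _ _ (3 - 2 / X + 2 * (X + 1) ^- 2)); first by lra.
suff : 2 * (X + 1) ^- 2 <= 2 / X - 2 / (X + 1) by lra.
have -> : 2 / X - 2 / (X + 1) = 2 / (X * (X + 1)) by field; rewrite !gt_eqF//; lra.
have X1 : 0 < X + 1 by lra.
rewrite ler_pM2l// lef_pV2 ?posrE ?exprn_gt0 ?mulr_gt0// expr2 ler_pM2r//; lra.
Qed.

(** [(1 + |a| + |b|)^2 >= (1 + |a|) * (1 + |b|)] splits the sum into two one-dimensional ones of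
    value at most 3. Hence the four extra powers of decay required throughout. *)
Lemma wt_sum N : \sum_(k : box N) freq_weight (frq k) ^- 4 <= 9.
Proof.
pose g (i : 'I_(N.*2.+1)) : R := (1 + `|(box_coord i)%:~R|) ^- 2.
have g0 i : 0 <= g i by rewrite invr_ge0 exprn_ge0// addr_ge0.
have S3 : \sum_i g i <= 3.
  by apply: le_trans (coord_sum N) _; rewrite gerBl divr_ge0.
apply: (@le_trans _ _ (\sum_(k : box N) g k.1 * g k.2)).
  apply: ler_sum => k _; rewrite /g /freq_weight /= -invfM.
  move: `|_| `|_| (normr_ge0 ((box_coord k.1)%:~R : R)) (normr_ge0 ((box_coord k.2)%:~R : R)) => X Y X0 Y0.
  rewrite lef_pV2 ?posrE; [|by apply: exprn_gt0; lra|by rewrite mulr_gt0// exprn_gt0//; lra].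
  rewrite -exprMn (exprM _ 2 2); apply: lerXn2r; rewrite ?nnegrE; [apply: mulr_ge0; lra|exact: sqr_ge0|nra].
rewrite -(pair_bigA _ (fun i j => g i * g j))/=.
under eq_bigr do rewrite -mulr_sumr.
rewrite -mulr_suml; have S0 : 0 <= \sum_i g i by rewrite sumr_ge0.
nra.
Qed.

Lemma wt_sum_le N s D (b : box N -> R) :
  0 <= D -> (forall k, `|b k| <= D / freq_weight (frq k) ^+ (s + 4)) ->
  \sum_k `|b k| * freq_weight (frq k) ^+ s <= 9 * D.
Proof.
move=> D0 h; rewrite mulrC; apply: (@le_trans _ _ (D * \sum_(k : box N) freq_weight (frq k) ^- 4)).
  rewrite mulr_sumr; apply: ler_sum => k _.
  have w0 := wt_gt0 (frq k).
  apply: le_trans (ler_wpM2r _ (h k)) _; first by rewrite exprn_ge0// ltW.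
  by rewrite exprD invfM mulrA mulrAC divfK// expf_neq0// gt_eqF.
by rewrite ler_wpM2l// wt_sum.
Qed.

End Box.

(** * Commutator estimate for powers of weights *)

Section PowerDiff.
Variable R : realType.

Lemma pow_diff_le (a b M : R) n : 0 <= a -> a <= M -> 0 <= b -> b <= M ->
  `|a ^+ n - b ^+ n| * M <= n%:R * `|a - b| * M ^+ n.
Proof.
move=> a0 aM b0 bM; have M0 : 0 <= M by exact: le_trans aM.
elim: n => [|n IH]; first by rewrite !expr0 subrr normr0 !mul0r.
have -> : a ^+ n.+1 - b ^+ n.+1 = a * (a ^+ n - b ^+ n) + (a - b) * b ^+ n.
  by rewrite !exprS; ring.
apply: (@le_trans _ _ (M * (`|a ^+ n - b ^+ n| * M) + `|a - b| * (M ^+ n * M))).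
  apply: (@le_trans _ _ ((M * `|a ^+ n - b ^+ n| + `|a - b| * M ^+ n) * M)); last first.
    by rewrite mulrDl !mulrA.
  apply: ler_wpM2r => //; apply: le_trans (ler_normD _ _) _; rewrite !normrM (ger0_norm a0) lerD//.
    by rewrite ler_wpM2r.
  by rewrite ler_wpM2l// normrX (ger0_norm b0) lerXn2r// ?nnegrE.
have -> : n.+1%:R * `|a - b| * M ^+ n.+1 = M * (n%:R * `|a - b| * M ^+ n) + `|a - b| * (M ^+ n * M).
  by rewrite -natr1 exprSr; ring.
by rewrite lerD2r ler_wpM2l.
Qed.

(** Differencing weights at bounded distance gains one power, which pays for the derivative [b] in
    the transport term. *)
Lemma weight_diff_le (a b J : R) s : 0 <= J -> 1 <= a -> 1 <= b -> `|a - b| <= J ->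
  `|a ^+ (s * 2) - b ^+ (s * 2)| * b <= (s * 2)%:R * J * (1 + J) ^+ (s * 2) * (a ^+ s * b ^+ s).
Proof.
move=> J0 a1 b1 ab.
have [a0 b0] : 0 <= a /\ 0 <= b by split; lra.
pose M := Num.max a b; pose mn := Num.min a b.
have mn0 : 0 <= mn by rewrite le_min a0.
have mn1 : 1 <= mn by rewrite le_min a1.
have M0 : 0 <= M by rewrite le_max a0.
have aM : a <= M by rewrite le_max lexx.
have bM : b <= M by rewrite le_max lexx orbT.
have ma : mn <= a by rewrite ge_min lexx.
have mb : mn <= b by rewrite ge_min lexx orbT.
have Mm : M <= (1 + J) * mn.
  have : M <= mn + J.
    rewrite /M /mn; move: ab; rewrite ler_norml => /andP[h1 h2].
    by case: (leP a b) => h; lra.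
  by nra.
apply: (@le_trans _ _ ((s * 2)%:R * J * M ^+ (s * 2))).
  apply: (@le_trans _ _ (`|a ^+ (s * 2) - b ^+ (s * 2)| * M)); first by rewrite ler_wpM2l.
  apply: le_trans (pow_diff_le _ a0 aM b0 bM) _.
  by rewrite ler_wpM2r ?exprn_ge0// ler_wpM2l.
rewrite -[leRHS]mulrA; apply: ler_wpM2l; first by rewrite mulr_ge0.
apply: (@le_trans _ _ (((1 + J) * mn) ^+ (s * 2))).
  by rewrite lerXn2r// nnegrE mulr_ge0//; lra.
rewrite exprMn ler_wpM2l//; first by rewrite exprn_ge0//; lra.
by rewrite exprM expr2 ler_pM ?exprn_ge0// lerXn2r// nnegrE.
Qed.

End PowerDiff.

(** * The truncated system and its weighted energies *)

Section Galerkin.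
Variables (R : realType) (l : seq (R * int * int)) (lam : int * int -> R) (Lam : R).
Hypothesis lam0 : forall z, 0 <= lam z.
Hypothesis lamle : forall z, lam z <= Lam * freq_weight R z ^+ 2.

Local Notation wt := (freq_weight R).

Definition jv (p : R * int * int) : int * int := (p.1.2, p.2).
Definition cross (z z' : int * int) : R := z.1%:~R * z'.2%:~R - z.2%:~R * z'.1%:~R.

Lemma crs_shift j z : cross j (z + j) = cross j z.
Proof. by rewrite /cross /= !intrD; ring. Qed.

Lemma crs_shiftN j z : cross j (z - j) = cross j z.
Proof. by rewrite /cross /= !intrD !intrN; ring. Qed.

Lemma wtN z : wt (- z) = wt z.
Proof. by rewrite /wt /= !intrN !normrN. Qed.

Lemma crs_le j z : `|cross j z| <= wt j * wt z.
Proof.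
rewrite /cross /wt; apply: le_trans (ler_normB _ _) _; rewrite !normrM.
have [a b] := (normr_ge0 (j.1%:~R : R), normr_ge0 (j.2%:~R : R)).
have [c d] := (normr_ge0 (z.1%:~R : R), normr_ge0 (z.2%:~R : R)).
nra.
Qed.

Lemma wt_shift j z : `|wt (z + j) - wt z| <= wt j.
Proof.
rewrite /wt /= !intrD.
move: (j.1%:~R : R) (j.2%:~R : R) (z.1%:~R : R) (z.2%:~R : R) => a b c d.
have := ler_normD c a; have := ler_normD d b.
have := ler_normB (c + a) a; have := ler_normB (d + b) b.
rewrite !addrK => h1 h2 h3 h4; rewrite ler_norml; apply/andP; split; lra.
Qed.

Lemma wt_shift_le j z : wt (z + j) <= (1 + wt j) * wt z.
Proof.
have := wt_shift j z; rewrite ler_norml => /andP[_ h].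
have := wt_ge1 R z; have := wt_ge1 R j; nra.
Qed.

(* The matrix of the transport operator in the basis [cas (z . x)]: see [advect_mode]. *)
Definition trans N (k k' : box N) : R :=
  \sum_(p <- l) p.1.1 / 2 * (cross (jv p) (frq k') *
    ((frq k == frq k' + jv p)%:R - (frq k == frq k' - jv p)%:R)).

Definition gmx N (k k' : box N) : R := - lam (frq k) * (k == k')%:R - trans k k'.

(** Incompressibility: the cross product of [j] with itself vanishes, so the coefficient is the same
    at both ends of a shift by [j], and the two shifts carry opposite signs. *)
Lemma trans_anti N (k k' : box N) : trans k' k = - trans k k'.
Proof.
rewrite /trans -sumrN; apply: eq_bigr => p _; rewrite -mulrN; congr (_ * _).
have e1 : (frq k' == frq k + jv p) = (frq k == frq k' - jv p).
  by rewrite -subr_eq eq_sym.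
have e2 : (frq k' == frq k - jv p) = (frq k == frq k' + jv p).
  by rewrite eq_sym subr_eq.
rewrite e1 e2.
have [E|n1] := eqVneq (frq k) (frq k' - jv p).
  have [_|n2] := eqVneq (frq k) (frq k' + jv p); first by ring.
  by rewrite E crs_shiftN; ring.
have [E|n2] := eqVneq (frq k) (frq k' + jv p); last by ring.
by rewrite E crs_shift; ring.
Qed.

Lemma gmx_apply N (b : box N -> R) k :
  mapp (@gmx N) b k = - lam (frq k) * b k - \sum_k' trans k k' * b k'.
Proof.
rewrite /mapp /gmx -sumrN (bigD1 k)//= [in RHS](bigD1 k)//= eqxx mulr1 mulrDl -addrA; congr (_ + _).
rewrite mulNr; congr (_ + _); apply: eq_bigr => k' kk'.
by rewrite eq_sym (negbTE kk') mulr0 sub0r mulNr.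
Qed.

(** Adjacency of frequencies through one wave of the velocity. It is symmetric, and each row sums to
    at most 2. *)
Definition nb (p : R * int * int) N (k k' : box N) : R :=
  (frq k == frq k' + jv p)%:R + (frq k == frq k' - jv p)%:R.

Lemma nb_ge0 p N (k k' : box N) : 0 <= nb p k k'.
Proof. exact: addr_ge0. Qed.

Lemma nb_sym p N (k k' : box N) : nb p k' k = nb p k k'.
Proof.
rewrite /nb addrC; congr (_%:R + _%:R).
  by rewrite eq_sym subr_eq.
by rewrite -subr_eq eq_sym.
Qed.

Lemma nb_sum p N (k : box N) (g : box N -> R) (c : R) : 0 <= c ->
  (forall k', frq k' = frq k + jv p \/ frq k' = frq k - jv p -> g k' <= c) ->
  \sum_k' nb p k k' * g k' <= 2 * c.
Proof.
move=> c0 h; under eq_bigr do rewrite -nb_sym /nb mulrDl.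
rewrite big_split mulr2n mulrDl mul1r lerD//; apply: sum_frq_le => // k' E; apply: h.
  by left.
by right.
Qed.

Lemma trans_le N (k k' : box N) :
  `|trans k k'| <= \sum_(p <- l) `|p.1.1| * (wt (jv p) * wt (frq k') * nb p k k').
Proof.
apply: le_trans (ler_norm_sum _ _ _) _; apply: ler_sum => p _.
rewrite !normrM; apply: ler_pM => //.
- by rewrite (ger0_norm (_ : 0 <= 2^-1)) ?invr_ge0// ler_piMr// invf_le1//; lra.
apply: ler_pM => //; first exact: crs_le.
by apply: le_trans (ler_normB _ _) _; rewrite /nb !ger0_norm.
Qed.

Definition decays N D s (b : box N -> R) := forall k, `|b k| <= D / wt (frq k) ^+ s.

(** The operator has order 2 through [lam] and order 1 through transport, so one application loses
    two powers of the weight, uniformly in [N]. *)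
Lemma mapp_decay s : exists C, 0 <= C /\ forall N D (b : box N -> R), 0 <= D ->
  decays D (s + 2) b -> decays (C * D) s (mapp (@gmx N) b).
Proof.
pose C1 := \sum_(p <- l) `|p.1.1| * (wt (jv p) * (2 * (1 + wt (jv p)) ^+ s)).
have Lam0 : 0 <= Lam.
  by have := le_trans (lam0 0) (lamle 0); rewrite pmulr_lge0// exprn_gt0// wt_gt0.
have w0 z : 0 < wt z by exact: wt_gt0.
have C10 : 0 <= C1.
  apply: sumr_ge0 => p _; have := w0 (jv p) => h.
  by rewrite !mulr_ge0// ?exprn_ge0// ?ltW//; lra.
exists (Lam + C1); split=> [|N D b D0 hb k]; first exact: addr_ge0.
rewrite gmx_apply; apply: le_trans (ler_normB _ _) _.
rewrite mulrDl mulrDl; apply: lerD.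
  rewrite normrM normrN (ger0_norm (lam0 _)).
  apply: le_trans (ler_pM _ _ (lamle _) (hb k)) _ => //.
  rewrite exprD invfM [leLHS](_ : _ = Lam * D / wt (frq k) ^+ s * (wt (frq k) ^+ 2 / wt (frq k) ^+ 2)); last by ring.
  by rewrite divff ?mulr1// expf_neq0// gt_eqF.
apply: le_trans (ler_norm_sum _ _ _) _.
apply: (@le_trans _ _ (\sum_k' (\sum_(p <- l) `|p.1.1| * (wt (jv p) * wt (frq k') * nb p k k')) * `|b k'|)).
  by apply: ler_sum => k' _; rewrite normrM ler_wpM2r// trans_le.
under eq_bigr do rewrite mulr_suml.
rewrite exchange_big /= /C1 !mulr_suml; apply: ler_sum => p _.
apply: (@le_trans _ _ (`|p.1.1| * wt (jv p) * \sum_k' nb p k k' * (wt (frq k') * `|b k'|))).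
  by rewrite mulr_sumr; apply: ler_sum => k' _; rewrite le_eqVlt; apply/orP; left; apply/eqP; ring.
rewrite [leRHS](_ : _ = `|p.1.1| * wt (jv p) * (2 * ((1 + wt (jv p)) ^+ s * D / wt (frq k) ^+ s))); last by ring.
apply: ler_wpM2l; first by rewrite mulr_ge0// ltW.
have w1 : 0 < 1 + wt (jv p) by have := w0 (jv p); lra.
apply: nb_sum; first by rewrite divr_ge0 ?mulr_ge0 ?exprn_ge0// ltW.
move=> k' hk'; have hw : wt (frq k) <= (1 + wt (jv p)) * wt (frq k').
  case: hk' => E.
    by rewrite -(addrK (jv p) (frq k)) -E -(wtN (jv p)); exact: wt_shift_le.
  by rewrite -(subrK (jv p) (frq k)) -E; exact: wt_shift_le.
apply: le_trans (ler_wpM2l _ (hb k')) _; first by rewrite ltW.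
rewrite exprD invfM [leLHS](_ : _ = D / wt (frq k') ^+ s * (wt (frq k') ^+ 1 / wt (frq k') ^+ 2)); last by rewrite expr1; ring.
apply: (@le_trans _ _ (D / wt (frq k') ^+ s * 1)).
  rewrite ler_wpM2l//; first by rewrite divr_ge0 ?exprn_ge0// ltW.
  by rewrite ler_pdivrMr ?exprn_gt0// mul1r ler_weXn2l// wt_ge1.
rewrite mulr1 ler_pdivlMr ?exprn_gt0// mulrAC ler_pdivrMr ?exprn_gt0// [leRHS]mulrAC -exprMn mulrC.
by apply: ler_wpM2r => //; rewrite lerXn2r// nnegrE ?mulr_ge0// ltW.
Qed.

(* By antisymmetry the transport term only sees the differences [w k - w k'] of the weights. *)
Lemma energy_rate s : exists C, forall N (b : box N -> R),
  2 * \sum_k wt (frq k) ^+ (s * 2) * (b k * mapp (@gmx N) b k)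
  <= C * \sum_k wt (frq k) ^+ (s * 2) * b k ^+ 2.
Proof.
pose c (p : R * int * int) := (s * 2)%:R * wt (jv p) * (1 + wt (jv p)) ^+ (s * 2).
have w0 z : 0 <= wt z by exact/ltW/wt_gt0.
have c0 p : 0 <= c p by rewrite /c !mulr_ge0// exprn_ge0// addr_ge0.
have pc0 p : 0 <= `|p.1.1| * wt (jv p) * c p.
  by apply: mulr_ge0 => //; exact: mulr_ge0.
exists (\sum_(p <- l) `|p.1.1| * wt (jv p) * c p * 2) => N b.
pose w (k : box N) := wt (frq k) ^+ (s * 2).
pose X (k : box N) := w k * b k ^+ 2.
have w0' k : 0 <= w k by rewrite exprn_ge0.
have X0 k : 0 <= X k by rewrite mulr_ge0// sqr_ge0.
have Q : \sum_k \sum_k' w k * (b k * (trans k k' * b k')) *+ 2 =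
         \sum_k \sum_k' (w k - w k') * (trans k k' * (b k * b k')).
  have E : \sum_k \sum_k' w k * (b k * (trans k k' * b k')) =
           \sum_k \sum_k' - (w k' * (b k * (trans k k' * b k'))).
    rewrite exchange_big /=; apply: eq_bigr => k _; apply: eq_bigr => k' _.
    by rewrite trans_anti; ring.
  rewrite (_ : \sum_k _ = \sum_k \sum_k' w k * (b k * (trans k k' * b k')) + \sum_k \sum_k' w k * (b k * (trans k k' * b k'))).
    rewrite {1}E -big_split /=; apply: eq_bigr => k _.
    by rewrite -big_split /=; apply: eq_bigr => k' _; ring.
  by rewrite -big_split; apply: eq_bigr => k _; rewrite -big_split /=; apply: eq_bigr => k' _; rewrite mulr2n.
rewrite -[\sum_k _ * b k ^+ 2]/(\sum_k X k) -[\sum_k _ * (b k * _)]/(\sum_k w k * (b k * mapp (@gmx N) b k)).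
have -> : 2 * \sum_k w k * (b k * mapp (@gmx N) b k) =
   - (2 * \sum_k lam (frq k) * X k) - \sum_k \sum_k' w k * (b k * (trans k k' * b k')) *+ 2.
  rewrite -mulrN -sumrN !mulr_sumr -sumrB; apply: eq_bigr => k _.
  rewrite gmx_apply /X sumrMnl /=.
  have -> : \sum_k' w k * (b k * (trans k k' * b k')) = w k * (b k * \sum_k' trans k k' * b k').
    by rewrite !mulr_sumr.
  ring.
rewrite Q.
have S1 : 0 <= 2 * \sum_k lam (frq k) * X k.
  by rewrite mulr_ge0// sumr_ge0// => k _; rewrite mulr_ge0.
apply: (@le_trans _ _ (\sum_k \sum_k' `|(w k - w k') * (trans k k' * (b k * b k'))|)).
  apply: (@le_trans _ _ (- \sum_k \sum_k' (w k - w k') * (trans k k' * (b k * b k')))); first by lra.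
  apply: le_trans (ler_norm _) _; rewrite normrN.
  apply: le_trans (ler_norm_sum _ _ _) _; apply: ler_sum => k _; exact: ler_norm_sum.
apply: (@le_trans _ _ (\sum_k \sum_k' \sum_(p <- l) `|p.1.1| * wt (jv p) * c p * (nb p k k' * (X k + X k') / 2))).
  apply: ler_sum => k _; apply: ler_sum => k' _.
  rewrite !normrM.
  apply: (@le_trans _ _ (`|w k - w k'| * ((\sum_(p <- l) `|p.1.1| * (wt (jv p) * wt (frq k') * nb p k k')) * (`|b k| * `|b k'|)))).
    apply: ler_wpM2l => //; apply: ler_wpM2r; [exact: mulr_ge0|exact: trans_le].
  rewrite mulrA mulr_sumr mulr_suml; apply: ler_sum => p _.
  have nbE : frq k = frq k' + jv p \/ frq k = frq k' - jv p \/ nb p k k' = 0.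
    rewrite /nb; case: eqP => [|_]; first by left.
    by case: eqP => [|_]; [right; left|right; right; rewrite addr0].
  have main : (frq k = frq k' + jv p \/ frq k = frq k' - jv p) ->
      `|w k - w k'| * wt (frq k') <= c p * (wt (frq k) ^+ s * wt (frq k') ^+ s).
    move=> h; apply: weight_diff_le; rewrite ?wt_ge1//.
    by case: h => ->; [exact: wt_shift|rewrite -(wtN (jv p)); exact: wt_shift].
  have {}main : `|w k - w k'| * wt (frq k') * nb p k k' <= c p * (wt (frq k) ^+ s * wt (frq k') ^+ s) * nb p k k'.
    case: nbE => [E|[E|->]]; last by rewrite !mulr0.
      by apply: ler_wpM2r; [exact: nb_ge0|apply: main; left].
    by apply: ler_wpM2r; [exact: nb_ge0|apply: main; right].
  apply: (@le_trans _ _ ((`|p.1.1| * wt (jv p) * (`|b k| * `|b k'|)) * (`|w k - w k'| * wt (frq k') * nb p k k'))).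
    by rewrite le_eqVlt; apply/orP; left; apply/eqP; ring.
  apply: le_trans (ler_wpM2l _ main) _; first by rewrite !mulr_ge0.
  have am : (wt (frq k) ^+ s * `|b k|) * (wt (frq k') ^+ s * `|b k'|) <= (X k + X k') / 2.
    have -> : X k = (wt (frq k) ^+ s * `|b k|) ^+ 2 by rewrite exprMn real_normK ?num_real// -exprM.
    have -> : X k' = (wt (frq k') ^+ s * `|b k'|) ^+ 2 by rewrite exprMn real_normK ?num_real// -exprM.
    move: (wt (frq k) ^+ s * _) (wt (frq k') ^+ s * _) => u v.
    by have := sqr_ge0 (u - v); rewrite sqrrB; lra.
  rewrite [leLHS](_ : _ = `|p.1.1| * wt (jv p) * c p * (nb p k k' * ((wt (frq k) ^+ s * `|b k|) * (wt (frq k') ^+ s * `|b k'|)))); last by ring.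
  rewrite -[nb p k k' * _ / 2]mulrA; apply: ler_wpM2l; first exact: pc0.
  by apply: ler_wpM2l => //; exact: nb_ge0.
(* By symmetry of [nb] both halves contribute equally; bounded row sums then finish, as in the Schur
   test. *)
have swap : \sum_k \sum_k' \sum_(p <- l) `|p.1.1| * wt (jv p) * c p * (nb p k k' * (X k + X k') / 2)
   = \sum_(p <- l) `|p.1.1| * wt (jv p) * c p * \sum_k \sum_k' nb p k k' * X k'.
  under eq_bigr do rewrite exchange_big /=.
  rewrite exchange_big /=; apply: eq_bigr => p _.
  have sy : \sum_k \sum_k' nb p k k' * X k = \sum_k \sum_k' nb p k k' * X k'.
    by rewrite exchange_big /=; apply: eq_bigr => k _; apply: eq_bigr => k' _; rewrite nb_sym.
  have -> : \sum_k \sum_k' nb p k k' * X k' = (\sum_k \sum_k' nb p k k' * X k + \sum_k \sum_k' nb p k k' * X k') / 2.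
    by rewrite sy; field.
  rewrite -big_split mulr_suml mulr_sumr; apply: eq_bigr => k _.
  rewrite -big_split mulr_suml mulr_sumr; apply: eq_bigr => k' _ /=.
  by ring.
rewrite swap mulr_suml; apply: ler_sum => p _.
rewrite -[leRHS]mulrA; apply: ler_wpM2l; first exact: pc0.
rewrite exchange_big mulr_sumr; apply: ler_sum => k _ /=.
under eq_bigr do rewrite -nb_sym.
exact: (nb_sum (g := fun=> X k)).
Qed.

End Galerkin.

(** * Sums of modes and their derivatives *)

Section TrigSums.
Variable R : realType.
Local Notation wt := (freq_weight R).

(* A real Fourier basis indexed by all frequencies, in which transport is antisymmetric. *)
Definition cas (t : R) : R := cos t + sin t.

Lemma cas_le t : `|cas t| <= 2.
Proof.
have [c1 c2] := (cos_geN1 t, cos_le1 t); have [s1 s2] := (sin_geN1 t, sin_le1 t).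
by rewrite /cas ler_norml; apply/andP; split; lra.
Qed.

Lemma is_derive_cas (t : R) : is_derive t 1 cas (cas (t + pi / 2)).
Proof.
rewrite /cas cosDpihalf sinDpihalf.
by apply: is_derive_eq; rewrite addrC.
Qed.

(** The index [n] counts derivatives, each shifting the phase by [pi / 2]; frequency factors are
    kept outside. *)
Definition mode (z : int * int) (n : nat) (x y : R) : R :=
  cas (ang z.1 z.2 x y + n%:R * (pi / 2)).

Lemma mode_shift z n x y : mode z n.+1 x y = cas (ang z.1 z.2 x y + n%:R * (pi / 2) + pi / 2).
Proof. by congr cas; rewrite -(@natr1 R n); ring. Qed.

Lemma is_derive_mode_x z n (x y : R) :
  is_derive x 1 (fun s => mode z n s y) (z.1%:~R * mode z n.+1 x y).
Proof.
have d : is_derive x 1 (fun s => ang z.1 z.2 s y + n%:R * (pi / 2)) z.1%:~R.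
  by rewrite /ang; apply: is_derive_eq; rewrite /GRing.scale/=; ring.
have := @is_derive1_comp _ cas (fun s => ang z.1 z.2 s y + n%:R * (pi / 2)) x _ _ (is_derive_cas _) d.
have -> : z.1%:~R * mode z n.+1 x y = cas (ang z.1 z.2 x y + n%:R * (pi / 2) + pi / 2) * z.1%:~R.
  by rewrite mulrC mode_shift.
exact.
Qed.

Lemma is_derive_mode_y z n (x y : R) :
  is_derive y 1 (fun s => mode z n x s) (z.2%:~R * mode z n.+1 x y).
Proof.
have d : is_derive y 1 (fun s => ang z.1 z.2 x s + n%:R * (pi / 2)) z.2%:~R.
  by rewrite /ang; apply: is_derive_eq; rewrite /GRing.scale/=; ring.
have := @is_derive1_comp _ cas (fun s => ang z.1 z.2 x s + n%:R * (pi / 2)) y _ _ (is_derive_cas _) d.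
have -> : z.2%:~R * mode z n.+1 x y = cas (ang z.1 z.2 x y + n%:R * (pi / 2) + pi / 2) * z.2%:~R.
  by rewrite mulrC mode_shift.
exact.
Qed.

Definition tsum N (b : box N -> R) (al be : nat) (x y : R) : R :=
  \sum_k b k * ((frq k).1%:~R ^+ al * (frq k).2%:~R ^+ be * mode (frq k) (al + be) x y).

Lemma is_derive_tsum_x N (b : box N -> R) al be (x y : R) :
  is_derive x 1 (fun s => tsum b al be s y) (tsum b al.+1 be x y).
Proof.
apply: is_derive_bigsum => k; have d := is_derive_mode_x (frq k) (al + be) x y.
by apply: is_derive_eq; rewrite /GRing.scale/= addSn exprS; ring.
Qed.

Lemma is_derive_tsum_y N (b : box N -> R) al be (x y : R) :
  is_derive y 1 (fun s => tsum b al be x s) (tsum b al be.+1 x y).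
Proof.
apply: is_derive_bigsum => k; have d := is_derive_mode_y (frq k) (al + be) x y.
by apply: is_derive_eq; rewrite /GRing.scale/= addnS exprS; ring.
Qed.

Lemma monom_le (z : int * int) al be : `|z.1%:~R ^+ al * z.2%:~R ^+ be| <= wt z ^+ (al + be).
Proof.
rewrite normrM !normrX exprD; have w0 := wt_gt0 R z.
have [a b] := (normr_ge0 (z.1%:~R : R), normr_ge0 (z.2%:~R : R)).
by apply: ler_pM; rewrite ?exprn_ge0// lerXn2r// ?nnegrE ?ltW// /freq_weight; lra.
Qed.

Lemma tsum_le N D (b : box N -> R) al be x y : 0 <= D ->
  decays D (al + be + 4) b -> `|tsum b al be x y| <= 18 * D.
Proof.
move=> D0 h; apply: le_trans (ler_norm_sum _ _ _) _.
apply: (@le_trans _ _ ((\sum_k `|b k| * wt (frq k) ^+ (al + be)) * 2)).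
  rewrite mulr_suml; apply: ler_sum => k _; rewrite normrM -[leRHS]mulrA ler_wpM2l//.
  by rewrite normrM ler_pM// ?monom_le// cas_le.
by have := wt_sum_le D0 h; lra.
Qed.

End TrigSums.

(** * Uniform bounds on the approximations and smoothness of their limit *)

Section Galerkin.
Variables (R : realType) (l : seq (R * int * int)) (lam : int * int -> R) (Lam : R).
Hypothesis lam0 : forall z, 0 <= lam z.
Hypothesis lamle : forall z, lam z <= Lam * freq_weight R z ^+ 2.
Variable init : int * int -> R.
Hypothesis init_energy : forall s, exists E, forall N,
  \sum_(k : box N) freq_weight R (frq k) ^+ (s * 2) * init (frq k) ^+ 2 <= E.
Local Notation wt := (freq_weight R).

Definition galerkin_coef N : R -> box N -> R :=
  projT1 (cid (linear_ode (@gmx _ l lam N) (fun k => init (frq k)))).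

Lemma galerkin0 N k : @galerkin_coef N 0 k = init (frq k).
Proof. by rewrite /galerkin_coef; case: cid => a [/= h _]; exact: h. Qed.

Lemma is_derive_galerkin N (t : R) k :
  is_derive t 1 (fun s => @galerkin_coef N s k) (mapp (@gmx _ l lam N) (galerkin_coef t) k).
Proof. by rewrite /galerkin_coef; case: cid => a [/= _ h]; exact: h. Qed.

(** A coefficient is controlled by the energy of order [s], whose growth rate does not depend on
    [N]. The bound [1 + X] stands for the square root of [X]. *)
Lemma galerkin_decay s tau : exists2 D, 0 <= D &
  forall N t, 0 <= t -> t <= tau -> decays D s (@galerkin_coef N t).
Proof.
have [C hC] := energy_rate l lam0 s.
have [E hE] := init_energy s.
have E0 : 0 <= E.
  by apply: le_trans (hE 0%N); rewrite sumr_ge0// => k _; rewrite mulr_ge0 ?sqr_ge0// exprn_ge0// ltW// wt_gt0.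
pose X := expR (`|C| * tau) * E.
have X0 : 0 <= X by rewrite mulr_ge0// expR_ge0.
exists (1 + X) => [|N t t0 tt k]; first exact: addr_ge0.
have w0 : 0 < wt (frq k) ^+ s by rewrite exprn_gt0// wt_gt0.
rewrite ler_pdivlMr//.
have h := energy_bound (@is_derive_galerkin N) (hC N) t0.
have {}h : (`|galerkin_coef t k| * wt (frq k) ^+ s) ^+ 2 <= X.
  apply: (@le_trans _ _ (\sum_(k : box N) wt (frq k) ^+ (s * 2) * galerkin_coef t k ^+ 2)).
    rewrite (bigD1 k)//= exprMn real_normK ?num_real// -exprM mulrC lerDl sumr_ge0// => i _.
    by rewrite mulr_ge0 ?sqr_ge0// exprn_ge0// ltW// wt_gt0.
  apply: le_trans h _; apply: ler_pM; rewrite ?expR_ge0//.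
  - by rewrite sumr_ge0// => i _; rewrite mulr_ge0 ?sqr_ge0// exprn_ge0// ltW// wt_gt0.
  - rewrite ler_expR; apply: (@le_trans _ _ (`|C| * t)); last by rewrite ler_wpM2l.
    by rewrite ler_wpM2r// ler_norm.
  - by under eq_bigr do rewrite galerkin0; exact: hE.
move: h X0; move: X (_ * _) => X u; nra.
Qed.

(** Coefficients of the time derivative of order [g]: the system is linear and autonomous, so each
    derivative is one more application of the matrix. *)
Definition gder g N (t : R) : box N -> R := iter g (mapp (@gmx _ l lam N)) (galerkin_coef t).

Lemma is_derive_gder g N (t : R) k :
  is_derive t 1 (fun s => @gder g N s k) (gder g.+1 t k).
Proof.
elim: g k => [|g IH] k; first exact: is_derive_galerkin.
apply: is_derive_bigsum => k'; have h := IH k'.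
Qed.

Lemma gder_decay g s tau : exists2 D, 0 <= D &
  forall N t, 0 <= t -> t <= tau -> decays D s (@gder g N t).
Proof.
elim: g s => [|g IH] s; first exact: galerkin_decay.
have [D D0 hD] := IH (s + 2)%N.
have [C [C0 hC]] := mapp_decay l lam0 lamle s.
exists (C * D) => [|N t t0 tt]; first exact: mulr_ge0.
by apply: hC => //; exact: hD.
Qed.

Definition galerkin_sum g al be N (t x y : R) : R := tsum (@gder g N t) al be x y.

Lemma gal_bound g al be tau : exists2 C, 0 <= C &
  forall N t x y, 0 <= t -> t <= tau -> `|galerkin_sum g al be N t x y| <= C.
Proof.
have [D D0 hD] := gder_decay g (al + be + 4) tau.
exists (18 * D) => [|N t x y t0 tt]; first exact: mulr_ge0.
by apply: tsum_le => //; exact: hD.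
Qed.

Lemma is_derive_gal_t g al be N (t x y : R) :
  is_derive t 1 (fun s => galerkin_sum g al be N s x y) (galerkin_sum g.+1 al be N t x y).
Proof.
apply: is_derive_bigsum => k; have h := is_derive_gder g t k.
by apply: is_derive_eq; rewrite /GRing.scale/=; ring.
Qed.

Lemma gal_lip g al be tau : exists2 C, 0 <= C &
  forall N t t' x x' y y', 0 <= t -> t <= tau -> 0 <= t' -> t' <= tau ->
   `|galerkin_sum g al be N t' x' y' - galerkin_sum g al be N t x y| <= C * (`|t' - t| + `|x' - x| + `|y' - y|).
Proof.
have [C1 C10 h1] := gal_bound g.+1 al be tau.
have [C2 C20 h2] := gal_bound g al.+1 be tau.
have [C3 C30 h3] := gal_bound g al be.+1 tau.
exists (C1 + C2 + C3) => [|N t t' x x' y y' t0 tt t'0 t't]; first by lra.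
have e1 : `|galerkin_sum g al be N t' x' y' - galerkin_sum g al be N t x' y'| <= C1 * `|t' - t|.
  apply: (lip_bound (fun z => is_derive_gal_t g al be N z x' y')) => z z1 z2.
  by apply: h1; [apply: le_trans z1|apply: le_trans z2 _]; rewrite ?le_min ?ge_max ?t0 ?tt.
have e2 : `|galerkin_sum g al be N t x' y' - galerkin_sum g al be N t x y'| <= C2 * `|x' - x|.
  by apply: (lip_bound (fun z => is_derive_tsum_x _ al be z y')) => z _ _; exact: h2.
have e3 : `|galerkin_sum g al be N t x y' - galerkin_sum g al be N t x y| <= C3 * `|y' - y|.
  by apply: (lip_bound (fun z => is_derive_tsum_y _ al be x z)) => z _ _; exact: h3.
have -> : galerkin_sum g al be N t' x' y' - galerkin_sum g al be N t x y =
  (galerkin_sum g al be N t' x' y' - galerkin_sum g al be N t x' y') +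
  ((galerkin_sum g al be N t x' y' - galerkin_sum g al be N t x y') + (galerkin_sum g al be N t x y' - galerkin_sum g al be N t x y)) by ring.
apply: le_trans (ler_normD _ _) _; have := ler_normD (galerkin_sum g al be N t x' y' - galerkin_sum g al be N t x y') (galerkin_sum g al be N t x y' - galerkin_sum g al be N t x y).
have [n1 [n2 n3]] := (normr_ge0 (t' - t), (normr_ge0 (x' - x), normr_ge0 (y' - y))).
move: e1 e2 e3.
set p1 := `|galerkin_sum _ _ _ _ _ _ _ - galerkin_sum _ _ _ _ t x' y'|; set p2 := `|galerkin_sum _ _ _ _ _ _ _ - galerkin_sum _ _ _ _ _ x y'|.
set p3 := `|galerkin_sum _ _ _ _ _ _ _ - galerkin_sum _ _ _ _ t x y|; set p4 := `|_ + _|.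
move=> e1 e2 e3 e4; nra.
Qed.

Section Limit.
Variable U : set_system nat.
Hypothesis UU : UltraFilter U.

Definition glim g al be (t x y : R) : R := ulim U (fun N => galerkin_sum g al be N t x y).

Lemma cvg_gal g al be t x y : 0 <= t ->
  (fun N => galerkin_sum g al be N t x y) @ U --> glim g al be t x y.
Proof.
move=> t0; have [C C0 h] := gal_bound g al be t.
by apply: (@cvg_ulim R U UU _ C) => N; exact: h.
Qed.

Lemma glim_bound g al be tau : exists2 C, 0 <= C &
  forall t x y, 0 <= t -> t <= tau -> `|glim g al be t x y| <= C.
Proof.
have [C C0 h] := gal_bound g al be tau; exists C => // t x y t0 tt.
have hc := @cvg_gal g al be t x y t0.
by apply: (ultra_norm_le UU hc) => N; exact: h.
Qed.

Lemma glim_lip g al be tau : exists2 C, 0 <= C &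
  forall t t' x x' y y', 0 <= t -> t <= tau -> 0 <= t' -> t' <= tau ->
   `|glim g al be t' x' y' - glim g al be t x y| <= C * (`|t' - t| + `|x' - x| + `|y' - y|).
Proof.
have [C C0 h] := gal_lip g al be tau; exists C => // t t' x x' y y' t0 tt t'0 t't.
apply: (ultra_norm_le UU (cvgB (@cvg_gal g al be t' x' y' t'0) (@cvg_gal g al be t x y t0))) => N.
exact: h.
Qed.

Lemma is_derive_glim_t g al be (t x y : R) : 0 < t ->
  is_derive t 1 (fun s => glim g al be s x y) (glim g.+1 al be t x y).
Proof.
move=> t0; have [C C0 hC] := gal_bound g.+2 al be (t + t).
have th (h : R) : `|h| < t -> 0 <= t + h /\ t + h <= t + t.
  by rewrite ltr_norml => /andP[h1 h2]; split; lra.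
apply: (@ulim_derive R U UU (fun s N => galerkin_sum g al be N s x y) _ (fun N => galerkin_sum g.+1 al be N t x y) _ t t C t0).
- by move=> h /th[h1 _]; exact: cvg_gal.
- by apply: cvg_gal; exact: ltW.
- move=> h N /[dup] ht /th[h1 h2].
  apply: (taylor_bound (fun z => is_derive_gal_t g al be N z x y) (fun z => is_derive_gal_t g.+1 al be N z x y)).
  by move=> z; rewrite ler_norml => /andP[z1 z2]; apply: hC; lra.
Qed.

Lemma is_derive_glim_x g al be (t x y : R) : 0 <= t ->
  is_derive x 1 (fun s => glim g al be t s y) (glim g al.+1 be t x y).
Proof.
move=> t0; have [C C0 hC] := gal_bound g al.+2 be t.
apply: (@ulim_derive R U UU (fun s N => galerkin_sum g al be N t s y) _ (fun N => galerkin_sum g al.+1 be N t x y) _ x 1 C ltr01).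
- by move=> h _; exact: cvg_gal.
- exact: cvg_gal.
- move=> h N _.
  apply: (taylor_bound (fun z => is_derive_tsum_x _ al be z y) (fun z => is_derive_tsum_x _ al.+1 be z y)).
  by move=> z _; apply: hC.
Qed.

Lemma is_derive_glim_y g al be (t x y : R) : 0 <= t ->
  is_derive y 1 (fun s => glim g al be t x s) (glim g al be.+1 t x y).
Proof.
move=> t0; have [C C0 hC] := gal_bound g al be.+2 t.
apply: (@ulim_derive R U UU (fun s N => galerkin_sum g al be N t x s) _ (fun N => galerkin_sum g al be.+1 N t x y) _ y 1 C ltr01).
- by move=> h _; exact: cvg_gal.
- exact: cvg_gal.
- move=> h N _.
  apply: (taylor_bound (fun z => is_derive_tsum_y _ al be x z) (fun z => is_derive_tsum_y _ al be.+1 x z)).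
  by move=> z _; apply: hC.
Qed.

Lemma glim_smooth g al be (F : R -> R -> R -> R) :
  (forall t x y, 0 < t -> F t x y = glim g al be t x y) ->
  smooth_on (fun t _ _ => 0 < t) F.
Proof.
(* Agreement with a limit is asked for positive times only, because the estimates say nothing about
   negative ones. *)
pose S (F : R -> R -> R -> R) := exists g al be, forall t x y, 0 < t -> F t x y = glim g al be t x y.
move=> FE; apply: (@smooth_closed _ _ S); last by exists g, al, be.
  move=> {g al be FE}G [g [al [be GE]]] t x y t0.
  have pos (h : R) : `|h| < t -> 0 < t + h by rewrite ltr_norml => /andP[]; lra.
  split; last split.
  - have [C C0 hC] := glim_lip g al be (t + t).
    apply/continuous3P => e e0; have C1 : 0 < 3 * (C + 1) by lra.
    exists (Num.min t (e / (3 * (C + 1)))) => [|t' x' y']; first by rewrite lt_min t0 divr_gt0.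
    rewrite !lt_min => /andP[ht h1] /andP[_ h2] /andP[_ h3].
    have [u1 u2] : 0 < t' /\ t' <= t + t by move: ht; rewrite ltr_norml => /andP[]; split; lra.
    rewrite !GE//; apply: le_trans (hC t t' x x' y y' (ltW t0) _ (ltW u1) u2) _; first by rewrite lerDl ltW.
    move: h1 h2 h3; rewrite !ltr_pdivlMr//.
    by have := normr_ge0 (t' - t); have := normr_ge0 (x' - x); have := normr_ge0 (y' - y); nra.
  - have h : is_derive t 1 (fun s => G s x y) (glim g.+1 al be t x y).
      by apply: (is_derive_local t0 _ (is_derive_glim_t g al be x y t0)) => h ht; exact/GE/pos.
    by case: h.
  - have -> : (fun s => G t s y) = fun s => glim g al be t s y by apply/funext => s; rewrite GE.
    by case: (is_derive_glim_x g al be x y (ltW t0)).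
  - have -> : (fun s => G t x s) = fun s => glim g al be t x s by apply/funext => s; rewrite GE.
    by case: (is_derive_glim_y g al be x y (ltW t0)).
move=> {g al be FE}G [g [al [be GE]]].
have pos (t h : R) : `|h| < t -> 0 < t + h by rewrite ltr_norml => /andP[]; lra.
split; [exists g.+1, al, be|exists g, al.+1, be|exists g, al, be.+1] => t x y t0.
- apply: is_derive_derive1.
  by apply: (is_derive_local t0 _ (is_derive_glim_t g al be x y t0)) => h ht; exact/GE/pos.
- apply: is_derive_derive1.
  have -> : (fun s => G t s y) = fun s => glim g al be t s y by apply/funext => s; rewrite GE.
  exact: is_derive_glim_x (ltW t0).
- apply: is_derive_derive1.
  have -> : (fun s => G t x s) = fun s => glim g al be t x s by apply/funext => s; rewrite GE.
  exact: is_derive_glim_y (ltW t0).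
Qed.

End Limit.
End Galerkin.

(** * Transport of a single mode *)

Section Advection.
Variables (R : realType) (l : seq (R * int * int)).
Local Notation wt := (freq_weight R).
Local Notation crs := (cross R).

Lemma mode_le z n (x y : R) : `|mode z n x y| <= 2.
Proof. exact: cas_le. Qed.

Lemma mode0E z (x y : R) : mode z 0 x y = cas (ang z.1 z.2 x y).
Proof. by rewrite /mode mul0r addr0. Qed.

(** Product-to-sum formulas: a velocity wave of frequency [j] sends the mode [z] to the modes
    [z + j] and [z - j]. *)
Lemma advect_mode z (x y : R) :
  vel1 l x y * (z.1%:~R * mode z 1 x y) + vel2 l x y * (z.2%:~R * mode z 1 x y) =
  \sum_(p <- l) p.1.1 / 2 * crs (jv p) z * (mode (z + jv p) 0 x y - mode (z - jv p) 0 x y).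
Proof.
rewrite /vel1 /vel2 /grad_x /grad_y -sumrN !mulr_suml -big_split /=; apply: eq_bigr => p _.
rewrite !mode0E mode_shift mul0r addr0 /cas cosDpihalf sinDpihalf.
have -> : ang (z + jv p).1 (z + jv p).2 x y = ang z.1 z.2 x y + ang p.1.2 p.2 x y.
  by rewrite /ang /= !intrD; ring.
have -> : ang (z - jv p).1 (z - jv p).2 x y = ang z.1 z.2 x y - ang p.1.2 p.2 x y.
  by rewrite /ang /= !intrD !intrN; ring.
by rewrite cosD cosB sinD sinB /cross /=; field.
Qed.

Lemma trunc_mode_le N z (x y : R) :
  `|mode z 0 x y - \sum_(k : box N) (frq k == z)%:R * mode (frq k) 0 x y| <= 2 * wt z / N.+1%:R.
Proof.
apply: le_trans (sum_frq_gap N z (fun z => mode z 0 x y)) _.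
by rewrite -mulrA ler_wpM2r ?mode_le// divr_ge0// ltW// wt_gt0.
Qed.

End Advection.

(** * Residual of the approximations and the limit equation *)

Section Galerkin.
Variables (R : realType) (l : seq (R * int * int)) (lam : int * int -> R) (Lam : R).
Hypothesis lam0 : forall z, 0 <= lam z.
Hypothesis lamle : forall z, lam z <= Lam * freq_weight R z ^+ 2.
Variable init : int * int -> R.
Hypothesis init_energy : forall s, exists E, forall N,
  \sum_(k : box N) freq_weight R (frq k) ^+ (s * 2) * init (frq k) ^+ 2 <= E.
Local Notation wt := (freq_weight R).
Local Notation crs := (cross R).
Local Notation galerkin := (galerkin_coef l lam init).
Local Notation gal := (galerkin_sum l lam init).

Definition csum N (t : R) (g : int * int -> R) : R := \sum_(k : box N) @galerkin N t k * g (frq k).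

Definition resid N (t x y : R) : R :=
  gal 1 0 0 N t x y + vel1 l x y * gal 0 1 0 N t x y + vel2 l x y * gal 0 0 1 N t x y
  + csum N t (fun z => lam z * mode z 0 x y).

(** The finite system cancels everything except the modes that a shift moves out of the box. *)
Lemma residE N t x y : resid N t x y =
  \sum_(k' : box N) @galerkin N t k' * \sum_(p <- l) p.1.1 / 2 * crs (jv p) (frq k') *
   ((mode (frq k' + jv p) 0 x y - \sum_(k : box N) (frq k == frq k' + jv p)%:R * mode (frq k) 0 x y)
    - (mode (frq k' - jv p) 0 x y - \sum_(k : box N) (frq k == frq k' - jv p)%:R * mode (frq k) 0 x y)).
Proof.
have -> : resid N t x y = \sum_(k' : box N) @galerkin N t k' *
    (vel1 l x y * ((frq k').1%:~R * mode (frq k') 1 x y) + vel2 l x y * ((frq k').2%:~R * mode (frq k') 1 x y))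
  - \sum_(k : box N) \sum_(k' : box N) trans l k k' * galerkin t k' * mode (frq k) 0 x y.
  rewrite /resid /csum /galerkin_sum /tsum !mulr_sumr -!big_split -sumrB /=; apply: eq_bigr => k _.
  rewrite /gder /= gmx_apply !expr0 !expr1 addn0 -mulr_suml; ring.
rewrite exchange_big -sumrB /=; apply: eq_bigr => k' _.
have -> : \sum_(k : box N) trans l k k' * galerkin t k' * mode (frq k) 0 x y =
   galerkin t k' * \sum_(k : box N) trans l k k' * mode (frq k) 0 x y.
  by rewrite mulr_sumr; apply: eq_bigr => k _; ring.
have A := advect_mode l (frq k') x y; rewrite /= in A.
rewrite -mulrBr A; congr (_ * _).
rewrite /trans; under [X in _ - X]eq_bigr do rewrite mulr_suml.
rewrite exchange_big -sumrB /=; apply: eq_bigr => p _.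
have -> : \sum_(k : box N) p.1.1 / 2 * (crs (jv p) (frq k') *
     ((frq k == frq k' + jv p)%:R - (frq k == frq k' - jv p)%:R)) * mode (frq k) 0 x y =
  p.1.1 / 2 * crs (jv p) (frq k') * (\sum_(k : box N) (frq k == frq k' + jv p)%:R * mode (frq k) 0 x y
   - \sum_(k : box N) (frq k == frq k' - jv p)%:R * mode (frq k) 0 x y).
  by rewrite -sumrB mulr_sumr; apply: eq_bigr => k _; ring.
by rewrite -mulrBr; congr (_ * _); ring.
Qed.

Lemma resid_le tau : exists2 C, 0 <= C & forall N t x y, 0 <= t -> t <= tau ->
  `|resid N t x y| <= C / N.+1%:R.
Proof.
(* [6 = 2 + 4]: one weight for the cross product, one for the truncation gap, four for
   summability. *)
have [D D0 hD] := galerkin_decay l lam0 init_energy 6 tau.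
pose C1 := \sum_(p <- l) `|p.1.1| * (2 * wt (jv p) * (1 + wt (jv p))).
have w0 z : 0 <= wt z by exact/ltW/wt_gt0.
have C10 : 0 <= C1.
  by apply: sumr_ge0 => p _; have := w0 (jv p) => h; rewrite mulr_ge0// !mulr_ge0//; lra.
exists (9 * D * C1) => [|N t x y t0 tt]; first by rewrite !mulr_ge0.
rewrite residE; apply: le_trans (ler_norm_sum _ _ _) _.
apply: (@le_trans _ _ ((\sum_(k : box N) `|galerkin t k| * wt (frq k) ^+ 2) * (C1 / N.+1%:R))); last first.
  rewrite mulrA; apply: ler_wpM2r => //; apply: ler_wpM2r => //.
  exact: (wt_sum_le (s := 2) D0 (hD N t t0 tt)).
rewrite mulr_suml; apply: ler_sum => k _; rewrite normrM -mulrA; apply: ler_wpM2l => //.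
apply: le_trans (ler_norm_sum _ _ _) _.
rewrite mulr_suml mulr_sumr; apply: ler_sum => p _.
rewrite !normrM (ger0_norm (_ : 0 <= 2^-1)) ?invr_ge0//.
have hm z (h : wt z <= (1 + wt (jv p)) * wt (frq k)) :
    `|mode z 0 x y - \sum_(k : box N) (frq k == z)%:R * mode (frq k) 0 x y|
     <= 2 * ((1 + wt (jv p)) * wt (frq k)) / N.+1%:R.
  apply: le_trans (trunc_mode_le N z x y) _.
  by rewrite ler_pM2r ?invr_gt0// ler_wpM2l.
have h1 := hm _ (wt_shift_le R (jv p) (frq k)).
have h2 : wt (frq k - jv p) <= (1 + wt (jv p)) * wt (frq k).
  by rewrite -(wtN R (jv p)); exact: wt_shift_le.
have {h2}h2 := hm _ h2.
apply: (@le_trans _ _ (`|p.1.1| * 2^-1 * (wt (jv p) * wt (frq k)) *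
  (2 * ((1 + wt (jv p)) * wt (frq k)) / N.+1%:R + 2 * ((1 + wt (jv p)) * wt (frq k)) / N.+1%:R))).
  apply: ler_pM; rewrite ?mulr_ge0 ?invr_ge0//.
    by rewrite ler_wpM2l ?crs_le// mulr_ge0// invr_ge0.
  by apply: le_trans (ler_normB _ _) _; exact: lerD.
by rewrite le_eqVlt; apply/orP; left; apply/eqP; field; rewrite nat1r.
Qed.

Section Limit.
Variable U : set_system nat.
Hypothesis UU : UltraFilter U.
Hypothesis Uoo : \oo `<=` U.

Definition coef_lim (t : R) (g : int * int -> R) : R := ulim U (fun N => csum N t g).
Definition coef (t : R) (z : int * int) : R := coef_lim t (fun z' => (z' == z)%:R).
Definition partial_sum K (t : R) (g : int * int -> R) : R := \sum_(k : box K) coef t (frq k) * g (frq k).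

Lemma glim_mode t x y : glim l lam init U 0 0 0 t x y = coef_lim t (fun z => mode z 0 x y).
Proof.
congr (ulim U _); apply/funext => N; apply: eq_bigr => k _.
by rewrite !expr0 !mul1r.
Qed.

Lemma csum_bound r G tau : 0 <= G -> exists2 C, 0 <= C &
  forall g, (forall z, `|g z| <= G * wt z ^+ r) ->
  forall N t, 0 <= t -> t <= tau -> `|csum N t g| <= C.
Proof.
move=> G0; have [D D0 hD] := galerkin_decay l lam0 init_energy (r + 4) tau.
exists (9 * D * G) => [|g hg N t t0 tt]; first by rewrite !mulr_ge0.
apply: le_trans (ler_norm_sum _ _ _) _.
apply: (@le_trans _ _ ((\sum_(k : box N) `|galerkin t k| * wt (frq k) ^+ r) * G)).
  rewrite mulr_suml; apply: ler_sum => k _.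
  by rewrite normrM -mulrA ler_wpM2l// mulrC.
by rewrite ler_wpM2r// (wt_sum_le D0 (hD N t t0 tt)).
Qed.

Lemma cvg_csum r G g t : 0 <= G -> (forall z, `|g z| <= G * wt z ^+ r) -> 0 <= t ->
  (fun N => csum N t g) @ U --> coef_lim t g.
Proof.
move=> G0 hg t0; have [C C0 h] := csum_bound r t G0.
by apply: (@cvg_ulim R U UU _ C) => N; exact: h.
Qed.

Lemma coef_decay s tau : exists2 D, 0 <= D &
  forall t z, 0 <= t -> t <= tau -> `|coef t z| <= D / wt z ^+ s.
Proof.
have [D D0 hD] := galerkin_decay l lam0 init_energy s tau.
exists D => // t z t0 tt; have w0 := wt_gt0 R z.
have h : (fun N => csum N t (fun z' => (z' == z)%:R)) @ U --> coef t z.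
  apply: (cvg_csum (r := 0) (G := 1)) => // z'.
  by rewrite expr0 mulr1 normr_nat; case: (_ == _).
apply: (ultra_norm_le UU h) => N.
apply: le_trans (ler_norm_sum _ _ _) _.
under eq_bigr do rewrite normrM normr_nat mulrC.
apply: sum_frq_le; first by rewrite divr_ge0// exprn_ge0// ltW.
by move=> k <-; exact: hD.
Qed.

Lemma psum_bound r tau : exists2 C, 0 <= C &
  forall K t G g, 0 <= t -> t <= tau -> 0 <= G -> (forall z, `|g z| <= G * wt z ^+ r) ->
  `|partial_sum K t g| <= C * G.
Proof.
have [D D0 hD] := coef_decay (r + 4) tau.
exists (9 * D) => [|K t G g t0 tt G0 hg]; first by rewrite mulr_ge0.
apply: le_trans (ler_norm_sum _ _ _) _.
apply: (@le_trans _ _ ((\sum_(k : box K) `|coef t (frq k)| * wt (frq k) ^+ r) * G)).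
  rewrite mulr_suml; apply: ler_sum => k _.
  by rewrite normrM -mulrA ler_wpM2l// mulrC.
by rewrite ler_wpM2r// (wt_sum_le (b := fun k : box K => coef t (frq k)) D0)// => k; exact: hD.
Qed.

Lemma cvg_psum K t g : 0 <= t ->
  (fun N => \sum_(k' : box K) csum N t (fun z' => (z' == frq k')%:R) * g (frq k')) @ U --> partial_sum K t g.
Proof.
move=> t0; apply: cvg_bigsum => k'; apply: cvgMl.
apply: (cvg_csum (r := 0) (G := 1)) => // z'.
by rewrite expr0 mulr1 normr_nat; case: (_ == _).
Qed.

(* Summing the limit coefficients again gives a convergence that is uniform on the plane, which
   the limit along the ultrafilter alone does not. *)
Lemma psum_clim r G tau : 0 <= G -> exists2 C, 0 <= C &
  forall K t g, 0 <= t -> t <= tau -> (forall z, `|g z| <= G * wt z ^+ r) ->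
  `|coef_lim t g - partial_sum K t g| <= C / K.+1%:R.
Proof.
move=> G0; have [D D0 hD] := galerkin_decay l lam0 init_energy (r.+1 + 4) tau.
exists (9 * D * G) => [|K t g t0 tt hg]; first by rewrite !mulr_ge0.
apply: (ultra_norm_le UU (cvgB (cvg_csum G0 hg t0) (@cvg_psum K t g t0))) => N.
rewrite -[_ N]/(csum N t g - \sum_(k' : box K) csum N t (fun z' => (z' == frq k')%:R) * g (frq k')).
have -> : csum N t g - \sum_(k' : box K) csum N t (fun z' => (z' == frq k')%:R) * g (frq k') =
  \sum_(k : box N) galerkin t k * (g (frq k) - \sum_(k' : box K) (frq k' == frq k)%:R * g (frq k')).
  rewrite /csum; under [X in _ - X]eq_bigr do rewrite mulr_suml.
  rewrite exchange_big -sumrB /=; apply: eq_bigr => k _.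
  rewrite mulrBr; congr (_ - _); rewrite mulr_sumr; apply: eq_bigr => k' _.
  by rewrite eq_sym mulrA.
apply: le_trans (ler_norm_sum _ _ _) _.
apply: (@le_trans _ _ ((\sum_(k : box N) `|galerkin t k| * wt (frq k) ^+ r.+1) * (G / K.+1%:R))).
  rewrite mulr_suml; apply: ler_sum => k _.
  rewrite normrM -mulrA ler_wpM2l//; apply: le_trans (sum_frq_gap _ _ _) _.
  rewrite [leRHS](_ : _ = G * wt (frq k) ^+ r * (wt (frq k) / K.+1%:R)); last by rewrite exprS; ring.
  by rewrite ler_wpM2r// divr_ge0// ltW// wt_gt0.
by rewrite mulrA ler_wpM2r// ler_wpM2r// (wt_sum_le D0 (hD N t t0 tt)).
Qed.

Lemma glim_pde t x y : 0 <= t ->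
  glim l lam init U 1 0 0 t x y + vel1 l x y * glim l lam init U 0 1 0 t x y
  + vel2 l x y * glim l lam init U 0 0 1 t x y + coef_lim t (fun z => lam z * mode z 0 x y) = 0.
Proof.
move=> t0; have Lam0 : 0 <= Lam.
  by have := le_trans (lam0 0) (lamle 0); rewrite pmulr_lge0// exprn_gt0// wt_gt0.
have h1 g al be : (fun N => gal g al be N t x y) @ U --> glim l lam init U g al be t x y.
  exact: (cvg_gal lam0 lamle init_energy UU).
have h2 : (fun N => csum N t (fun z => lam z * mode z 0 x y)) @ U --> coef_lim t (fun z => lam z * mode z 0 x y).
  apply: (cvg_csum (r := 2) (G := Lam * 2)) => //; first exact: mulr_ge0.
  move=> z; rewrite normrM mulrAC ler_pM// ?mode_le//.
  by rewrite ger0_norm.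
have hr : resid ^~ t ^~ x ^~ y @ U --> (glim l lam init U 1 0 0 t x y + vel1 l x y * glim l lam init U 0 1 0 t x y
  + vel2 l x y * glim l lam init U 0 0 1 t x y + coef_lim t (fun z => lam z * mode z 0 x y)).
  apply: cvgD h2; apply: cvgD; [apply: cvgD => //|]; exact: cvgMr.
have [C C0 hC] := resid_le t.
have r0 : resid ^~ t ^~ x ^~ y @ U --> (0 : R).
  suff h : (fun N => resid N t x y) @ \oo --> (0 : R) by exact: cvg_trans (cvg_app _ Uoo) h.
  apply: (@squeeze_cvgr _ _ _ _ (fun N => - (C / N.+1%:R)) (fun N => C / N.+1%:R)).
  - by apply: filterE => N; rewrite -ler_norml; exact: hC.
  - rewrite -oppr0; apply: cvgN; rewrite -(mulr0 C); apply: cvgMr; exact: cvg_harmonic.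
  - rewrite -(mulr0 C); apply: cvgMr; exact: cvg_harmonic.
exact: cvg_unique hr r0.
Qed.

(** The datum has finitely many modes, so the truncated initial values are exact once the box
    contains them. *)
Lemma glim_init th0 N0 : (forall N x y, (N0 <= N)%N ->
    \sum_(k : box N) init (frq k) * mode (frq k) 0 x y = th0 x y) ->
  forall x y, glim l lam init U 0 0 0 0 x y = th0 x y.
Proof.
move=> h x y; rewrite glim_mode; apply: ulimE => //.
suff h' : (fun N => csum N 0 (fun z => mode z 0 x y)) @ \oo --> th0 x y by exact: cvg_trans (cvg_app _ Uoo) h'.
apply: cvg_near_cst; exists N0 => // N /= NN; rewrite -(h N)//.
by apply: eq_bigr => k _; rewrite galerkin0.
Qed.

End Limit.
End Galerkin.

(** * The nonlocal operator on the limit *)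

Section Fractional.
Variable R : realType.
Local Notation mu := (@lebesgue_measure R).
Local Notation T2 := (measurableTypeR R * measurableTypeR R)%type.
Variable m : R -> R.
Hypothesis m0 : forall r, 0 < r -> 0 < m r.
Hypothesis mc : forall r, 0 < r -> {for r, continuous m}.
Hypothesis md : forall r s, 0 < r -> r <= s -> m s <= m r.
Hypothesis mint : (\int[mu]_(r in [set r : R | (0 < r)%R]) (m r / (1 + r))%:E < +oo)%E.
Local Notation wt := (freq_weight R).

Lemma Rintegral_sum (D : set T2) (I : Type) (r : seq I) (c : I -> R) (f : I -> T2 -> R) :
  measurable D -> (forall i, (@leb2 R).-integrable D (EFin \o f i)) ->
  (@leb2 R).-integrable D (EFin \o (fun y => \sum_(i <- r) c i * f i y)) /\
  Rintegral (@leb2 R) D (fun y => \sum_(i <- r) c i * f i y) =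
  \sum_(i <- r) c i * Rintegral (@leb2 R) D (f i).
Proof.
move=> mD fi; elim: r => [|i r [IH1 IH2]].
  rewrite big_nil; split.
    rewrite (_ : (fun _ => _) = fun=> 0); first exact: integrable0.
    by apply/funext => y; rewrite big_nil.
  rewrite (_ : (fun _ => _) = fun=> 0); first by rewrite Rintegral_cst// mul0r.
  by apply/funext => y; rewrite big_nil.
have ci : (@leb2 R).-integrable D (EFin \o (fun y => c i * f i y)) by exact: (integrableZl mD (c i) (fi i)).
rewrite (_ : (fun y => _) = (fun y => c i * f i y + \sum_(j <- r) c j * f j y)); last first.
  by apply/funext => y; rewrite big_cons.
split; first exact: (integrableD mD ci IH1).
by rewrite RintegralD// RintegralZl// big_cons IH2.
Qed.

Definition cosdef (z : int * int) (w : T2) : R := 1 - cos (ang z.1 z.2 w.1 w.2).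

Lemma measurable_ang z : measurable_fun setT (fun w : T2 => ang z.1 z.2 w.1 w.2 : R).
Proof.
by apply: measurable_funD; apply: measurable_funM.
Qed.

Lemma measurable_cosdef z : measurable_fun setT (cosdef z).
Proof.
apply: measurable_funB => //; apply: measurableT_comp; last exact: measurable_ang.
by apply: continuous_measurable_fun; exact: continuous_cos.
Qed.

Lemma cosdef_ge0 z w : 0 <= cosdef z w.
Proof. by rewrite subr_ge0 cos_le1. Qed.

Lemma cosdef_le2 z w : cosdef z w <= 2.
Proof. by rewrite /cosdef; have := cos_geN1 (ang z.1 z.2 w.1 w.2 : R); lra. Qed.

Lemma cosdef_le z w : cosdef z w <= wt z ^+ 2 * enorm w.1 w.2 ^+ 2.
Proof.
rewrite enorm_sqr; apply: (@le_trans _ _ (ang z.1 z.2 w.1 w.2 ^+ 2 / 2)).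
  by rewrite /cosdef; have := cos_ge (ang z.1 z.2 w.1 w.2 : R); lra.
have k2 : (z.1%:~R : R) ^+ 2 + z.2%:~R ^+ 2 <= wt z ^+ 2.
  rewrite /freq_weight -(@real_normK _ (z.1%:~R : R)) ?num_real// -(@real_normK _ (z.2%:~R : R)) ?num_real//.
  have [a b] := (normr_ge0 (z.1%:~R : R), normr_ge0 (z.2%:~R : R)); nra.
apply: (@le_trans _ _ (((z.1%:~R : R) ^+ 2 + z.2%:~R ^+ 2) * (w.1 ^+ 2 + w.2 ^+ 2))).
  rewrite /ang; move: (z.1%:~R : R) (z.2%:~R : R) => a b.
  have h1 := sqr_ge0 (a * w.2 - b * w.1); have h2 := sqr_ge0 (a * w.1 + b * w.2).
  rewrite -subr_ge0 (_ : _ - _ = (a * w.2 - b * w.1) ^+ 2 + (a * w.1 + b * w.2) ^+ 2 / 2); last by field.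
  by apply: addr_ge0 => //; apply: divr_ge0.
by apply: ler_wpM2r => //; apply: addr_ge0; exact: sqr_ge0.
Qed.

(* The Fourier multiplier of the nonlocal operator, and that of its truncation off a ball. *)
Definition symb (z : int * int) : R := mult m (cosdef z).
Definition tsymb (e : R) (z : int * int) : R :=
  Rintegral (@leb2 R) (off_ball e) (fun w => cosdef z w * kern m w).

Lemma symb_ge0 z : 0 <= symb z.
Proof. by apply: (mult_ge0 m0); exact: cosdef_ge0. Qed.

Lemma symb_le z : symb z <= 3 * Gk m 1 * wt z ^+ 2.
Proof.
have w0 : 0 <= wt z ^+ 2 by exact: sqr_ge0.
apply: le_trans (mult_le m0 mc md mint w0 (measurable_cosdef z) (cosdef_ge0 z) (cosdef_le2 z) (cosdef_le z)) _.
rewrite mulrAC; apply: ler_wpM2r; first exact: Gk_ge0.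
have := wt_ge1 R z; move: (wt z) => X X1; nra.
Qed.

Lemma tsymb_symb e z : 0 < e -> e <= 1 -> `|tsymb e z - symb z| <= wt z ^+ 2 * (16 * base_mass m) * e.
Proof.
move=> e0 e1.
exact: (mult_trunc m0 mc md mint (sqr_ge0 _) (measurable_cosdef z) (cosdef_ge0 z) (cosdef_le2 z) (cosdef_le z) e0 e1).
Qed.

Lemma measurable_sin_ang z : measurable_fun setT (fun w : T2 => sin (ang z.1 z.2 w.1 w.2 : R)).
Proof.
apply: measurableT_comp; last exact: measurable_ang.
by apply: continuous_measurable_fun; exact: continuous_sin.
Qed.

Lemma sin_kern_int e z : 0 < e ->
  (@leb2 R).-integrable (off_ball e) (EFin \o (fun w => sin (ang z.1 z.2 w.1 w.2) * kern m w)) /\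
  Rintegral (@leb2 R) (off_ball e) (fun w => sin (ang z.1 z.2 w.1 w.2) * kern m w) = 0.
Proof.
move=> e0; have mE := @measurable_off_ball R e.
have hi : (@leb2 R).-integrable (off_ball e) (EFin \o (fun w => sin (ang z.1 z.2 w.1 w.2) * kern m w)).
  apply: (bounded_kern_int m0 mc md mint (c := 1) e0 (measurable_sin_ang z)) => y.
  by rewrite ler_norml sin_geN1 sin_le1.
split=> //.
have [_ h] := integral_opp2 mE (@off_ball_opp R e) hi.
pose g w := sin (ang z.1 z.2 w.1 w.2) * kern m w.
have E : Rintegral (@leb2 R) (off_ball e) (fun w => - 1 * g w) = Rintegral (@leb2 R) (off_ball e) g.
  rewrite /Rintegral -h; congr fine; apply: eq_integral => w _; congr EFin.
  by rewrite /g kern_opp /ang /= !mulrN -opprD sinN; ring.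
move: E; rewrite RintegralZl// /g; lra.
Qed.

(** The increment of a mode is [1 - cos] times the mode plus a multiple of a sine. The sine part is
    odd and integrates to 0, so each mode is an eigenfunction of the truncated operator. *)
Lemma mode_shift_int e z (x y : R) : 0 < e ->
  (@leb2 R).-integrable (off_ball e)
    (EFin \o (fun w => (mode z 0 x y - mode z 0 (x + w.1) (y + w.2)) * kern m w)) /\
  Rintegral (@leb2 R) (off_ball e) (fun w => (mode z 0 x y - mode z 0 (x + w.1) (y + w.2)) * kern m w) =
  tsymb e z * mode z 0 x y.
Proof.
move=> e0; have mE := @measurable_off_ball R e.
have [si s0] := sin_kern_int z e0.
have ci : (@leb2 R).-integrable (off_ball e) (EFin \o (fun w => cosdef z w * kern m w)).
  apply: (bounded_kern_int m0 mc md mint (c := 2) e0 (measurable_cosdef z)) => w.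
  by rewrite ger0_norm ?cosdef_ge0// cosdef_le2.
pose A : R := ang z.1 z.2 x y.
rewrite (_ : (fun w => _) = (fun w => mode z 0 x y * (cosdef z w * kern m w) +
    (sin A - cos A) * (sin (ang z.1 z.2 w.1 w.2) * kern m w))); last first.
  apply/funext => w; rewrite !mode0E /cosdef /cas.
  have -> : ang z.1 z.2 (x + w.1) (y + w.2) = A + ang z.1 z.2 w.1 w.2 by rewrite /A /ang; ring.
  by rewrite -/A cosD sinD; ring.
have ci' := integrableZl mE (mode z 0 x y) ci.
have si' := integrableZl mE (sin A - cos A) si.
split; first exact: (integrableD mE ci' si').
by rewrite RintegralD// RintegralZl// RintegralZl// s0 mulr0 addr0 mulrC.
Qed.

Variables (l : seq (R * int * int)) (init : int * int -> R).
Hypothesis init_energy : forall s, exists E, forall N,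
  \sum_(k : box N) wt (frq k) ^+ (s * 2) * init (frq k) ^+ 2 <= E.
Variable U : set_system nat.
Hypothesis UU : UltraFilter U.
Hypothesis Uoo : \oo `<=` U.

Definition sol : R -> R -> R -> R := glim l symb init U 0 0 0.
Local Notation psum := (partial_sum l symb init U).
Local Notation clim := (coef_lim l symb init U).

Lemma sol_psum t : 0 <= t -> exists2 C, 0 <= C &
  forall K x y, `|sol t x y - psum K t (fun z => mode z 0 x y)| <= C / K.+1%:R.
Proof.
move=> t0; have [C C0 h] := psum_clim l symb_ge0 init_energy UU 0 t (ler0n R 2).
exists C => // K x y; rewrite /sol glim_mode.
by apply: h => // z; rewrite expr0 mulr1 mode_le.
Qed.

Lemma measurable_mode z (x y : R) : measurable_fun setT (fun w : T2 => mode z 0 (x + w.1) (y + w.2) : R).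
Proof.
have mc' : measurable_fun setT (@cas R).
  apply: continuous_measurable_fun => u; apply: cvgD; [exact: continuous_cos|exact: continuous_sin].
have -> : (fun w : T2 => mode z 0 (x + w.1) (y + w.2)) =
    (@cas R) \o (fun w : T2 => ang z.1 z.2 x y + ang z.1 z.2 w.1 w.2).
  by apply/funext => w; rewrite mode0E /=; congr cas; rewrite /ang; ring.
apply: measurableT_comp => //; apply: measurable_funD => //; exact: measurable_ang.
Qed.

Lemma measurable_sol t (x y : R) : 0 <= t -> measurable_fun setT (fun w : T2 => sol t (x + w.1) (y + w.2)).
Proof.
move=> t0; have [C C0 h] := sol_psum t0.
apply: (@measurable_fun_cvg _ _ _ _ (fun K (w : T2) => psum K t (fun z => mode z 0 (x + w.1) (y + w.2)))).
  move=> K; apply: measurable_sum => k; apply: measurable_funM => //; exact: measurable_mode.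
move=> w _; apply/cvgrPdist_le => e e0.
have hc : (fun K => C / K.+1%:R : R) @ \oo --> (0 : R).
  rewrite -(mulr0 C); apply: cvgMr; exact: cvg_harmonic.
move/cvgrPdist_le : hc => /(_ e e0); apply: filterS => K; rewrite sub0r normrN => hK.
by apply: le_trans (h K _ _) _; exact: le_trans (ler_norm _) hK.
Qed.

(** For partial sums the integral is computed mode by mode. The truncation rate in [e] is uniform in
    [K], and [K] tends to infinity at fixed [e], where the kernel has finite mass [Mk]. *)
Lemma sol_trunc t (x y : R) : 0 <= t -> exists2 C, 0 <= C & forall e, 0 < e -> e <= 1 ->
  `|Rintegral (@leb2 R) (off_ball e) (fun w => (sol t x y - sol t (x + w.1) (y + w.2)) * kern m w)
    - clim t (fun z => symb z * mode z 0 x y)| <= C * e.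
Proof.
move=> t0.
have [Cs Cs0 hs] := sol_psum t0.
have [Cp Cp0 hp] := psum_bound l symb_ge0 init_energy UU 2 t.
have G0 : 0 <= 3 * Gk m 1 * 2 by rewrite mulr_ge0// mulr_ge0//; exact: Gk_ge0.
have [Ct Ct0 ht] := psum_clim l symb_ge0 init_energy UU 2 t G0.
have B0 : 0 <= base_mass m by exact: base_mass_ge0.
exists (Cp * (32 * base_mass m)) => [|e e0 e1]; first by apply: mulr_ge0 => //; apply: mulr_ge0.
have mE := @measurable_off_ball R e.
have ki := kern_int m0 mc md mint e0.
pose Mk := Rintegral (@leb2 R) (off_ball e) (kern m).
have Mk0 : 0 <= Mk.
  by apply: Rintegral_ge0 => w we; apply: (kern_ge0 m0); exact: lt_trans we.
pose d w := sol t x y - sol t (x + w.1) (y + w.2).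
pose dK K w := psum K t (fun z => mode z 0 x y) - psum K t (fun z => mode z 0 (x + w.1) (y + w.2)).
have dKi K : (@leb2 R).-integrable (off_ball e) (EFin \o (fun w => dK K w * kern m w)) /\
    Rintegral (@leb2 R) (off_ball e) (fun w => dK K w * kern m w) = psum K t (fun z => tsymb e z * mode z 0 x y).
  have [] := @Rintegral_sum (off_ball e) _ (index_enum (box K)) (fun k => coef l symb init U t (frq k)) _ mE
     (fun k => (mode_shift_int (frq k) x y e0).1).
  rewrite (_ : (fun w => \sum_(k <- _) _) = (fun w => dK K w * kern m w)); last first.
    apply/funext => w; rewrite /dK /partial_sum -sumrB mulr_suml; apply: eq_bigr => k _; ring.
  move=> h1 h2; split=> //; rewrite h2; apply: eq_bigr => k _.
  by rewrite (mode_shift_int (frq k) x y e0).2.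
have dd K w : `|d w - dK K w| <= 2 * Cs / K.+1%:R.
  rewrite (_ : d w - dK K w = (sol t x y - psum K t (fun z => mode z 0 x y)) -
     (sol t (x + w.1) (y + w.2) - psum K t (fun z => mode z 0 (x + w.1) (y + w.2)))); last first.
    by rewrite /d /dK; ring.
  apply: le_trans (ler_normB _ _) _; have := hs K x y; have := hs K (x + w.1) (y + w.2).
  by rewrite -mulrA mulr2n mulrDl mul1r => a b; exact: lerD.
have md' : measurable_fun setT d by apply: measurable_funB => //; exact: measurable_sol.
have di : (@leb2 R).-integrable (off_ball e) (EFin \o (fun w => d w * kern m w)).
  have [C C0 hC] := glim_bound l symb_ge0 symb_le init_energy UU 0 0 0 t.
  apply: (bounded_kern_int m0 mc md mint (c := C + C) e0 md') => w.
  by apply: le_trans (ler_normB _ _) _; apply: lerD; exact: hC.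
have key K : `|Rintegral (@leb2 R) (off_ball e) (fun w => d w * kern m w) - clim t (fun z => symb z * mode z 0 x y)|
    <= Cp * (32 * base_mass m) * e + (2 * Cs * Mk + Ct) / K.+1%:R.
  have [dKint dKE] := dKi K.
  have e1' : `|Rintegral (@leb2 R) (off_ball e) (fun w => d w * kern m w)
      - Rintegral (@leb2 R) (off_ball e) (fun w => dK K w * kern m w)| <= 2 * Cs / K.+1%:R * Mk.
    have di' := integrableZl mE (-1) dKint.
    have si := integrableD mE di di'.
    have -> : Rintegral (@leb2 R) (off_ball e) (fun w => d w * kern m w)
      - Rintegral (@leb2 R) (off_ball e) (fun w => dK K w * kern m w) =
      Rintegral (@leb2 R) (off_ball e) (fun w => d w * kern m w + -1 * (dK K w * kern m w)).
      by rewrite RintegralD// RintegralZl// mulN1r.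
    apply: le_trans (le_normr_Rintegral mE si) _.
    rewrite /Mk -RintegralZl//; apply: le_Rintegral => //.
    - exact: (integrable_abse si).
    - exact: (integrableZl mE (2 * Cs / K.+1%:R) ki).
    - move=> w we; rewrite mulN1r -mulrBl normrM.
      have k0 : 0 <= kern m w by apply: (kern_ge0 m0); exact: lt_trans we.
      by rewrite (ger0_norm k0); apply: ler_wpM2r.
  have e2 : `|psum K t (fun z => tsymb e z * mode z 0 x y) - psum K t (fun z => symb z * mode z 0 x y)|
     <= Cp * (32 * base_mass m * e).
    have -> : psum K t (fun z => tsymb e z * mode z 0 x y) - psum K t (fun z => symb z * mode z 0 x y) =
       psum K t (fun z => (tsymb e z - symb z) * mode z 0 x y).
      by rewrite /partial_sum -sumrB; apply: eq_bigr => k _; ring.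
    apply: hp => // [|z]; first by apply: mulr_ge0; [apply: mulr_ge0|exact: ltW].
    rewrite normrM; apply: le_trans (ler_pM _ _ (tsymb_symb z e0 e1) (mode_le z 0 x y)) _ => //.
    by rewrite le_eqVlt; apply/orP; left; apply/eqP; ring.
  have e3 : `|clim t (fun z => symb z * mode z 0 x y) - psum K t (fun z => symb z * mode z 0 x y)| <= Ct / K.+1%:R.
    apply: ht => // z; rewrite normrM mulrAC; apply: ler_pM => //; last exact: mode_le.
    by rewrite ger0_norm ?symb_ge0// symb_le.
  rewrite dKE in e1'; move: e1' e2 e3.
  rewrite -[Rintegral _ _ _]/(Rintegral (@leb2 R) (off_ball e) (fun w => d w * kern m w)).
  move: (Rintegral _ _ _) (psum _ _ _) (psum _ _ _) (clim _ _) => I P Q S h1 h2 h3.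
  rewrite (_ : I - S = (I - Q) + (Q - P) - (S - P)); last by ring.
  rewrite (_ : _ + _ / K.+1%:R = 2 * Cs / K.+1%:R * Mk + Cp * (32 * base_mass m * e) + Ct / K.+1%:R); last by ring.
  apply: le_trans (ler_normB _ _) _; apply: lerD => //.
  by apply: le_trans (ler_normD _ _) _; exact: lerD.
apply/ler_addgt0Pr => eps eps0.
have hc : (fun K => (2 * Cs * Mk + Ct) / K.+1%:R : R) @ \oo --> (0 : R).
  rewrite -(mulr0 (2 * Cs * Mk + Ct)); apply: cvgMr; exact: cvg_harmonic.
move/cvgrPdist_le : hc => /(_ eps eps0)[K _ hK].
apply: le_trans (key K) _; rewrite lerD2l.
by have := hK K (leqnn K); rewrite /= sub0r normrN; apply: le_trans; exact: ler_norm.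
Qed.

Lemma sol_pv t (x y : R) : 0 <= t ->
  pv_integral (fun w => (sol t x y - sol t (x + w.1) (y + w.2)) * kern m w)
    (clim t (fun z => symb z * mode z 0 x y)).
Proof.
move=> t0; split=> [e e0|].
  have [C C0 hC] := glim_bound l symb_ge0 symb_le init_energy UU 0 0 0 t.
  apply: (bounded_kern_int m0 mc md mint (c := C + C) e0) => [|w].
    by apply: measurable_funB => //; exact: measurable_sol.
  by apply: le_trans (ler_normB _ _) _; apply: lerD; exact: hC.
have [C C0 hC] := sol_trunc x y t0.
have C1 : 0 < C + 1 by lra.
apply/cvgrPdist_le => eps eps0; near=> e.
have e0 : 0 < e by near: e; exact: nbhs_right_gt.
have e1 : e <= 1 by near: e; exact: nbhs_right_le.
have e2 : e <= eps / (C + 1) by near: e; apply: nbhs_right_le; rewrite divr_gt0.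
rewrite distrC; apply: le_trans (hC e e0 e1) _.
move: e2; rewrite ler_pdivlMr//; nra.
Unshelve. all: by end_near. Qed.

End Fractional.

(** * Existence of solutions *)

Section Solutions.
Variable R : realType.
Variable m : R -> R.
Variables u1 u2 th0 : R -> R -> R.
Local Notation T2 := (measurableTypeR R * measurableTypeR R)%type.

Lemma pv_scale (g : R * R -> R) (L c : R) : pv_integral g L -> pv_integral (fun y => c * g y) (c * L).
Proof.
move=> [h1 h2]; split=> [e e0|].
  exact: (integrableZl (@measurable_off_ball R e) c (h1 e e0)).
have h : (fun e : R => c * Rintegral (@leb2 R) [set y : R * R | e < enorm y.1 y.2] g) @ 0^'+ --> c * L.
  exact: cvgMr.
apply: cvg_trans h; apply: near_eq_cvg; near=> e.
rewrite RintegralZl//; first exact: (@measurable_off_ball R e).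
by apply: h1; near: e; exact: nbhs_right_gt.
Unshelve. all: by end_near. Qed.

(** The sign [sg] lets one lower barrier give bounds from both sides. Continuity at time 0 is glued
    from the initial condition and the continuity of the datum. *)
Lemma solution_evolves (theta : R -> R -> R -> R) (sg : R) :
  smooth2 th0 -> sg * sg = 1 ->
  (forall x1 x2, theta 0 x1 x2 = th0 x1 x2) ->
  smooth_on (fun t _ _ => 0 < t) theta ->
  (forall x1 x2 e, 0 < e -> exists2 d, 0 < d &
         forall t y1 y2, 0 < t < d -> `|y1 - x1| < d -> `|y2 - x2| < d ->
           `|theta t y1 y2 - th0 x1 x2| < e) ->
  (forall t x1 x2, 0 < t -> exists L,
         pv_integral (fun y => (theta t x1 x2 - theta t (x1 + y.1) (x2 + y.2))
                               * m (enorm y.1 y.2) / (enorm y.1 y.2) ^+ 2) L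
         /\ dT theta t x1 x2 + u1 x1 x2 * dX theta t x1 x2
            + u2 x1 x2 * dY theta t x1 x2 + L = 0) ->
  evolves m u1 u2 (fun t x y => sg * theta t x y).
Proof.
move=> sm0 sg2 t0E tsm tinit tpde.
have sgn : `|sg| = 1.
  by apply/eqP; rewrite -sqrp_eq1// real_normK ?num_real// expr2 sg2.
have [dth _] := tsm 1%N.
have dd (f : R -> R) (u : R) : derivable f u 1 -> is_derive u 1 (fun s => sg * f s) (sg * derive1 f u).
  move=> /derivable1_is_derive df; apply: is_derive_eq; rewrite /GRing.scale/=; ring.
split.
- move=> t x y t0; apply/continuous3P => e e0 /=.
  have sE s t' x' y' : `|sg * theta t' x' y' - sg * theta s x y| = `|theta t' x' y' - theta s x y|.
    by rewrite -mulrBr normrM sgn mul1r.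
  have [tp|] := ltP 0 t.
    have ct := tsm 0%N t x y tp.
    have [d d0 hd] := (continuous3P theta t x y).1 ct e e0.
    exists (Num.min d t) => [|t' x' y']; first by rewrite lt_min d0.
    rewrite !lt_min => /andP[h1 ht] /andP[h2 _] /andP[h3 _].
    have t'0 : 0 < t' by move: ht; rewrite ltr_norml => /andP[]; lra.
    by rewrite sE (max_l (ltW t'0)); apply: hd.
  move=> t_le0; have {t0 t_le0}-> : t = 0 by apply/eqP; rewrite eq_le t_le0 t0.
  have c0 := sm0 0%N 0 x y I.
  have [d1 d10 hd1] := (continuous3P _ 0 x y).1 c0 e e0.
  have [d2 d20 hd2] := tinit x y e e0.
  exists (Num.min d1 d2) => [|t' x' y']; first by rewrite lt_min d10.
  rewrite !lt_min => /andP[h1 h1'] /andP[h2 h2'] /andP[h3 h3'].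
  rewrite sE t0E; case: (leP t' 0) => t'0.
    by rewrite t0E; apply: (hd1 0) => //; rewrite subrr normr0.
  by apply/ltW/hd2 => //; move: h1'; rewrite subr0 (gtr0_norm t'0) t'0.
- move=> t x y tp; have [a b c] := dth t x y tp.
  by split; [case: (dd _ _ a)|case: (dd _ _ b)|case: (dd _ _ c)].
- move=> t x1 x2 tp; have [L [pvL E]] := tpde t x1 x2 tp.
  have [a b c] := dth t x1 x2 tp.
  exists (sg * L); split.
    rewrite (_ : (fun y => _) = fun y => sg * ((theta t x1 x2 - theta t (x1 + y.1) (x2 + y.2))
                               * m (enorm y.1 y.2) / (enorm y.1 y.2) ^+ 2)); first exact: pv_scale.
    by apply/funext => y; ring.
  have -> : dT (fun t x y => sg * theta t x y) t x1 x2 = sg * dT theta t x1 x2 by exact: is_derive_derive1 (dd _ _ a).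
  have -> : dX (fun t x y => sg * theta t x y) t x1 x2 = sg * dX theta t x1 x2 by exact: is_derive_derive1 (dd _ _ b).
  have -> : dY (fun t x y => sg * theta t x y) t x1 x2 = sg * dY theta t x1 x2 by exact: is_derive_derive1 (dd _ _ c).
  by rewrite -(mulr0 sg) -E; ring.
Qed.

End Solutions.

Section Existence.
Variable R : realType.
Local Notation mu := (@lebesgue_measure R).
Variable m : R -> R.
Hypothesis m0 : forall r, 0 < r -> 0 < m r.
Hypothesis mc : forall r, 0 < r -> {for r, continuous m}.
Hypothesis md : forall r s, 0 < r -> r <= s -> m s <= m r.
Hypothesis mint : (\int[mu]_(r in [set r : R | (0 < r)%R]) (m r / (1 + r))%:E < +oo)%E.
Local Notation wt := (freq_weight R).

Definition shear (ka : R) (n : nat) (_ y : R) : R := ka * sin (n%:R * y).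

Lemma shear_waves ka n : shear ka n = waves [:: (ka, 0, n%:R, - (pi / 2))].
Proof.
apply/funext => x; apply/funext => y.
by rewrite /shear /= /phase /= mul0r add0r addr0 cosBpihalf.
Qed.

Lemma shear_smooth ka n : smooth2 (shear ka n).
Proof. by rewrite shear_waves; exact: waves_smooth. Qed.

Lemma shear_le ka n x y : 0 <= ka -> `|shear ka n x y| <= ka.
Proof.
move=> k0; rewrite /shear normrM (ger0_norm k0) ler_piMr// ler_norml sin_geN1 sin_le1//.
Qed.

(** From [2 * sin t = cas t - cas (- t)]. *)
Definition shear_coef (ka : R) (n : nat) (z : int * int) : R :=
  ka / 2 * ((z == (0, n%:Z))%:R - (z == (0, - n%:Z))%:R).

Lemma shear_coef_sum ka n N x y : (n <= N)%N ->
  \sum_(k : box N) shear_coef ka n (frq k) * mode (frq k) 0 x y = shear ka n x y.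
Proof.
move=> nN.
have pick z : `|z|%N = n -> \sum_(k : box N) (frq k == (0, z))%:R * mode (frq k) 0 x y = mode (0, z) 0 x y.
  move=> hz; have [[k kz ->]|[h _]] := sum_frq (0, z) (fun k : box N => mode (frq k) 0 x y).
    by rewrite kz.
  have [i hi] : exists i : 'I_(N.*2.+1), box_coord i = 0.
    have [//|] := coord_cover R N 0; rewrite normr0 => /le_lt_trans/(_ (ltr0Sn _ N)).
    by rewrite ltxx.
  have [j hj] : exists j : 'I_(N.*2.+1), box_coord j = z.
    have [//|] := coord_cover R N z; rewrite -intr_norm -[N.+1%:R]/(N.+1%:Z%:~R) ler_int; lia.
  by case: (h (i, j)); rewrite /frq hi hj.
under eq_bigr do rewrite /shear_coef -mulrA mulrBl mulrBr.
rewrite sumrB -!mulr_sumr !pick ?absz_nat ?abszN ?absz_nat//.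
rewrite !mode0E /ang /= !mul0r !add0r intrN mulNr /cas cosN sinN /shear; field.
by [].
Qed.

Lemma shear_coef_energy ka n s : exists E, forall N,
  \sum_(k : box N) wt (frq k) ^+ (s * 2) * shear_coef ka n (frq k) ^+ 2 <= E.
Proof.
pose a : int * int := (0, n%:Z); pose b : int * int := (0, - n%:Z).
have w0 z : 0 <= wt z ^+ (s * 2) by rewrite exprn_ge0// ltW// wt_gt0.
have ka0 : 0 <= ka ^+ 2 by exact: sqr_ge0.
exists (ka ^+ 2 * wt a ^+ (s * 2) + ka ^+ 2 * wt b ^+ (s * 2)) => N.
apply: (@le_trans _ _ (\sum_(k : box N) ((frq k == a)%:R * (ka ^+ 2 * wt (frq k) ^+ (s * 2)) +
   (frq k == b)%:R * (ka ^+ 2 * wt (frq k) ^+ (s * 2))))).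
  apply: ler_sum => k _; rewrite /shear_coef -/a -/b -mulrDl.
  move: (wt _ ^+ _) (w0 (frq k)) => X X0.
  by case: (_ == a); case: (_ == b) => /=; nra.
rewrite big_split; apply: lerD; apply: sum_frq_le => [|k ->//]; exact: mulr_ge0.
Qed.

Lemma solution_exists ka n (l : seq (R * int * int)) : 0 <= ka ->
  (forall x y, enorm (vel1 l x y) (vel2 l x y) <= 1) ->
  exists theta, is_solution m (vel1 l) (vel2 l) (shear ka n) theta.
Proof.
move=> ka0 ul.
have [U [UU Uoo]] := ultra_infty.
have ie := shear_coef_energy ka n.
have sy0 := symb_ge0 m0; have syle := symb_le m0 mc md mint.
pose th := sol m l (shear_coef ka n) U.
have t0E x y : th 0 x y = shear ka n x y.
  by apply: (glim_init _ _ UU Uoo (N0 := n)) => N x' y' nN; exact: shear_coef_sum.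
have sm : smooth_on (fun t _ _ => 0 < t) th.
  by apply: (glim_smooth sy0 syle ie UU (g := 0) (al := 0) (be := 0)).
have tinit x1 x2 e : 0 < e -> exists2 d, 0 < d &
         forall t y1 y2, 0 < t < d -> `|y1 - x1| < d -> `|y2 - x2| < d ->
           `|th t y1 y2 - shear ka n x1 x2| < e.
  move=> e0; have [C C0 hC] := glim_lip l sy0 syle ie UU 0 0 0 1.
  have C1 : 0 < 3 * (C + 1) by lra.
  exists (Num.min 1 (e / (3 * (C + 1)))) => [|t y1 y2]; first by rewrite lt_min ltr01 divr_gt0.
  rewrite !lt_min => /andP[t0 /andP[t1 te]] /andP[_ h1] /andP[_ h2].
  rewrite -t0E; apply: le_lt_trans (hC 0 t x1 y1 x2 y2 (lexx 0) ler01 (ltW t0) (ltW t1)) _.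
  rewrite subr0 (gtr0_norm t0); move: te h1 h2; rewrite !ltr_pdivlMr//.
  by have := normr_ge0 (y1 - x1); have := normr_ge0 (y2 - x2); nra.
have pde t x1 x2 : 0 < t -> exists L,
         pv_integral (fun y => (th t x1 x2 - th t (x1 + y.1) (x2 + y.2))
                               * m (enorm y.1 y.2) / (enorm y.1 y.2) ^+ 2) L
         /\ dT th t x1 x2 + vel1 l x1 x2 * dX th t x1 x2
            + vel2 l x1 x2 * dY th t x1 x2 + L = 0.
  move=> t0; eexists; split.
    rewrite pv_kern; exact: (sol_pv m0 mc md mint l ie UU x1 x2 (ltW t0)).
  have -> : dT th t x1 x2 = glim l (symb m) (shear_coef ka n) U 1 0 0 t x1 x2.
    exact: is_derive_derive1 (is_derive_glim_t l sy0 syle ie UU 0 0 0 x1 x2 t0).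
  have -> : dX th t x1 x2 = glim l (symb m) (shear_coef ka n) U 0 1 0 t x1 x2.
    exact: is_derive_derive1 (is_derive_glim_x l sy0 syle ie UU 0 0 0 x1 x2 (ltW t0)).
  have -> : dY th t x1 x2 = glim l (symb m) (shear_coef ka n) U 0 0 1 t x1 x2.
    exact: is_derive_derive1 (is_derive_glim_y l sy0 syle ie UU 0 0 0 x1 x2 (ltW t0)).
  exact: (glim_pde l sy0 syle ie UU Uoo x1 x2 (ltW t0)).
exists th; split=> //.
exists ka => t x y t0.
have ev sg : sg * sg = 1 -> - ka <= sg * th t x y.
  move=> sg2; have ev := solution_evolves (shear_smooth ka n) sg2 t0E sm tinit pde.
  have [M M0 hM] := glim_bound l sy0 syle ie UU 0 0 0 t.
  have sgn : `|sg| = 1 by apply/eqP; rewrite -sqrp_eq1// real_normK ?num_real// expr2 sg2.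
  (* [A = 0] and [B = - ka] give comparison with a constant; [a = t + 1] and [smin = 1] put the
     horizon exactly at [t]. The bound [M], which depends on [t], drops out. *)
  have := @barrier_bound R m m0 mc md mint _ _ _ sg 0 (- ka) M (t + 1) 1 0 _ _ sg2 (lexx 0) (lexx 0) ltr01 _ _ ev _ _ t x y t0.
  rewrite !mul0r !mulr0 !mul0r !subr0 addr0 addrK; apply => //.
  - by move=> a b; exact: le_trans (enorm_ge1 _ _) (ul a b).
  - by move=> a b; exact: le_trans (enorm_ge2 _ _) (ul a b).
  - by rewrite lerDr.
  - by move=> *; rewrite mul0r.
  - move=> s a b s0 st; have := hM s a b s0 st.
    by rewrite -[X in X <= _ -> _]mul1r -sgn -normrM ler_norml => /andP[].
  - move=> a b; rewrite mul0r addr0 t0E.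
    have := shear_le n a b ka0; rewrite -[X in X <= _ -> _]mul1r -sgn -normrM ler_norml => /andP[//].
rewrite ler_norml; apply/andP; split.
  by have := ev 1 (mulr1 1); rewrite mul1r.
by have := ev (-1); rewrite mulrNN mulr1 mulN1r lerN2; apply.
Qed.

End Existence.

(** * Breaking the modulus *)

Section Main.
Variable R : realType.

Lemma modulus_small (rho : R -> R) (e : R) : is_modulus rho -> 0 < e ->
  exists2 d, 0 < d & forall r, 0 <= r -> r < d -> rho r < e.
Proof.
move=> [r0 _ _ rc] e0.
have := rc 0; rewrite /continuous_at => h.
have {}h : rho @ within [set r : R | 0 <= r] (nbhs 0) --> rho 0.
  by move: h; rewrite nbhs_subspace_in//=.
move/cvgrPdist_lt : h => /(_ e e0); rewrite /within/= => /nbhs_ballP[d /= d0 hd].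
exists d => // r r0' rd; have := hd r; rewrite /ball /= sub0r normrN ger0_norm// => /(_ rd r0').
by rewrite r0 sub0r normrN; apply: le_lt_trans; exact: ler_norm.
Qed.

Lemma is_derive_sin_lin (c y : R) (n : nat) :
  is_derive y 1 (fun s => c * sin (n%:R * s)) (c * n%:R * cos (n%:R * y)).
Proof.
have d : is_derive y 1 (fun s : R => n%:R * s) n%:R.
  by apply: is_derive_eq; rewrite /GRing.scale/=; ring.
have h := @is_derive1_comp _ (@sin R) (fun s => n%:R * s) y _ _ (is_derive_sin _) d.
rewrite (_ : (fun s => _) = fun s => c * (@sin R \o (fun s => n%:R * s)) s)//.
by apply: is_derive_eq; rewrite /GRing.scale/=; ring.
Qed.

Lemma is_derive_cos_lin (c y : R) (n : nat) :
  is_derive y 1 (fun s => c * cos (n%:R * s)) (- (c * n%:R * sin (n%:R * y))).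
Proof.
have d : is_derive y 1 (fun s : R => n%:R * s) n%:R.
  by apply: is_derive_eq; rewrite /GRing.scale/=; ring.
have h := @is_derive1_comp _ (@cos R) (fun s => n%:R * s) y _ _ (is_derive_cos _) d.
rewrite (_ : (fun s => _) = fun s => c * (@cos R \o (fun s => n%:R * s)) s)//.
by apply: is_derive_eq; rewrite /GRing.scale/=; ring.
Qed.

Lemma shear_C2 (ka : R) n : 0 <= ka -> ka * (1 + n%:R + n%:R ^+ 2) <= 1 -> C2norm_le (shear ka n) 1.
Proof.
move=> k0 hk.
have dyE : dy (shear ka n) = fun _ y => ka * n%:R * cos (n%:R * y).
  by apply/funext => x; apply/funext => y; exact: is_derive_derive1 (is_derive_sin_lin _ _ _).
have dyyE : dy (dy (shear ka n)) = fun _ y => - (ka * n%:R * n%:R * sin (n%:R * y)).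
  by rewrite dyE; apply/funext => x; apply/funext => y; exact: is_derive_derive1 (is_derive_cos_lin _ _ _).
have dx0 (g : R -> R) : dx (fun _ y => g y) = fun _ _ => 0.
  by apply/funext => x; apply/funext => y; rewrite /dx derive1_cst.
have n0 : 0 <= n%:R :> R by [].
have bd (c t : R) : 0 <= c -> -1 <= t -> t <= 1 -> `|c * t| <= c.
  by move=> c0 t1 t2; rewrite normrM (ger0_norm c0) ler_piMr// ler_norml t1.
exists ka, 0, (ka * n%:R), 0, 0, (ka * n%:R * n%:R); do 6 (try split).
- by move=> x y; exact: shear_le.
- by move=> x y; rewrite dx0 normr0.
- by move=> x y; rewrite dyE bd ?cos_geN1 ?cos_le1// mulr_ge0.
- by move=> x y; rewrite !dx0 normr0.
- by move=> x y; rewrite dyE dx0 normr0.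
- by move=> x y; rewrite dyyE normrN bd ?sin_geN1 ?sin_le1// !mulr_ge0.
- by apply: le_trans hk; rewrite le_eqVlt; apply/orP; left; apply/eqP; ring.
Qed.

(** The height budget: the cap starts at [- 1 + 15/8 = 7/8] times [ka]; the operator takes at most
    [60 / 480 = 1/8], the flow defect at most [1/2 * 1/4 = 1/8], and 5/8 remains. *)
Lemma gap_arith (ka H z : R) : 0 <= ka * (1 / 480 - H) -> 0 <= ka * (1 / 4 - z) ->
  5 / 8 * ka <= - ka + 15 / 8 * ka * 1 - 32 * (15 / 8 * ka) * H - ka / 2 * z.
Proof. by move=> *; lra. Qed.

(* On the bump around [(0, sg * a)], with [n a = pi/2], the phase [n y] stays within [pi/8] of [sg * pi/2], where [|sin|] exceeds [7/8]. *)
Lemma shear_bump (ka a sg x y : R) n : 0 <= ka -> 0 < a -> sg * sg = 1 -> n%:R * a = pi / 2 ->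
  - ka + 15 / 8 * ka * hat2 (sg * a) (a / 4) x y <= sg * shear ka n x y.
Proof.
move=> k0 a0 sg2 na.
have sE : sg * sin (n%:R * y) = cos (n%:R * (sg * y - a)).
  have : sg = 1 \/ sg = -1 by have : (sg - 1) * (sg + 1) == 0 by [rewrite mulrDr mulrBl sg2; lra|]; rewrite mulf_eq0 subr_eq0 addr_eq0 => /orP[]/eqP->; [left|right].
  rewrite mulrBr na cosBpihalf => -[->|->]; first by rewrite !mul1r.
  by rewrite !mulN1r mulrN sinN.
rewrite /shear [leRHS]mulrCA sE.
have [h|h] := leP (x ^+ 2 + (y - sg * a) ^+ 2) ((a / 4) ^+ 2); last first.
  rewrite (_ : hat2 _ _ _ _ = 0); last first.
    rewrite /hat2 hat_eq0// subr_le0 ler_pdivlMr ?mul1r ?ltW// exprn_gt0//; lra.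
  by have := cos_geN1 (n%:R * (sg * y - a)); nra.
have h1 := hat2_le1 (sg * a) (a / 4) x y; have h0 := hat2_ge0 (sg * a) (a / 4) x y.
have ph : (n%:R * (sg * y - a)) ^+ 2 <= 1 / 4.
  have -> : (n%:R * (sg * y - a)) ^+ 2 = n%:R ^+ 2 * (y - sg * a) ^+ 2.
    rewrite exprMn; congr (_ * _).
    rewrite (_ : sg * y - a = sg * (y - sg * a)); last by rewrite mulrBr mulrA sg2 mul1r.
    by rewrite exprMn expr2 sg2 mul1r.
  have n2 : 0 <= (n%:R : R) ^+ 2 by exact: sqr_ge0.
  apply: (@le_trans _ _ (n%:R ^+ 2 * (a / 4) ^+ 2)).
    by apply: ler_wpM2l => //; apply: le_trans h; rewrite lerDr sqr_ge0.
  rewrite (_ : n%:R ^+ 2 * (a / 4) ^+ 2 = (n%:R * a) ^+ 2 / 16); last by field.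
  rewrite na; have := pihalf_lt2 R; have := pi_ge0 R; nra.
have := cos_ge (n%:R * (sg * y - a)); nra.
Qed.

End Main.

Theorem theorem1p5 (R : realType) (m : R -> R) :
  (forall r, 0 < r -> 0 < m r) ->
  smooth1_on (fun r => 0 < r) m ->
  (forall r s, 0 < r -> r <= s -> m s <= m r) ->
  (\int[@lebesgue_measure R]_(r in [set r : R | (0 < r)%R]) (m r / (1 + r))%:E < +oo)%E ->
  (forall r s, 0 < r -> r <= s -> s < 1 -> r * m r <= s * m s) ->
  exists T : R, 0 < T /\
  exists theta0 : R -> R -> R,
    [/\ smooth2 theta0, C2norm_le theta0 1 &
    forall rho : R -> R, is_modulus rho ->
      exists u1 u2 : R -> R -> R,
        [/\ smooth2 u1, smooth2 u2,
            (forall x1 x2, dx u1 x1 x2 + dy u2 x1 x2 = 0),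
            (forall x1 x2, enorm (u1 x1 x2) (u2 x1 x2) <= 1) &
            (exists theta, is_solution m u1 u2 theta0 theta) /\
            (forall theta, is_solution m u1 u2 theta0 theta ->
               exists t, 0 <= t <= T /\ breaks rho theta t)]].
Proof.
move=> m0 msm md mint _.
have mc r : 0 < r -> {for r, continuous m}.
  move=> r0; have h := msm 0%N r 0 0 r0.
  apply/cvgrPdist_le => e e0; have [d d0 hd] := (continuous3P _ r 0 0).1 h e e0.
  apply/nbhs_ballP; exists d => // s /= rs.
  by rewrite distrC; apply: (hd s 0 0); rewrite ?subrr ?normr0// distrC.
have e480 : 0 < 1 / 480 :> R by lra.
have [d d0 hd] := Hk_small m0 mc mint e480.
(* The bound [1 / 16] gives [a <= 1 / 4], the range on which the flow is controlled. *)
pose mn := Num.min d (1 / 16).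
have mn0 : 0 < mn by rewrite lt_min d0//=; lra.
pose n := (Num.bound (1 / mn)).+1.
have nmn : 1 / mn < n%:R.
  have := archi_boundP (_ : 0 <= 1 / mn); rewrite divr_ge0 ?ltW// => /(_ isT) h.
  by apply: lt_trans h _; rewrite ltr_nat.
have n0 : 0 < n%:R :> R by rewrite ltr0n.
pose a : R := pi / 2 / n%:R.
have na : n%:R * a = pi / 2 by rewrite /a mulrC divfK// gt_eqF.
have a0 : 0 < a by rewrite divr_gt0// divr_gt0// pi_gt0.
have a4 : a / 4 <= mn.
  have : 1 <= mn * n%:R by rewrite mulrC -ler_pdivrMr ?ltW.
  have := pihalf_lt2 R; nra.
have a1 : a <= 1 / 4.
  have : mn <= 1 / 16 by rewrite ge_min lexx orbT.
  by lra.
have Ha : Hk m (a / 4) <= 1 / 480.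
  by apply: hd; [rewrite divr_gt0|apply: le_trans a4 _; rewrite ge_min lexx].
pose ka : R := (1 + n%:R + n%:R ^+ 2)^-1.
have kd : 0 < 1 + n%:R + n%:R ^+ 2 :> R by have := sqr_ge0 (n%:R : R); lra.
have ka0 : 0 < ka by rewrite invr_gt0.
have kan : ka * (1 + n%:R + n%:R ^+ 2) <= 1 by rewrite /ka mulVf// gt_eqF.
(* The time bound [a] is when the centres would reach the origin. It and the datum are fixed here,
   before the modulus. *)
clearbody ka a; exists a; split=> //; exists (shear ka n); split.
- exact: shear_smooth.
- by apply: shear_C2 => //; exact: ltW.
move=> rho rhoM.
(* The caps will differ by at least [5/4 * ka], so it suffices that the modulus is below [ka] at
   their final distance [2 * smin]. *)
have [dr dr0 hdr] := modulus_small rhoM ka0.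
pose smin := Num.min a (dr / 4).
have smin0 : 0 < smin by rewrite lt_min a0 divr_gt0.
have smina : smin <= a by rewrite ge_min lexx.
have smindr : 2 * smin < dr.
  have : smin <= dr / 4 by rewrite ge_min lexx orbT.
  by lra.
clearbody smin.
(* With [A = 15/8 * ka], the accuracy [smin / 240] makes the defect cost [64 * A * ep / smin] equal
   to [ka / 2] per unit of time, independently of [smin]. *)
have [ep0 ep1 sm4] : [/\ 0 < smin / 240, smin / 240 <= 1 & smin <= 1 / 4] by split; lra.
have [l [ul flow]] := flow_exists ep0 ep1 smin0 sm4.
exists (vel1 l), (vel2 l); split.
- exact: vel1_smooth.
- exact: vel2_smooth.
- exact: vel_div0.
- exact: ul.
split; first exact: (solution_exists m0 mc md mint n (ltW ka0) ul).
move=> theta [t0E tsm tinit [M hM] pde].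
exists (a - smin); split; first by rewrite subr_ge0 smina/= gerBl ltW.
have ev sg : sg * sg = 1 -> 5 / 8 * ka <= sg * theta (a - smin) 0 (sg * smin).
  move=> sg2; have ev := solution_evolves (shear_smooth ka n) sg2 t0E tsm tinit pde.
  have sgn : `|sg| = 1 by apply/eqP; rewrite -sqrp_eq1// real_normK ?num_real// expr2 sg2.
  have A0 : 0 <= 15 / 8 * ka by rewrite mulr_ge0 ?divr_ge0// ltW.
  have h := @barrier_bound R m m0 mc md mint _ _ _ sg (15 / 8 * ka) (- ka) M a smin (smin / 240) _ _ sg2 A0 _ smin0 smina _ ev _ _ (a - smin) 0 (sg * smin) _ (lexx _).
  have {h} := h.
  have -> : a - (a - smin) = smin by ring.
  have -> : hat2 (sg * smin) (smin / 4) 0 (sg * smin) = 1.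
    by rewrite /hat2 subrr expr0n add0r mul0r subr0 /hat max_r// expr1n.
  have -> : 64 * (15 / 8 * ka) * (smin / 240) / smin * (a - smin) = ka / 2 * (a - smin).
    by field; rewrite gt_eqF.
  move=> h; apply: le_trans (h _ _ _ _ _ _ _).
  - apply: gap_arith; first by rewrite mulr_ge0 ?subr_ge0// ltW.
    apply: mulr_ge0; first exact: ltW.
    by rewrite subr_ge0; apply: le_trans a1; rewrite gerBl ltW.
  - by move=> x y; exact: le_trans (enorm_ge1 _ _) (ul x y).
  - by move=> x y; exact: le_trans (enorm_ge2 _ _) (ul x y).
  - exact: ltW.
  - by move=> s x y s1 s2 s3; apply: mulr_ge0 => //; apply: flow => //; exact: le_trans s2 a1.
  - move=> t x y t0 _; have := hM t x y t0.
    by rewrite -[X in X <= _ -> _]mul1r -sgn -normrM ler_norml => /andP[].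
  - by move=> x y; rewrite t0E; exact: shear_bump (ltW ka0) a0 sg2 na.
  - by rewrite subr_ge0.
have e1 := ev 1 (mulr1 1); have e2 := ev (-1) (_ : -1 * -1 = 1).
exists 0, smin, 0, (- smin); rewrite subrr opprK.
have -> : enorm 0 (smin + smin) = 2 * smin.
  by rewrite /enorm expr0n add0r sqrtr_sqr ger0_norm ?addr_ge0 ?ltW// mulr2n mulrDl mul1r.
apply: lt_le_trans (hdr (2 * smin) _ smindr) _; first by rewrite mulr_ge0// ltW.
apply: le_trans (ler_norm _).
move: e1; rewrite !mul1r; move: e2; rewrite mulrNN mulr1 !mulN1r => /(_ erefl); lra.
Qed.
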